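(* Let $Z=(X,Y)$ be a 3D piecewise $\mathcal C^r$ vector field on $K_0\subset\mathbb R^3$ admitting a sliding Shilnikov orbit $\Gamma$ connecting a hyperbolic pseudo saddle-focus $p_0\in M^s$ to itself and intersecting $\partial M^s$ at $q_0$; let $\mathcal U\subset\partial M^s$ be a sufficiently small neighbourhood of $q_0$ and $\pi$ the first return map to $\mathcal U$. Given a compact $\pi$-invariant set $K\subset\mathcal U$, there are $k\in\mathbb N$ and a $\sigma_k$-invariant set $\Omega\subset\Sigma_2\times\Sigma_k^*$ such that $\pi|K$ is conjugate to $\sigma_k|\Omega$.
   Context: **Filippov systems.** $K_0$ is the closure of an open subset of $\mathbb R^3$, $h:K_0\to\mathbb R$ is differentiable (as smooth as needed for the expressions below) with $0$ as a regular value, $M=h^{-1}(0)$, and $X,Y$ are $\mathcal C^r$ vector fields on $K_0$, $r\ge1$. $Z=(X,Y)$ denotes the vector field equal to $X$ where $h>0$ and to $Y$ where $h<0$. For a vector field $W$, $Wh(\xi)=\langle\nabla h(\xi),W(\xi)\rangle$ and $W^2h=W(Wh)$. The sliding region is $M^s=\{\xi\in M: Xh(\xi)<0,\ Yh(\xi)>0\}$, with boundary $\partial M^s$ in $M$. The sliding vector field is $\widetilde Z=\dfrac{Yh\,X-Xh\,Y}{Yh-Xh}$. A tangency point of $X$ is $\xi \in M$ with $Xh(\xi)=0$; it is a visible fold of $X$ if also $X^2h(\xi)>0$. A hyperbolic pseudo saddle-focus $p_0\in M^s$ is a point with $\widetilde Z(p_0)=0$ that is an unstable hyperbolic focus of $\widetilde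 Z$. **Sliding Shilnikov orbit.** $Z$ has a sliding Shilnikov orbit through $p_0\in M^s$ and $q_0\in\partial M^s$ if $p_0$ is a hyperbolic pseudo saddle-focus, $q_0$ is a visible fold of $X$, (j) the orbit through $q_0$ following $\widetilde Z$ converges to $p_0$ backward in time, and (jj) the orbit starting at $q_0$ and following $X$ spends a time $t_0>0$ to reach $p_0$. The loop $\Gamma$ formed by these two orbit pieces and $p_0,q_0$ is the sliding Shilnikov orbit. **First return map.** The forward Filippov trajectory of a point $\xi\in\partial M^s$ near $q_0$ follows $X$ until it reaches $M$ at a point $\theta(\xi)\in M^s$ near $p_0$; then it follows $\widetilde Z$ until reaching $\partial M^s$. For a small neighbourhood $\mathcal U$ of $q_0$ in $\partial M^s$, $\pi(\xi)$ is the first point of $\mathcal U$ reached by this trajectory at positive time; $\pi$ is defined at those $\xi\in\mathcal U$ whose forward trajectory returns to $\mathcal U$ (this excludes $q_0$, as $\theta(q_0)=p_0$). A set $B$ is invariant under a map $f$ if $f$ is defined on $B$ and $f(B)\subset B$. **Symbolic spaces.** $\Sigma_2=\{0,1\}^{\mathbb N}$ and $\Sigma_k^*=\{1,\dots,k\}^{\mathbb N}$, with the product topologies of discrete spaces; $\sigma_k:\Sigma_2\times\Sigma_k^*\to\Sigma_2\times\Sigma_k^*$ is the shift $\sigma_k((x_n)_n,(y_m)_m)=((x_{n+1})_n,(y_{m+1})_m)$. Conjugate means topologically conjugate, i.e. via a homeomorphism intertwining the two maps. *)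

(* Defs.v *)
From HB Require Import structures.
From mathcomp Require Import all_boot all_order all_algebra.
From mathcomp Require Import all_classical all_reals all_analysis.
From mathcomp Require Import complex.

Set Implicit Arguments.
Unset Strict Implicit.
Unset Printing Implicit Defensive.

Import Order.TTheory GRing.Theory Num.Theory.
Import numFieldNormedType.Exports.

Local Open Scope classical_set_scope.
Local Open Scope ring_scope.

Section Calculus.
Context {R : realType}.
Local Notation E := 'rV[R]_3.

(* [f] is of class C^k at every point of [A]; meant for [A] open. *)
Fixpoint class_C (k : nat) {W : normedModType R} (A : set E) (f : E -> W) : Prop :=
  match k with
  | 0 => forall x, A x -> {for x, continuous f}
  | k'.+1 => (forall x, A x -> differentiable f x) /\
             forall v : E, class_C k' A ('D_v f)
  end.

(* C^k on a set that need not be open: the values of the total function [f]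
   outside [K] serve as a C^k extension of [f|K] to a neighbourhood of [K]. *)
Definition class_C_on (k : nat) {W : normedModType R} (K : set E) (f : E -> W) :=
  exists A : set E, [/\ open A, K `<=` A & class_C k A f].

Definition dot (u v : E) : R := \sum_i u 0 i * v 0 i.

Definition grad (f : E -> R) (x : E) : E := \row_i 'D_(delta_mx 0 i) f x.

Definition lie (W : E -> E) (f : E -> R) : E -> R :=
  fun x => dot (grad f x) (W x).

(* [c] is, on the interval [I], a solution of x' = W(x) that stays in [D].
   Continuity up to the endpoints of [I] together with the equation in the
   interior gives the equation at the endpoints (one-sided) for continuous W. *)
Definition solution (W : E -> E) (D : set E) (I : interval R) (c : R -> E) :=
  [/\ {within [set` I], continuous c},
      (forall t, t \in I -> D (c t)) &
      (forall t, [set` I]° t -> is_derive t 1 c (W (c t)))].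

End Calculus.

Section Filippov.
Context {R : realType}.
Local Notation E := 'rV[R]_3.

Record filippov := Filippov {
  dom : set E;
  sw : E -> R;    (* the function h *)
  fX : E -> E;
  fY : E -> E }.

Context (Z : filippov).
Local Notation h := (sw Z).
Local Notation X := (fX Z).
Local Notation Y := (fY Z).

Definition switching : set E := [set x | dom Z x /\ h x = 0].

(* h is asked to be C^2 so that Xh, Yh are C^1 and X(Xh) makes sense. *)
Definition piecewise_C (r : nat) :=
  [/\ (exists O : set E, open O /\ dom Z = closure O),
      class_C_on 2 (dom Z) h,
      (forall x, switching x -> grad h x != 0),
      class_C_on r (dom Z) X &
      class_C_on r (dom Z) Y].

Definition sliding : set E :=
  [set x | [/\ switching x, lie X h x < 0 & 0 < lie Y h x]].

Definition sliding_boundary : set E :=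
  switching `&` closure sliding `&` closure (switching `\` sliding).

Definition slide (x : E) : E :=
  (lie Y h x - lie X h x)^-1 *: (lie Y h x *: X x - lie X h x *: Y x).

(* Where the quotient defining the sliding vector field is meaningful. *)
Definition slide_dom : set E :=
  [set x | switching x /\ lie Y h x - lie X h x != 0].

Definition visible_fold (x : E) :=
  [/\ switching x, lie X h x = 0 & 0 < lie X (lie X h) x].

(* The sliding vector field is tangent to M, so at a zero p its differential
   preserves T_p M = (grad h p)^perp. The rows of B are a basis of T_p M and A is
   the matrix, in this basis, of the restriction of the differential (vectors
   are rows, matrices act on the right). *)
Definition unstable_hyperbolic_focus (p : E) :=
  exists (B : 'M[R]_(2, 3)) (A : 'M[R]_2),
    [/\ row_free B,
        (forall i, dot (grad h p) (row i B) = 0),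
        B *m 'J slide p = A *m B &
        forall l : R[i], eigenvalue (map_mx (real_complex R) A) l ->
          0 < complex.Re l /\ complex.Im l != 0].

Definition pseudo_saddle_focus (p : E) :=
  [/\ sliding p, slide p = 0 & unstable_hyperbolic_focus p].

(* On [0, s] the curve c follows X through the region h > 0 where Z = X,
   and c s is the first point of M that it reaches after time 0. *)
Definition follows_X (s : R) (c : R -> E) :=
  [/\ solution X (dom Z) `[0, s] c,
      (forall t, 0 < t < s -> 0 < h (c t)) & switching (c s)].

Definition sliding_shilnikov (p0 q0 : E) :=
  [/\ pseudo_saddle_focus p0,
      sliding_boundary q0,
      visible_fold q0,
      (exists c : R -> E,
        [/\ solution slide slide_dom `]-oo, 0] c,
            (forall t, t < 0 -> sliding (c t)),
            c 0 = q0 &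
            c t @[t --> -oo%R] --> p0]) &
      (exists (t0 : R) (c : R -> E),
        [/\ 0 < t0, follows_X t0 c, c 0 = q0 & c t0 = p0])].

(* The trajectory from x: along X up to the point c s of the sliding region,
   then along the sliding vector field until it reaches the boundary of the
   sliding region, at time T. *)
Definition forward_trajectory (x : E) (s T : R) (c : R -> E) :=
  [/\ 0 < s < T /\ c 0 = x,
      follows_X s c,
      solution slide slide_dom `[s, T] c,
      (forall t, s <= t < T -> sliding (c t)) &
      sliding_boundary (c T)].

Definition first_return (U : set E) (x y : E) :=
  exists (s T : R) (c : R -> E), forward_trajectory x s T c /\
    exists t, [/\ 0 < t <= T, c t = y, U y & forall u, 0 < u < t -> ~ U (c u)].

Definition return_dom (U : set E) : set E :=
  [set x | U x /\ exists y, first_return U x y].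

(* Only meaningful on [return_dom U]; [get] is a (by uniqueness of solutions, the)
   witness. *)
Definition return_map (U : set E) (x : E) : E := get (first_return U x).

End Filippov.

(* A partial map is given by a domain D and a total function f. *)
Definition invariant_set {T : Type} (D : set T) (f : T -> T) (B : set T) :=
  B `<=` D /\ f @` B `<=` B.

Definition homeomorphism_on {S T : topologicalType} (A : set S) (B : set T)
    (phi : S -> T) :=
  [/\ set_bij A B phi,
      {within A, continuous phi} &
      exists psi : T -> S,
        {within B, continuous psi} /\ forall x, A x -> psi (phi x) = x].

Definition conjugate_on {S T : topologicalType} (A : set S) (f : S -> S)
    (B : set T) (g : T -> T) :=
  exists phi : S -> T,
    homeomorphism_on A B phi /\ forall x, A x -> phi (f x) = g (phi x).

(* {1, ..., k}^N, the symbols being indexed from 0. *)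
Definition Sigma_star (k : nat) : topologicalType :=
  prod_topology (fun _ : nat => discrete_topology 'I_k).

Definition sigma (k : nat) (w : cantor_space * Sigma_star k) :
    cantor_space * Sigma_star k :=
  (fun n => w.1 n.+1, fun m => w.2 m.+1).

(* Main.v *)
Require Import Defs.
From HB Require Import structures.
From mathcomp Require Import all_boot all_order all_algebra.
From mathcomp Require Import all_classical all_reals all_analysis.
From mathcomp Require Import complex ring lra.

Set Implicit Arguments.
Unset Strict Implicit.
Unset Printing Implicit Defensive.

Import Order.TTheory GRing.Theory Num.Theory.
Import numFieldNormedType.Exports.

Local Open Scope classical_set_scope.
Local Open Scope ring_scope.

(* Near [q0] the boundary of the sliding region lies on the curve
   [h = Xh = 0], which a linear coordinate [u] parametrizes bi-Lipschitzly. A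
   turn of the return map follows X to a point [theta] near [p0] and then
   spirals out along the sliding field. Take two turns whose sliding parts last
   [t1 <= t2] with [t2 - t1] small, and run these parts backward. For the time
   [t1], which is long, they contract differences by as large a factor as we
   please. The points reached then differ, to first order, by
   [(s - t A) (theta2 - p0)] up to a nonzero factor, where [s] and [t] are
   proportional to the difference of the starting points and to [t2 - t1], and
   A is the linearized sliding field. As A has no real eigenvalue, this cannot
   be small compared with [s]. So the return map locally doubles differences of
   [u] on K. Hence [u(K)] contains no interval, since the images of one would
   have unbounded length; K splits into finitely many relatively open pieces of
   small diameter, and the itinerary through these pieces is the conjugacy. *)

(** * Vectors and curves *)

(** The arrival points differ by a multiple of [theta2 - p0] for this reason: [q0] is carried to
    [p0], and the starting points lie on a differentiable curve through [q0]. Hence three starting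
    points [x1], [x2], [q0] have nearly proportional differences, and the arcs of X preserve this.
    The contraction is arbitrarily strong because the backward orbit of [q0] tends to [p0] without
    reaching it, so that arriving very near [p0] takes a long time. The delay [t2 - t1] is the
    obstacle: it shifts the second point along the flow and, along a real eigendirection, could undo
    the difference of the arrival points. The fields are only C^1, and no derivative of a flow with
    respect to its initial point is taken. All estimates concern differences of trajectories,
    through strict differentiability and Gronwall's inequality; the proportionality above comes from
    applying Gronwall to a weighted combination of two differences. Restricting to small [t2 - t1]
    is harmless: on K the duration of the sliding part is continuous, so nearby points have nearly
    equal durations. *)

Section RowVectors.
Context {R : realType}.
Local Notation E := 'rV[R]_3.
Implicit Types (u v w x y z : E) (a b e t s : R).

Lemma coord_le_norm v i : `|v 0 i| <= `|v|.
Proof.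
rewrite [leRHS]/Num.Def.normr/= mx_normrE.
exact: (le_bigmax _ (fun ij : 'I_1 * 'I_3 => `|v ij.1 ij.2|) (0, i)).
Qed.

Lemma norm_le_coord v a : 0 <= a -> (forall i, `|v 0 i| <= a) -> `|v| <= a.
Proof.
move=> a0 va; rewrite [leLHS]/Num.Def.normr/= mx_normrE.
by apply: bigmax_le => // -[i j] _ /=; rewrite ord1.
Qed.

Lemma dotC u v : dot u v = dot v u.
Proof. by apply: eq_bigr => i _; rewrite mulrC. Qed.

Lemma dotDr u v w : dot u (v + w) = dot u v + dot u w.
Proof. by rewrite /dot -big_split; apply: eq_bigr => i _; rewrite mxE mulrDr. Qed.

Lemma dotZr u a v : dot u (a *: v) = a * dot u v.
Proof. by rewrite /dot big_distrr; apply: eq_bigr => i _; rewrite mxE /=; ring. Qed.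

Lemma dotNr u v : dot u (- v) = - dot u v.
Proof. by rewrite -scaleN1r dotZr mulN1r. Qed.

Lemma dotBr u v w : dot u (v - w) = dot u v - dot u w.
Proof. by rewrite dotDr dotNr. Qed.

Lemma dotDl u v w : dot (u + v) w = dot u w + dot v w.
Proof. by rewrite dotC dotDr !(dotC w). Qed.

Lemma dotZl a u v : dot (a *: u) v = a * dot u v.
Proof. by rewrite dotC dotZr dotC. Qed.

Lemma dotNl u v : dot (- u) v = - dot u v.
Proof. by rewrite dotC dotNr dotC. Qed.

Lemma dotBl u v w : dot (u - v) w = dot u w - dot v w.
Proof. by rewrite dotDl dotNl. Qed.

Lemma dot0r u : dot u 0 = 0.
Proof. by rewrite -(scale0r 0) dotZr mul0r. Qed.

(** The norm of row vectors is the maximum norm, so the Cauchy-Schwarz inequality costs a factor 3,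
    the number of coordinates. The factors 3 that recur below come from here. *)
Lemma dot_le u v : `|dot u v| <= 3 * `|u| * `|v|.
Proof.
rewrite (le_trans (ler_norm_sum _ _ _))//.
rewrite (@le_trans _ _ (\sum_(i < 3) `|u| * `|v|))//; last first.
  by rewrite sumr_const card_ord -mulrA [leRHS]mulr_natl.
by apply: ler_sum => i _; rewrite normrM ler_pM// coord_le_norm.
Qed.

Lemma dotvv_le v : dot v v <= 3 * `|v| ^+ 2.
Proof. by rewrite (le_trans (ler_norm _))// (le_trans (dot_le _ _))// -mulrA. Qed.

Lemma le_dotvv v : `|v| ^+ 2 <= dot v v.
Proof.
have dge0 : 0 <= dot v v by apply: sumr_ge0 => i _; rewrite -expr2 sqr_ge0.
rewrite -[leRHS]sqr_sqrtr// ler_sqr ?nnegrE ?sqrtr_ge0//.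
apply: norm_le_coord; rewrite ?sqrtr_ge0// => i.
rewrite -sqrtr_sqr ler_sqrt// /dot (bigD1 i)//= -expr2 lerDl.
by apply: sumr_ge0 => j _; rewrite -expr2 sqr_ge0.
Qed.

Lemma dot_delta (v : E) i : dot (delta_mx 0 i) v = v 0 i.
Proof.
rewrite /dot (bigD1 i)//= big1 ?addr0 => [|j ji]; rewrite mxE ?eqxx/= ?mul1r//.
by rewrite eq_sym (negPf (_ : i != j)) ?mul0r// eq_sym.
Qed.

End RowVectors.

(** * Gronwall estimates and continuation arguments for curves *)

Section RealCurves.
Context {R : realType}.
Implicit Types (a b e t s : R).

Lemma within_itvP {V : normedModType R} (c : R -> V) a b :
  {within `[a, b], continuous c} <->
  forall t, a <= t <= b -> forall e, 0 < e -> exists2 d : R, 0 < d &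
    forall s, a <= s <= b -> `|s - t| < d -> `|c s - c t| < e.
Proof.
rewrite subspace_continuousP; split=> [cc t tab e e0|cc t /=].
  have /cc/cvgrPdist_lt/(_ _ e0) : `[a, b]%classic t by rewrite /= in_itv.
  move=> /nbhs_ballP[d d0 dP]; exists d => // s sab std.
  have H := dP s; rewrite distrC; apply: H; last by rewrite /= in_itv.
by rewrite /ball/= distrC.
rewrite in_itv /= => tab; apply/cvgrPdist_lt => e e0.
have [d d0 dP] := cc t tab e e0.
apply/nbhs_ballP; exists d => // s; rewrite /ball/= distrC => std.
by rewrite in_itv/= => sab; rewrite distrC; apply: dP.
Qed.

Lemma within_sub {V : normedModType R} (c : R -> V) a b a' b' :
  a <= a' -> b' <= b ->
  {within `[a, b], continuous c} -> {within `[a', b'], continuous c}.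
Proof.
move=> aa bb; apply: continuous_subspaceW => t /=; rewrite !in_itv/=.
by move=> /andP[? ?]; apply/andP; split; [exact: le_trans aa _|exact: le_trans bb].
Qed.

Lemma within_comp {V W : normedModType R} (c : R -> V) (g : V -> W) a b :
  (forall t, a <= t <= b -> {for c t, continuous g}) ->
  {within `[a, b], continuous c} -> {within `[a, b], continuous (g \o c)}.
Proof.
move=> cg; apply: within_continuous_comp => _ /set_mem[t tab <-].
by apply: cg; move: tab; rewrite /= in_itv.
Qed.

Lemma gronwall1 (g dg : R -> R) (K a b : R) : a <= b ->
  {within `[a, b], continuous g} ->
  (forall t, a < t < b -> is_derive t 1 g (dg t)) ->
  (forall t, a < t < b -> dg t <= K * g t) ->
  g b <= expR (K * (b - a)) * g a.
Proof.
move=> ab cg dgt dgle.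
pose w : R -> R := fun t => expR (- K * t) * g t.
have dw t : a < t < b ->
    is_derive t 1 w (expR (- K * t) * (dg t - K * g t)).
  move=> /dgt dgt'.
  have dE : is_derive t 1 (fun t : R => expR (- K * t)) (- K * expR (- K * t)).
    have d1 : is_derive t 1 (fun t : R => - K * t) (- K).
      have := is_deriveZ (- K) (is_derive_id t (1 : R)).
      by rewrite /GRing.scale/= mulr1.
    have := is_derive1_comp (is_derive_expR (- K * t)) d1.
    by rewrite mulrC.
  have := is_deriveM dE dgt'.
  move=> H; apply: is_derive_eq; rewrite /GRing.scale/=; ring.
have cw : {within `[a, b], continuous w}.
  move=> t; apply: (@continuousM R (subspace `[a, b]) (fun t => expR (- K * t)) g t); last exact: cg.
  apply: continuous_subspaceT => {}t.
  apply: (continuous_comp (f := fun x : R => - K * x)); last exact: continuous_expR.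
  exact: mulrl_continuous.
have wab : w b <= w a.
  case: ltgtP ab => // [ab _|-> //].
  have dw' t : t \in `]a, b[ -> is_derive t 1 w (expR (- K * t) * (dg t - K * g t)).
    by rewrite in_itv/=; exact: dw.
  have [t tab wE] := MVT ab dw' cw.
  move: tab; rewrite in_itv/= => tab.
  rewrite -subr_le0 wE; apply: mulr_le0_ge0; last by rewrite subr_ge0 ltW.
  by apply: mulr_ge0_le0; [exact: expR_ge0|rewrite subr_le0; exact: dgle].
have -> : g b = expR (K * b) * w b.
  by rewrite /w mulrA -expRD mulNr subrr expR0 mul1r.
have -> : expR (K * (b - a)) * g a = expR (K * b) * w a.
  by rewrite /w mulrA -expRD mulrBr mulNr.
by rewrite ler_pM2l ?expR_gt0.
Qed.

Lemma gronwall1_ge (g dg : R -> R) (K a b : R) : a <= b ->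
  {within `[a, b], continuous g} ->
  (forall t, a < t < b -> is_derive t 1 g (dg t)) ->
  (forall t, a < t < b -> K * g t <= dg t) ->
  expR (K * (b - a)) * g a <= g b.
Proof.
move=> ab cg dgt dgge; rewrite -lerN2 -mulrN.
apply: (@gronwall1 (fun t => - g t) (fun t => - dg t)) => //.
- by apply: within_comp cg => t _; exact: opp_continuous.
- by move=> t /dgt dgt'; exact: is_deriveN.
- by move=> t /dgge; rewrite mulrN lerN2.
Qed.

(** The times up to which [g <= M] holds form an interval that contains its supremum by continuity;
    there the strict bound supplied by the step hypothesis leaves room to go further, so the
    supremum is [b]. In this way an estimate valid only near a reference orbit confirms itself. *)
Lemma bootstrap (g : R -> R) (M a b : R) : a <= b ->
  {within `[a, b], continuous g} -> g a < M ->
  (forall t, a <= t <= b -> (forall s, a <= s <= t -> g s <= M) -> g t < M) ->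
  forall t, a <= t <= b -> g t < M.
Proof.
move=> ab /within_itvP cg gaM step.
suff H : forall t, a <= t <= b -> forall s, a <= s <= t -> g s <= M.
  by move=> t tab; apply: step => // s; exact: H.
pose A := [set t | a <= t <= b /\ forall s, a <= s <= t -> g s <= M].
have Aa : A a.
  by split=> [|s /le_anti <-]; rewrite ?lexx ?ab// ltW.
have supA : has_sup A.
  by split; [exists a|exists b => t [/andP[]]].
have aS : a <= sup A by apply: ub_le_sup Aa; exact: supA.2.
have Sb : sup A <= b by apply: ge_sup; [exists a|move=> t [/andP[]]].
have ltS s : a <= s < sup A -> g s <= M.
  move=> /andP[as_ sS]; have [t [_ tP] st] := sup_gt supA.1 sS.
  by apply: tP; rewrite as_ ltW.
have SAB : a <= sup A <= b by rewrite aS.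
have gSM : g (sup A) <= M.
  rewrite leNgt; apply/negP => MgS.
  have aS' : a < sup A.
    by rewrite lt_neqAle aS andbT; apply: contraTneq MgS => <-; rewrite -leNgt ltW.
  have e0 : 0 < g (sup A) - M by rewrite subr_gt0.
  have [d d0 dP] := cg _ SAB _ e0.
  pose s := Num.max a (sup A - d / 2).
  have sS : s < sup A by rewrite /s gt_max aS'/= ltrBlDr ltrDl divr_gt0.
  have as_ : a <= s by rewrite /s le_max lexx.
  have := dP s; rewrite as_ (le_trans (ltW sS) Sb) => /(_ isT).
  have : `|s - sup A| < d.
    rewrite distrC gtr0_norm ?subr_gt0//.
    have : sup A - d / 2 <= s by rewrite /s le_max lexx orbT.
    lra.
  move=> -> /(_ isT).
  have := ltS s; rewrite as_ sS => /(_ isT).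
  rewrite distrC ltr_norml => ? /andP[? ?]; lra.
have leS s : a <= s <= sup A -> g s <= M.
  move=> /andP[as_]; rewrite le_eqVlt => /predU1P[->//|sS].
  by apply: ltS; rewrite as_.
have gS : g (sup A) < M by apply: step leS; rewrite aS.
move: Sb; rewrite le_eqVlt => /predU1P[<-|Sb].
  by move=> t /andP[_ tS] s /andP[as_ st]; apply: leS; rewrite as_ (le_trans st).
have e0 : 0 < M - g (sup A) by rewrite subr_gt0.
have [d d0 dP] := cg _ SAB _ e0.
pose t := Num.min b (sup A + d / 2).
have tS : sup A < t by rewrite /t lt_min Sb ltrDl divr_gt0.
have tb : t <= b by rewrite /t ge_min lexx.
have tA : A t.
  split=> [|s /andP[as_ st]]; first by rewrite tb (le_trans aS) ?ltW.
  have [sS|Ss] := leP s (sup A); first by apply: leS; rewrite as_.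
  have := dP s; rewrite as_ (le_trans st tb) => /(_ isT).
  have : `|s - sup A| < d.
    rewrite gtr0_norm ?subr_gt0//.
    have : t <= sup A + d / 2 by rewrite /t ge_min lexx orbT.
    lra.
  by move=> -> /(_ isT); rewrite ltr_norml => /andP[? ?]; lra.
have := ub_le_sup supA.2 tA; rewrite leNgt tS => //.
Qed.

Lemma is_derive_coord (z : R -> 'rV[R]_3) w t i :
  is_derive t 1 z w -> is_derive t 1 (fun t => z t 0 i) (w 0 i).
Proof.
move=> [dz zw]; have /derivable_mxP/(_ 0 i) H := dz.
by apply: DeriveDef => //; rewrite -zw derive_mx// mxE.
Qed.

Lemma is_derive_dotr (u : 'rV[R]_3) (z : R -> 'rV[R]_3) w t :
  is_derive t 1 z w -> is_derive t 1 (fun t => dot u (z t)) (dot u w).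
Proof.
move=> dz.
have -> : (fun t => dot u (z t)) = \sum_(i < 3) (fun t => u 0 i * z t 0 i).
  by apply/funext => s; rewrite fct_sumE.
apply: is_derive_sum => i; exact: (is_deriveZ (u 0 i) (is_derive_coord i dz)).
Qed.

Lemma is_derive_dotvv (z : R -> 'rV[R]_3) w t :
  is_derive t 1 z w -> is_derive t 1 (fun t => dot (z t) (z t)) (2 * dot (z t) w).
Proof.
move=> dz.
have -> : (fun t => dot (z t) (z t)) = \sum_(i < 3) (fun t => z t 0 i * z t 0 i).
  by apply/funext => s; rewrite fct_sumE.
rewrite /dot big_distrr/=; apply: is_derive_sum => i.
have H := is_deriveM (is_derive_coord i dz) (is_derive_coord i dz).
by apply: is_derive_eq H _; rewrite /GRing.scale/=; ring.
Qed.

Lemma dot_continuous (u : 'rV[R]_3) : continuous (dot u).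
Proof.
apply: continuous_big => //; first exact: add_continuous.
by move=> i _ x; apply: continuousM; [exact: cst_continuous|exact: coord_continuous].
Qed.

Lemma dotvv_continuous : continuous (fun v : 'rV[R]_3 => dot v v).
Proof.
apply: continuous_big => //; first exact: add_continuous.
by move=> i _ x; apply: continuousM; exact: coord_continuous.
Qed.

(** Growth factor over a time [D]. The rate bounds the logarithmic derivative of [dot z z + m ^+ 2],
    the 6 being 2 from differentiating a square times 3 from [dot_le]. The leading 2 covers the
    passage between [dot v v] and the squared maximum norm; the square root of the exponential is
    not taken. *)
Definition gron (L D : R) : R := 2 * expR (6 * (L + 1) * D).

Lemma gron_ge2 L D : 0 <= L -> 0 <= D -> 2 <= gron L D.
Proof.
move=> L0 D0; rewrite /gron -{1}(mulr1 2) ler_pM2l//.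
by rewrite -expR0 ler_expR; rewrite !mulr_ge0// addr_ge0.
Qed.

Lemma gron_le L D D' : 0 <= L -> D <= D' -> gron L D <= gron L D'.
Proof. by move=> L0 DD; rewrite /gron ler_pM2l// ler_expR ler_wpM2l//; lra. Qed.

(** Adding [m ^+ 2] to the squared length turns the affine bound on [w] into a linear differential
    inequality for [g]. As it bounds the absolute value of [dg], it can be integrated in both
    directions of time. *)
Lemma gronwall_vec (z w : R -> 'rV[R]_3) L m a b :
  a <= b -> 0 <= L -> 0 <= m -> {within `[a, b], continuous z} ->
  (forall t, a < t < b -> is_derive t 1 z (w t)) ->
  (forall t, a < t < b -> `|w t| <= L * `|z t| + m) ->
  `|z b| <= gron L (b - a) * (`|z a| + m) /\
  `|z a| <= gron L (b - a) * (`|z b| + m).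
Proof.
move=> ab L0 m0 cz dz wle.
pose g t := dot (z t) (z t) + m ^+ 2.
pose dg t := 2 * dot (z t) (w t).
pose K := 6 * (L + 1).
have cg : {within `[a, b], continuous g}.
  apply: (@within_comp _ _ z (fun v => dot v v + m ^+ 2)) cz => t _.
  by apply: continuousD; [exact: dotvv_continuous|exact: cst_continuous].
have dgP t : a < t < b -> is_derive t 1 g (dg t).
  move=> /dz /is_derive_dotvv d; rewrite -[dg t]addr0.
  exact: (is_deriveD d (is_derive_cst _ _ _)).
have dgK t : a < t < b -> `|dg t| <= K * g t.
  move=> /wle wt; rewrite /dg normrM ger0_norm//.
  have := dot_le (z t) (w t); have := le_dotvv (z t).
  rewrite /K /g; set Q := dot _ _; set n := `|dot _ _|.
  set x := `|z t| in wt *; set y := `|w t| in wt *.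
  have x0 : 0 <= x by exact: normr_ge0.
  move=> xQ nxy.
  have H1 : x * y <= x * (L * x + m) by rewrite ler_wpM2l.
  have H2 : 0 <= L * (Q - x ^+ 2) by rewrite mulr_ge0// subr_ge0.
  have H3 : 0 <= L * m ^+ 2 by rewrite mulr_ge0// sqr_ge0.
  have H4 := sqr_ge0 (x - m); have H5 := sqr_ge0 m.
  nra.
have sq u v : dot u u <= expR (K * (b - a)) * (dot v v + m ^+ 2) ->
    `|u| <= gron L (b - a) * (`|v| + m).
  move=> H.
  have r0 : 0 <= gron L (b - a) * (`|v| + m).
    by rewrite mulr_ge0 ?addr_ge0// (le_trans _ (gron_ge2 _ _))// subr_ge0.
  rewrite -ler_sqr ?nnegrE// (le_trans (le_dotvv _))// (le_trans H)//.
  rewrite exprMn /gron exprMn -/K; set e := expR _.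
  have e1 : 1 <= e.
    rewrite -expR0 ler_expR /K; apply: mulr_ge0; last by rewrite subr_ge0.
    by rewrite mulr_ge0// addr_ge0.
  have := dotvv_le v; set q := dot v v; set x := `|v| => qx.
  have x0 : 0 <= x by exact: normr_ge0.
  have q1 : q + m ^+ 2 <= 2 ^+ 2 * (x + m) ^+ 2 by nra.
  rewrite (@le_trans _ _ (e * (2 ^+ 2 * (x + m) ^+ 2)))//.
    by rewrite ler_wpM2l// (le_trans _ e1).
  rewrite mulrA [e * _]mulrC ler_wpM2r ?sqr_ge0//.
  by rewrite ler_wpM2l ?exprn_ge0// expr2 ler_peMr// (le_trans _ e1).
split; apply: sq.
  have H : g b <= expR (K * (b - a)) * g a.
    apply: gronwall1 ab cg dgP _ => t /dgK; rewrite ler_norml => /andP[//].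
  by apply: le_trans H; rewrite lerDl sqr_ge0.
have H : expR (- K * (b - a)) * g a <= g b.
  by apply: gronwall1_ge ab cg dgP _ => t /dgK; rewrite ler_norml mulNr => /andP[].
rewrite -/(g b).
have -> : dot (z a) (z a) = g a - m ^+ 2 by rewrite /g addrK.
rewrite (@le_trans _ _ (g a))// ?gerBl ?sqr_ge0//.
have -> : g a = expR (K * (b - a)) * (expR (- K * (b - a)) * g a).
  by rewrite mulrA -expRD mulNr subrr expR0 mul1r.
by rewrite ler_pM2l ?expR_gt0.
Qed.

Lemma mean_value (c : R -> 'rV[R]_3) (w : R -> 'rV[R]_3) v e a b :
  a <= b -> 0 <= e -> {within `[a, b], continuous c} ->
  (forall t, a < t < b -> is_derive t 1 c (w t)) ->
  (forall t, a < t < b -> `|w t - v| <= e) ->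
  `|c b - c a - (b - a) *: v| <= e * (b - a).
Proof.
move=> + e0 cc dc wv; rewrite le_eqVlt => /predU1P[->|ab].
  by rewrite !subrr scale0r subrr normr0 mulr0.
apply: norm_le_coord => [|i]; first by rewrite mulr_ge0// subr_ge0 ltW.
have cci : {within `[a, b], continuous (fun t => c t 0 i)}.
  by apply: (@within_comp _ _ c (fun v : 'rV[R]_3 => v 0 i)) cc => t _; exact: coord_continuous.
have dci t : t \in `]a, b[ -> is_derive t 1 (fun t => c t 0 i) (w t 0 i).
  by rewrite in_itv/= => /dc; exact: is_derive_coord.
have [t + H] := MVT ab dci cci; rewrite in_itv/= => tab.
rewrite !mxE H -[(b - a) * _]mulrC -mulrBl normrM (gtr0_norm (_ : 0 < b - a)) ?subr_gt0//.
rewrite ler_pM2r ?subr_gt0// (le_trans _ (wv t tab))//.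
by have := coord_le_norm (w t - v) i; rewrite !mxE.
Qed.

End RealCurves.

(** * Strict differentiability *)

Section StrongDifferentiability.
Context {R : realType}.
Local Notation E := 'rV[R]_3.
Implicit Types (f g : E -> R) (u v w p d x y z : E) (e r : R).

Lemma near0_ex (P : R -> Prop) : (\forall r \near 0^'+, P r) -> exists2 r, 0 < r & P r.
Proof.
move=> HP; have : \forall r \near 0^'+, 0 < r /\ P r.
  by near=> r; split; near: r => //; exact: nbhs_right_gt.
by move=> /filter_ex[r []]; exists r.
Unshelve. all: by end_near. Qed.

(** Strict differentiability at [p] with gradient [d]: both points vary near [p]. It holds wherever
    a function is C^1 and controls the difference of its values along two nearby trajectories. The
    radius runs through a filter so that several such conditions can be imposed at once. *)
Definition sdiff f p d := forall e, 0 < e -> \forall r \near 0^'+,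
  forall y z, `|y - p| < r -> `|z - p| < r ->
    `|f y - f z - dot d (y - z)| <= e * `|y - z|.

Lemma sdiff_lip f p d : sdiff f p d -> \forall r \near 0^'+,
  forall y z, `|y - p| < r -> `|z - p| < r ->
    `|f y - f z| <= (3 * `|d| + 1) * `|y - z|.
Proof.
move=> /(_ 1 ltr01) fd; near=> r => y z yr zr.
have : `|f y - f z - dot d (y - z)| <= 1 * `|y - z| by move: (y) (z) yr zr; near: r.
have := dot_le d (y - z).
have := ler_normD (f y - f z - dot d (y - z)) (dot d (y - z)).
rewrite subrK; lra.
Unshelve. all: by end_near. Qed.

Lemma sdiff_near f p d e : sdiff f p d -> 0 < e -> \forall r \near 0^'+,
  forall y, `|y - p| < r -> `|f y - f p| <= e.
Proof.
move=> fd e0; have L0 : 0 < 3 * `|d| + 1 by rewrite ltr_pwDr// mulr_ge0.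
near=> r => y yr; have r0 : 0 < r by near: r; exact: nbhs_right_gt.
have : `|f y - f p| <= (3 * `|d| + 1) * `|y - p|.
  have : forall y z, `|y - p| < r -> `|z - p| < r -> `|f y - f z| <= (3 * `|d| + 1) * `|y - z|.
    by near: r; exact: sdiff_lip.
  by apply; rewrite // subrr normr0.
move=> H; rewrite (le_trans H)// -ler_pdivlMl// (le_trans (ltW yr))//.
by near: r; apply: nbhs_right_le; rewrite mulr_gt0// invr_gt0.
Unshelve. all: by end_near. Qed.

Lemma sdiff_cst (a : R) p : sdiff (fun=> a) p 0.
Proof.
move=> e e0; near=> r => y z _ _.
by rewrite subrr dotC dot0r subrr normr0 mulr_ge0// ltW.
Unshelve. all: by end_near. Qed.

Lemma sdiffD f g p d d' : sdiff f p d -> sdiff g p d' ->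
  sdiff (fun x => f x + g x) p (d + d').
Proof.
move=> fd gd e e0; have e20 : 0 < e / 2 by rewrite divr_gt0.
near=> r => y z yr zr.
have H1 : `|f y - f z - dot d (y - z)| <= e / 2 * `|y - z|.
  by move: (y) (z) yr zr; near: r; apply: fd.
have H2 : `|g y - g z - dot d' (y - z)| <= e / 2 * `|y - z|.
  by move: (y) (z) yr zr; near: r; apply: gd.
have := ler_normD (f y - f z - dot d (y - z)) (g y - g z - dot d' (y - z)).
rewrite dotDl.
have -> : f y - f z - dot d (y - z) + (g y - g z - dot d' (y - z)) =
  f y + g y - (f z + g z) - (dot d (y - z) + dot d' (y - z)) by ring.
lra.
Unshelve. all: by end_near. Qed.

Lemma sdiffZ a f p d : sdiff f p d -> sdiff (fun x => a * f x) p (a *: d).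
Proof.
move=> fd e e0; have a0 : 0 < `|a| + 1 by rewrite ltr_wpDl.
have e20 : 0 < e / (`|a| + 1) by rewrite divr_gt0.
near=> r => y z yr zr.
have H1 : `|f y - f z - dot d (y - z)| <= e / (`|a| + 1) * `|y - z|.
  by move: (y) (z) yr zr; near: r; apply: fd.
rewrite dotZl -!mulrBr normrM.
rewrite (@le_trans _ _ ((`|a| + 1) * `|f y - f z - dot d (y - z)|))//.
  by rewrite ler_wpM2r// lerDl.
by rewrite (le_trans (ler_wpM2l (ltW a0) H1))// mulrA mulrCA divff ?mulr1 ?gt_eqF.
Unshelve. all: by end_near. Qed.

Lemma sdiffN f p d : sdiff f p d -> sdiff (fun x => - f x) p (- d).
Proof.
by move=> /(sdiffZ (-1)); rewrite scaleN1r; under eq_fun do rewrite mulN1r.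
Qed.

Lemma sdiffB f g p d d' : sdiff f p d -> sdiff g p d' ->
  sdiff (fun x => f x - g x) p (d - d').
Proof. by move=> fd /sdiffN; exact: sdiffD. Qed.

Lemma sdiffM f g p d d' : sdiff f p d -> sdiff g p d' ->
  sdiff (fun x => f x * g x) p (f p *: d' + g p *: d).
Proof.
move=> fd gd e e0.
pose Lf := 3 * `|d| + 1; pose Lg := 3 * `|d'| + 1.
have Lf0 : 0 < Lf by rewrite ltr_pwDr// mulr_ge0.
have Lg0 : 0 < Lg by rewrite ltr_pwDr// mulr_ge0.
have := sdiffZ (f p) gd => /(_ (e / 4)); rewrite divr_gt0// => /(_ isT) H1.
have := sdiffZ (g p) fd => /(_ (e / 4)); rewrite divr_gt0// => /(_ isT) H2.
near=> r => y z yr zr.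
have K1 : `|f p * g y - f p * g z - dot (f p *: d') (y - z)| <= e / 4 * `|y - z|.
  by move: (y) (z) yr zr; near: r.
have K2 : `|g p * f y - g p * f z - dot (g p *: d) (y - z)| <= e / 4 * `|y - z|.
  by move: (y) (z) yr zr; near: r.
have K3 : `|f y - f p| <= e / 4 / Lg.
  by move: (y) yr; near: r; apply: sdiff_near fd _; rewrite !divr_gt0.
have K4 : `|g z - g p| <= e / 4 / Lf.
  by move: (z) zr; near: r; apply: sdiff_near gd _; rewrite !divr_gt0.
have K5 : `|f y - f z| <= Lf * `|y - z|.
  by move: (y) (z) yr zr; near: r; exact: sdiff_lip.
have K6 : `|g y - g z| <= Lg * `|y - z|.
  by move: (y) (z) yr zr; near: r; exact: sdiff_lip.
have M1 : `|(f y - f p) * (g y - g z)| <= e / 4 * `|y - z|.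
  rewrite normrM (le_trans (ler_pM _ _ K3 K6))//.
  by rewrite mulrA divfK// gt_eqF.
have M2 : `|(g z - g p) * (f y - f z)| <= e / 4 * `|y - z|.
  rewrite normrM (le_trans (ler_pM _ _ K4 K5))//.
  by rewrite mulrA divfK// gt_eqF.
rewrite dotDl.
have -> : f y * g y - f z * g z - (dot (f p *: d') (y - z) + dot (g p *: d) (y - z)) =
  (f p * g y - f p * g z - dot (f p *: d') (y - z)) +
  (g p * f y - g p * f z - dot (g p *: d) (y - z)) +
  ((f y - f p) * (g y - g z)) + ((g z - g p) * (f y - f z)) by ring.
apply: le_trans (ler_normD _ _) _.
apply: le_trans (lerD (le_trans (ler_normD _ _) (lerD (le_trans (ler_normD _ _) (lerD K1 K2)) M1)) M2) _.
lra.
Unshelve. all: by end_near. Qed.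

(** The increment of the inverse is [- (f y)^-1 * (f z)^-1 * (f y - f z)], so only the coefficient
    has to be compared with its value at [p]. *)
Lemma sdiffV f p d : f p != 0 -> sdiff f p d ->
  sdiff (fun x => (f x)^-1) p (- ((f p)^-1 ^+ 2) *: d).
Proof.
move=> fp0 fd e e0.
pose Lf := 3 * `|d| + 1; have Lf0 : 0 < Lf by rewrite ltr_pwDr// mulr_ge0.
pose m := `|f p|; have m0 : 0 < m by rewrite normr_gt0.
have := sdiffZ (- ((f p)^-1 ^+ 2)) fd => /(_ (e / 2)); rewrite divr_gt0// => /(_ isT) H1.
(* The error of the coefficient is a fraction with numerator at most [5 / 2 * m * k] and denominator
   at least [m ^+ 4 / 4]; the 10 makes the quotient [e / 2 / Lf]. *)
pose k := e / 2 / Lf * (m ^+ 3 / 10).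
have k0 : 0 < k by rewrite !mulr_gt0 ?invr_gt0// exprn_gt0.
pose k' := Num.min k (m / 2).
have k'0 : 0 < k' by rewrite lt_min k0 divr_gt0.
near=> r => y z yr zr.
have K1 : `|- ((f p)^-1 ^+ 2) * f y - - ((f p)^-1 ^+ 2) * f z - dot (- ((f p)^-1 ^+ 2) *: d) (y - z)| <= e / 2 * `|y - z|.
  by move: (y) (z) yr zr; near: r.
have K3 : `|f y - f p| <= k' by move: (y) yr; near: r; apply: sdiff_near fd _.
have K4 : `|f z - f p| <= k' by move: (z) zr; near: r; apply: sdiff_near fd _.
have K5 : `|f y - f z| <= Lf * `|y - z|.
  by move: (y) (z) yr zr; near: r; exact: sdiff_lip.
have fm (a : R) : `|a - f p| <= k' -> m / 2 <= `|a| /\ `|a - f p| <= k.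
  rewrite le_min => /andP[-> H]; split=> //.
  have := ler_normD (f p - a) a; rewrite subrK distrC -/m; lra.
have [my ky] := fm _ K3; have [mz kz] := fm _ K4.
have m20 : 0 < m / 2 by rewrite divr_gt0.
have y0 : f y != 0 by rewrite -normr_gt0 (lt_le_trans m20).
have z0 : f z != 0 by rewrite -normr_gt0 (lt_le_trans m20).
have M : `|((f p)^-1 ^+ 2 - (f y)^-1 * (f z)^-1)| <= e / 2 / Lf.
  have -> : (f p)^-1 ^+ 2 - (f y)^-1 * (f z)^-1 =
     (f y * (f z - f p) + f p * (f y - f p)) / (f p * f p * f y * f z).
    by field; rewrite fp0 y0 z0.
  rewrite normrM normfV.
  have -> : `|f p * f p * f y * f z| = m * m * `|f y| * `|f z| by rewrite !normrM.
  rewrite ler_pdivrMr; last by rewrite !mulr_gt0 ?normr_gt0.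
  have yle : `|f y| <= 3 / 2 * m.
    have := ler_normD (f y - f p) (f p); rewrite subrK -/m.
    have := K3; rewrite le_min => /andP[_]; lra.
  apply: (@le_trans _ _ (5 / 2 * m * k)).
    rewrite (le_trans (ler_normD _ _))// !normrM -/m.
    have -> : 5 / 2 * m * k = 3 / 2 * m * k + m * k by field.
    by rewrite lerD// ler_pM// ltW.
  apply: (@le_trans _ _ (e / 2 / Lf * (m * m * (m / 2) * (m / 2)))).
    have -> : 5 / 2 * m * k = e / 2 / Lf * (m * m * (m / 2) * (m / 2)) by rewrite /k; field; rewrite gt_eqF.
    by [].
  rewrite ler_wpM2l//; first by rewrite !mulr_ge0 ?invr_ge0 ?ltW.
  rewrite -!(mulrA (m * m)) ler_wpM2l//; first by rewrite mulr_ge0 ?ltW.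
  by apply: ler_pM => //; exact: ltW.
have M1 : `|((f p)^-1 ^+ 2 - (f y)^-1 * (f z)^-1) * (f y - f z)| <= e / 2 * `|y - z|.
  rewrite normrM (le_trans (ler_pM _ _ M K5))//.
  by rewrite mulrA divfK// gt_eqF.
have -> : (f y)^-1 - (f z)^-1 - dot (- ((f p)^-1 ^+ 2) *: d) (y - z) =
  (- ((f p)^-1 ^+ 2) * f y - - ((f p)^-1 ^+ 2) * f z - dot (- ((f p)^-1 ^+ 2) *: d) (y - z))
  + ((f p)^-1 ^+ 2 - (f y)^-1 * (f z)^-1) * (f y - f z).
  set D := dot _ _; field; rewrite fp0 y0 z0 //.
rewrite (le_trans (ler_normD _ _))// (le_trans (lerD K1 M1))//; lra.
Unshelve. all: by end_near. Qed.

Lemma dot_linear u : linear (dot u).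
Proof. by move=> a v w; rewrite dotDr dotZr. Qed.

HB.instance Definition _ u := GRing.isLinear.Build R E R *%R (dot u) (dot_linear u).

Lemma sdiff_diff f p d : sdiff f p d ->
  differentiable f p /\ 'd f p = dot d :> (E -> R).
Proof.
move=> fd.
have fE : (f : E -> R^o) \o shift p = cst (f p : R^o) + (dot d : E -> R^o) +o_ (0 : E) id.
  apply/eqaddoP => e e0.
  have [r r0 fr] := near0_ex (fd e e0).
  have nr : \forall v \near (0 : E), `|v| < r by exact: nbhs0_lt.
  near=> v; rewrite /= !fctE/= opprD addrA -{3}(addrK p v) addrC.
  have -> : dot d v = dot d (v + p - p) by rewrite addrK.
  rewrite addrC; apply: fr; last by rewrite subrr normr0.
  by rewrite addrK; near: v; exact: nr.
have dfd := diff_unique (@dot_continuous _ d) fE.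
by split=> //; apply/diff_locallyP; rewrite dfd; split => //; exact: dot_continuous.
Unshelve. all: by end_near. Qed.

Lemma sdiff_derive f p d v : sdiff f p d -> 'D_v f p = dot d v.
Proof. by move=> /sdiff_diff[df dfE]; rewrite deriveE// dfE. Qed.

Lemma sdiff_continuous f p d : sdiff f p d -> {for p, continuous f}.
Proof. by move=> /sdiff_diff[df _]; exact: differentiable_continuous. Qed.

Lemma sdiff_grad f p d : sdiff f p d -> grad f p = d.
Proof.
by move=> fd; apply/rowP => i; rewrite mxE (sdiff_derive _ fd) dotC dot_delta.
Qed.

Lemma is_derive_sdiff f d (c : R -> E) w (t : R) :
  is_derive t 1 c w -> sdiff f (c t) d -> is_derive t 1 (f \o c) (dot d w).
Proof.
move=> [dc cw] /sdiff_diff[df dfE].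
have dct : differentiable c t by exact/derivable1_diffP.
apply: DeriveDef; first exact/derivable1_diffP/differentiable_comp.
rewrite deriveE; last exact: differentiable_comp.
by rewrite diff_comp//= dfE -cw deriveE.
Qed.

(** The strict expansions at [p] and at [y] both apply to the pair formed by [y] and [k *: v + y]
    when [k] is small. Subtracting them and dividing by [k] compares the two gradients on [v]. *)
Lemma sdiff_grad_near f p d e : sdiff f p d -> 0 < e -> \forall r \near 0^'+,
  forall y d', `|y - p| < r -> sdiff f y d' -> forall v, `|dot d' v - dot d v| <= e * `|v|.
Proof.
move=> fd e0; have e20 : 0 < e / 2 by rewrite divr_gt0.
near=> r => y d' yr fd' v.
have Hr : forall y z, `|y - p| < r -> `|z - p| < r ->
    `|f y - f z - dot d (y - z)| <= e / 2 * `|y - z| by near: r; exact: fd.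
have [r' r'0 Hr'] := near0_ex (fd' _ e20).
have v0 : 0 < `|v| + 1 by rewrite ltr_wpDl.
pose k := Num.min (r - `|y - p|) r' / 2 / (`|v| + 1).
have m0 : 0 < Num.min (r - `|y - p|) r' by rewrite lt_min subr_gt0 yr.
have k0 : 0 < k by rewrite !divr_gt0.
pose z := k *: v + y.
have zy : `|z - y| < Num.min (r - `|y - p|) r'.
  rewrite addrK normrZ gtr0_norm// /k -!mulrA.
  have : (`|v| + 1)^-1 * `|v| <= 1 by rewrite mulrC ler_pdivrMr// mul1r lerDl.
  by move: m0; set m := Num.min _ _; set q := _^-1 * `|v|; nra.
have zr' : `|z - y| < r' by move: zy; rewrite lt_min => /andP[].
have zr : `|z - p| < r.
  have := ler_normD (z - y) (y - p); rewrite subrKA.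
  by move: zy; rewrite lt_min => /andP[+ _]; lra.
have H1 := Hr z y zr yr.
have H2 := Hr' z y zr'; rewrite subrr normr0 in H2; have {}H2 := H2 r'0.
have zyE : z - y = k *: v by rewrite addrK.
rewrite -(ler_pM2l k0) [leRHS]mulrCA -[k in leRHS](gtr0_norm k0) -normrZ.
rewrite -[k in leLHS](gtr0_norm k0) -normrM mulrBr -!dotZr -zyE.
have := ler_normB (f z - f y - dot d (z - y)) (f z - f y - dot d' (z - y)).
rewrite opprB addrC addrA.
rewrite subrK.
lra.
Unshelve. all: by end_near. Qed.

Lemma differentiable_grad f x v : differentiable f x -> 'D_v f x = dot (grad f x) v.
Proof.
move=> df; rewrite deriveE// {1}(row_sum_delta v) linear_sum/=.
by apply: eq_bigr => i _; rewrite linearZ/= mxE deriveE// mulrC.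
Qed.

Lemma is_derive_line f z v (s : R) : derivable f (s *: v + z) v ->
  is_derive s 1 (fun s => f (s *: v + z)) ('D_v f (s *: v + z)).
Proof.
move=> df.
have E1 : (fun h : R => h^-1 *: (f ((h *: (1 : R) + s) *: v + z) - f (s *: v + z))) =
          (fun h : R => h^-1 *: (f (h *: v + (s *: v + z)) - f (s *: v + z))).
  by apply/funext => h; rewrite [_%:A]mulr1 scalerDl addrA.
apply: DeriveDef; first by rewrite /derivable E1.
by rewrite /derive E1.
Qed.

(** The mean value theorem along the segment from [z] to [y] expresses the increment by a gradient
    at an intermediate point, which is close to the one at [p]. The tolerance [e / 3] offsets the
    factor of [dot_le]. *)
Lemma C1_sdiff f (A : set E) p : open A -> class_C 1 A f -> A p ->
  sdiff f p (grad f p).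
Proof.
move=> oA [/= df cf] Ap e e0.
have e30 : 0 < e / 3 by rewrite divr_gt0.
have : \forall x \near p, A x /\
    forall i, `|'D_(delta_mx 0 i) f x - 'D_(delta_mx 0 i) f p| <= e / 3.
  near=> x; split; first by near: x; exact: open_nbhs_nbhs.
  near: x; apply: filter_forall => i.
  have /cvgrPdist_le/(_ _ e30) := cf (delta_mx 0 i) p Ap.
  by apply: filterS => x; rewrite distrC.
move=> /nbhs_ballP[r0 /= r00 Hr0].
have : \forall r \near 0^'+, forall x, `|x - p| < r ->
    A x /\ forall i, `|'D_(delta_mx 0 i) f x - 'D_(delta_mx 0 i) f p| <= e / 3.
  near=> r => x xr; apply: Hr0; rewrite -ball_normE /= distrC (lt_le_trans xr)//.
  by near: r; exact: nbhs_right_le.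
move=> H; near=> r => y z yr zr.
have seg (s : R) : 0 <= s <= 1 -> `|s *: (y - z) + z - p| < r.
  move=> /andP[s0 s1].
  have -> : s *: (y - z) + z - p = s *: (y - p) + (1 - s) *: (z - p).
    by rewrite !scalerBr !scalerBl !scale1r; apply/rowP => i; rewrite !mxE; ring.
  rewrite (le_lt_trans (ler_normD _ _))// !normrZ ger0_norm// ger0_norm ?subr_ge0//.
  have [->|sn0] := eqVneq s 0; first by rewrite mul0r add0r subr0 mul1r.
  have {sn0}s0 : 0 < s by rewrite lt0r sn0.
  have H1 : 0 < s * (r - `|y - p|) by rewrite mulr_gt0// subr_gt0.
  have H2 : 0 <= (1 - s) * (r - `|z - p|) by rewrite mulr_ge0// subr_ge0// ltW.
  lra.
have Hr : forall x, `|x - p| < r ->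
    A x /\ forall i, `|'D_(delta_mx 0 i) f x - 'D_(delta_mx 0 i) f p| <= e / 3.
  by near: r.
pose phi (s : R) := f (s *: (y - z) + z).
have dphi (s : R) : 0 <= s <= 1 -> is_derive s 1 phi ('D_(y - z) f (s *: (y - z) + z)).
  move=> /seg/Hr[As _]; apply: is_derive_line; apply: diff_derivable; exact: df.
have cphi : {within `[0, 1], continuous phi}.
  apply: derivable_within_continuous => s; rewrite in_itv/= => /dphi[]//.
have dphi' (s : R) : s \in `]0 : R, 1[ -> is_derive s 1 phi ('D_(y - z) f (s *: (y - z) + z)).
  by rewrite in_itv/= => /andP[s0 s1]; apply: dphi; rewrite !ltW.
have [s + ] := MVT ltr01 dphi' cphi.
rewrite in_itv/= => /andP[s0 s1]; rewrite /phi scale1r scale0r add0r subrK subr0 mulr1 => ->.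
have [|As Hs] := Hr (s *: (y - z) + z); first by apply: seg; rewrite !ltW.
rewrite differentiable_grad; last exact: df.
rewrite -dotBl (le_trans (dot_le _ _))// ler_wpM2r//.
rewrite -ler_pdivlMl// mulrC; apply: norm_le_coord => [|i]; first by rewrite divr_ge0// ltW.
by rewrite !mxE.
Unshelve. all: by end_near. Qed.

End StrongDifferentiability.

(** * Vector fields: estimates uniform along compact sets *)

Section VectorFields.
Context {R : realType}.
Local Notation E := 'rV[R]_3.
Implicit Types (F : E -> E) (u v w p d x y z : E) (e r L : R).

Definition C1at F p := forall i, exists d, sdiff (fun x => F x 0 i) p d.

Definition vsdiff F p (M : 'M[R]_3) := forall e, 0 < e -> \forall r \near 0^'+,
  forall y z, `|y - p| < r -> `|z - p| < r ->
    `|F y - F z - (y - z) *m M| <= e * `|y - z|.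

Lemma C1at_vsdiff F p : C1at F p -> exists M, vsdiff F p M.
Proof.
move=> /choice[d dP]; exists (\matrix_(j, i) d i 0 j) => e e0.
near=> r => y z yr zr; apply: norm_le_coord => [|i].
  by rewrite mulr_ge0// ltW.
have -> : (F y - F z - (y - z) *m (\matrix_(j, i) d i 0 j)) 0 i =
    F y 0 i - F z 0 i - dot (d i) (y - z).
  rewrite !mxE; congr (_ - _); apply: eq_bigr => j _.
  by rewrite !mxE mulrC.
move: i (y) (z) yr zr; near: r; apply: filter_forall => i; exact: dP.
Unshelve. all: by end_near. Qed.

Lemma C1at_differentiable F p : C1at F p -> differentiable F p.
Proof.
move=> FP; have -> : F = \sum_(i < 3) (fun x => F x 0 i *: delta_mx 0 i).
  by apply/funext => x; rewrite fct_sumE; exact: row_sum_delta.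
apply: differentiable_sum => i; apply: differentiableZl.
by have [d /sdiff_diff[]] := FP i.
Qed.

(** The focus hypothesis is phrased with the Jacobian while the estimates use strict differentials;
    the rows of both matrices are the directional derivatives along the basis vectors. *)
Lemma vsdiff_jacobian F p M : C1at F p -> vsdiff F p M -> 'J F p = M.
Proof.
move=> FP FM; apply/row_matrixP => i; rewrite !rowE.
have dF := C1at_differentiable FP.
rewrite -deriveEjacobian//; apply/cvg_lim => //.
apply/cvgrPdist_le => e e0.
have [r r0 Hr] := near0_ex (FM _ e0).
near=> h.
have h0 : h != 0 by near: h; exact: nbhs_dnbhs_neq.
have hr : `|h| < r by near: h; exact: dnbhs0_lt.
have := Hr (h *: delta_mx 0 i + p) p; rewrite addrK subrr normr0 => /(_ _ r0).
have d1 : `|delta_mx 0 i : E| <= 1.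
  apply: norm_le_coord => // j; rewrite mxE.
  by case: (_ && _); rewrite ?normr1 ?normr0.
rewrite normrZ => H.
have {H} : `|F (h *: 'e_i + p) - F p - h *: 'e_i *m M| <= e * (`|h| * `|'e_i : E|).
  by apply: H; rewrite (le_lt_trans _ hr)// ler_piMr.
rewrite -(ler_pM2l (_ : 0 < `|h|^-1)) ?invr_gt0 ?normr_gt0//.
rewrite -normfV -normrZ scalerBr -scalemxAl scalerA mulVf// scale1r distrC.
move=> H; rewrite (le_trans H)// normfV mulrCA mulKf ?normr_eq0//.
by rewrite ler_piMr// ltW.
Unshelve. all: by end_near. Qed.

Lemma C1at_lip F p : C1at F p -> exists L r, 0 < r /\
  forall y z, `|y - p| < r -> `|z - p| < r -> `|F y - F z| <= L * `|y - z|.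
Proof.
move=> /choice[d dP]; exists (\sum_i (3 * `|d i| + 1)).
have : \forall r \near 0^'+, forall i y z, `|y - p| < r -> `|z - p| < r ->
    `|F y 0 i - F z 0 i| <= (3 * `|d i| + 1) * `|y - z|.
  by apply: filter_forall => i; exact: (sdiff_lip (dP i)).
move=> /near0_ex[r r0 Hr]; exists r; split=> // y z yr zr.
have pos i : 0 <= 3 * `|d i| + 1 by rewrite addr_ge0// mulr_ge0.
apply: norm_le_coord => [|i]; first by rewrite mulr_ge0// sumr_ge0.
have := Hr i y z yr zr; rewrite !mxE => H; rewrite (le_trans H)// ler_wpM2r//.
by rewrite (bigD1 i)//= lerDl sumr_ge0.
Qed.

(** Any vector can be scaled into the ball where the Lipschitz bound and the strict expansion with
    tolerance 1 both apply; the tolerance accounts for the additional 1. *)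
Lemma vsdiff_mulmx_le F p M L r : vsdiff F p M -> 0 < r ->
  (forall y z, `|y - p| < r -> `|z - p| < r -> `|F y - F z| <= L * `|y - z|) ->
  forall v, `|v *m M| <= (L + 1) * `|v|.
Proof.
move=> FM r0 FL v.
have : \forall r' \near 0^'+, r' <= r /\ forall y z, `|y - p| < r' -> `|z - p| < r' ->
    `|F y - F z - (y - z) *m M| <= 1 * `|y - z|.
  near=> r'; split; near: r'; [exact: nbhs_right_le|exact: (FM _ ltr01)].
move=> /near0_ex[r' r'0 [rr' Hr']].
have v0 : 0 < `|v| + 1 by rewrite ltr_wpDl.
pose k := r' / (`|v| + 1); have k0 : 0 < k by rewrite divr_gt0.
have kv : `|k *: v + p - p| < r'.
  by rewrite addrK normrZ gtr0_norm// /k -mulrA gtr_pMr// mulrC ltr_pdivrMr// mul1r ltrDl.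
have H1 := Hr' _ p kv; have H2 := FL _ p (lt_le_trans kv rr').
rewrite subrr normr0 in H1 H2; have {}H1 := H1 r'0; have {}H2 := H2 r0.
rewrite addrK in H1 H2.
rewrite -(ler_pM2l k0) mulrCA -[k in leRHS](gtr0_norm k0) -normrZ.
rewrite -[k in leLHS](gtr0_norm k0) -normrZ scalemxAl.
have := ler_normB (F (k *: v + p) - F p) (F (k *: v + p) - F p - k *: v *m M).
rewrite subKr; lra.
Unshelve. all: by end_near. Qed.

Definition lip_on L F (A : set E) := forall y z, A y -> A z -> `|F y - F z| <= L * `|y - z|.

Definition nb p r : set E := [set y | `|y - p| < r].

(** The near-covering form of compactness is used along [i] tending to infinity, with [i] as the
    constant and [i^-1] as the radius, which the monotonicity of [P] permits. Half of the local
    radius is kept for moving the centre. *)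
Lemma compact_tube (C : set E) (P : R -> set E -> Prop) : compact C ->
  (forall L L' A B, L <= L' -> A `<=` B -> P L B -> P L' A) ->
  (forall p, C p -> exists L r, 0 < r /\ P L (nb p r)) ->
  exists L r, [/\ 0 < L, 0 < r & forall p, C p -> P L (nb p r)].
Proof.
move=> /compact_near_coveringP cC Pmono Ploc.
have : \forall i \near +oo%R, C `<=` (fun p => P i (nb p i^-1)).
  apply: cC => p /Ploc[L [r [r0 PL]]].
  have r20 : 0 < r / 2 by rewrite divr_gt0.
  have H : \forall i \near +oo%R, L <= i /\ i^-1 <= r / 2.
    near=> i; split; first by near: i; apply: nbhs_pinfty_ge; rewrite num_real.
    have i0 : 0 < i by near: i; apply: nbhs_pinfty_gt; rewrite num_real.
    rewrite -[leRHS]invrK lef_pV2 ?posrE ?invr_gt0//.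
  exists ([set x | `|x - p| < r / 2], [set i | L <= i /\ i^-1 <= r / 2]).
    split=> //=; apply/nbhs_ballP; exists (r / 2) => // x.
    by rewrite -ball_normE /= distrC.
  move=> [x i] /= [xp [Li ir]]; apply: Pmono PL => // y /= yx.
  rewrite /nb/= -(subrKA x) (le_lt_trans (ler_normD _ _))//.
  by rewrite [ltRHS]splitr ltrD// (lt_le_trans yx).
move=> H; have : \forall i \near +oo%R, 0 < i /\ C `<=` (fun p => P i (nb p i^-1)).
  by near=> i; split; near: i; [apply: nbhs_pinfty_gt; rewrite num_real|exact: H].
move=> /filter_ex[i [i0 Hi]].
by exists i, i^-1; split=> //; rewrite invr_gt0.
Unshelve. all: by end_near. Qed.

Lemma compact_lip F (C : set E) : compact C -> (forall p, C p -> C1at F p) ->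
  exists L r, [/\ 0 < L, 0 < r & forall p, C p -> lip_on L F (nb p r)].
Proof.
move=> cC CF; apply: (compact_tube (P := fun L A => lip_on L F A)) cC _ _.
  move=> L L' A B LL AB FB y z Ay Az; rewrite (le_trans (FB _ _ _ _))//; do ?exact: AB.
  by rewrite ler_wpM2r.
by move=> p /CF/C1at_lip[L [r [r0 Hr]]]; exists L, r; split=> // y z; exact: Hr.
Qed.

(** A weighted difference of two increments of [F] is controlled by the same combination of
    increments of the argument. Along trajectories this takes the place of the variational equation:
    differences that start out nearly proportional remain so. *)
Definition quad_on L e F (A : set E) := forall y z y' z' (a a' : R),
  A y -> A z -> A y' -> A z' ->
  `|a *: (F y - F z) - a' *: (F y' - F z')| <=
    L * `|a *: (y - z) - a' *: (y' - z')| +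
    e * (`|a| * `|y - z| + `|a'| * `|y' - z'|).

(** The constant has to be fixed before [e]. It bounds the differentials on [C] and so comes from a
    Lipschitz constant through [vsdiff_mulmx_le]; only the radius shrinks with [e]. *)
Lemma compact_quad F (C : set E) : compact C -> (forall p, C p -> C1at F p) ->
  exists2 L, 0 < L & forall e, 0 < e ->
    exists2 r, 0 < r & forall p, C p -> quad_on L e F (nb p r).
Proof.
move=> cC CF; have [L [r [L0 r0 Hr]]] := compact_lip cC CF.
exists (L + 1) => [|e e0]; first by rewrite addr_gt0.
suff [_ [r' [_ r'0 H]]] : exists L' r, [/\ 0 < L', 0 < r & forall p, C p -> quad_on (L + 1) e F (nb p r)].
  by exists r'.
apply: (compact_tube (P := fun _ A => quad_on (L + 1) e F A)) cC _ _.
  by move=> _ _ A B _ AB FB y z y' z' a a' Ay Az Ay' Az'; apply: FB; exact: AB.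
move=> p Cp; have [M FM] := C1at_vsdiff (CF p Cp).
have Mle := vsdiff_mulmx_le FM r0 (fun y z => Hr p Cp y z).
have [r' r'0 Hr'] := near0_ex (FM _ e0); exists 0, r'; split=> //.
move=> y z y' z' a a' yr zr yr' zr'.
have H1 := Hr' _ _ yr zr; have H2 := Hr' _ _ yr' zr'.
have -> : a *: (F y - F z) - a' *: (F y' - F z') =
   (a *: (y - z) - a' *: (y' - z')) *m M +
   (a *: (F y - F z - (y - z) *m M) - a' *: (F y' - F z' - (y' - z') *m M)).
  rewrite mulmxBl -!scalemxAl !scalerBr; apply/rowP => i; rewrite !mxE; ring.
rewrite (le_trans (ler_normD _ _))// lerD//.
rewrite (le_trans (ler_normB _ _))// !normrZ mulrDr.
by rewrite lerD// mulrCA ler_wpM2l.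
Qed.

Lemma nb_center p r : 0 < r -> nb p r p.
Proof. by rewrite /nb/= subrr normr0. Qed.

End VectorFields.

(** * Trajectories *)

Section Trajectories.
Context {R : realType}.
Local Notation E := 'rV[R]_3.
Implicit Types (F : E -> E) (c : R -> E) (u v w p d x y z : E) (e r L T t s a : R).

Definition traj F T c := {within `[0, T], continuous c} /\
  forall t, 0 < t < T -> is_derive t 1 c (F (c t)).

Lemma traj_sub F T T' c : T' <= T -> traj F T c -> traj F T' c.
Proof.
move=> TT [cc dc]; split; first exact: within_sub cc.
by move=> t /andP[t0 tT]; apply: dc; rewrite t0 (lt_le_trans tT).
Qed.

Lemma traj_shift F T c s : 0 <= s -> traj F T c -> traj F (T - s) (fun t => c (t + s)).
Proof.
move=> s0 [/within_itvP cc dc]; split.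
  apply/within_itvP => t /andP[t0 tT] e e0.
  have [|d d0 dP] := cc (t + s) _ e e0; first by apply/andP; split; lra.
  exists d => // u /andP[u0 uT] ut; apply: dP; first by apply/andP; split; lra.
  by have -> : u + s - (t + s) = u - t by ring.
move=> t /andP[t0 tT].
have H : is_derive (t + s) 1 c (F (c (t + s))) by apply: dc; apply/andP; split; lra.
have [H1 H2] := H.
have E1 : (fun h : R => h^-1 *: (c ((h *: (1 : R) + t) + s) - c (t + s))) =
          (fun h : R => h^-1 *: (c (h *: (1 : R) + (t + s)) - c (t + s))).
  by apply/funext => h; rewrite addrA.
apply: DeriveDef; first by rewrite /derivable E1.
by rewrite /derive E1.
Qed.

Lemma traj_rev F T c : traj F T c -> traj (fun x => - F x) T (fun t => c (T - t)).
Proof.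
move=> [/within_itvP cc dc]; split.
  apply/within_itvP => t /andP[t0 tT] e e0.
  have [|d d0 dP] := cc (T - t) _ e e0; first by apply/andP; split; lra.
  exists d => // u /andP[u0 uT] ut; apply: dP; first by apply/andP; split; lra.
  by rewrite opprB [T - u + _]addrC addrA subrK distrC.
move=> t /andP[t0 tT].
have H : is_derive (T - t) 1 c (F (c (T - t))) by apply: dc; apply/andP; split; lra.
have dT : is_derive t 1 (fun t : R => T - t) (- 1).
  have := is_deriveB (is_derive_cst T t (1 : R)) (is_derive_id t (1 : R)).
  by rewrite sub0r.
have [H1 H2] := H; have [D1 D2] := dT.
have dc1 : differentiable c (T - t) by exact/derivable1_diffP.
have dT1 : differentiable (fun t : R => T - t) t by exact/derivable1_diffP.
have dcomp : differentiable (c \o (fun t : R => T - t)) t by exact: differentiable_comp.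
apply: DeriveDef; first exact/derivable1_diffP.
rewrite deriveE// diff_comp//=.
have -> : 'd (fun t : R => T - t) t 1 = - 1 by rewrite -deriveE.
by rewrite linearN/= -deriveE// H2.
Qed.

Lemma traj_compact F T c : traj F T c -> compact (c @` `[0, T]).
Proof. by move=> [cc _]; apply: continuous_compact => //; exact: segment_compact. Qed.

Lemma traj_dist_within F T c p : traj F T c ->
  {within `[0, T], continuous (fun t => `|c t - p|)}.
Proof.
move=> [cc _]; apply: (@within_comp _ _ _ c (fun x => `|x - p|)) cc => t _.
apply: (continuous_comp (f := fun x => x - p)); last exact: norm_continuous.
by apply: continuousB; [exact: cvg_id|exact: cst_continuous].
Qed.

(** While the curve is in the ball its speed is at most [B], and at that speed it cannot reach the
    boundary in time [T]; [bootstrap] removes the circularity. *)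
Lemma traj_slow F T c p (q B : R) : 0 <= T -> 0 <= B -> traj F T c ->
  (forall y, `|y - p| < q -> `|F y| <= B) -> `|c 0 - p| + B * T < q ->
  forall t, 0 <= t <= T -> `|c t - c 0| <= B * t /\ `|c t - p| < q.
Proof.
move=> T0 B0 cT FB cq.
pose M := (`|c 0 - p| + B * T + q) / 2.
have BT : 0 <= B * T by rewrite mulr_ge0.
have Mq : M < q by rewrite /M; lra.
have key t : 0 <= t <= T -> (forall s, 0 <= s <= t -> `|c s - p| <= M) ->
    `|c t - c 0| <= B * t.
  move=> /andP[t0 tT] H; have [cc dc] := traj_sub tT cT.
  have := @mean_value _ c (fun s => F (c s)) 0 B 0 t t0 B0 cc dc.
  rewrite scaler0 !subr0; apply => s /andP[s0 st]; rewrite subr0; apply: FB.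
  by rewrite (le_lt_trans (H s _))// !ltW.
have tri t : `|c t - p| <= `|c t - c 0| + `|c 0 - p|.
  by rewrite -(subrKA (c 0)) ler_normD.
have Bt t : t <= T -> B * t <= B * T by move=> tT; rewrite ler_wpM2l.
have H : forall t, 0 <= t <= T -> `|c t - p| < M.
  apply: bootstrap => //; first exact: traj_dist_within cT.
    by rewrite /M; lra.
  move=> t t0T H; have := key t t0T H; have := tri t.
  by have /andP[_ /Bt] := t0T; rewrite /M; lra.
move=> t t0T; split; last by rewrite (lt_trans (H t t0T)).
apply: key => // s /andP[s0 st]; apply: ltW; apply: H; rewrite s0 (le_trans st)//.
by have /andP[] := t0T.
Qed.

Lemma is_derive_sub c c' w w' t : is_derive t 1 c w -> is_derive t 1 c' w' ->
  is_derive t 1 (fun t => c t - c' t) (w - w').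
Proof. by move=> d d'; exact: (is_deriveB d d'). Qed.

Lemma within_subr c c' (a b : R) : {within `[a, b], continuous c} ->
  {within `[a, b], continuous c'} -> {within `[a, b], continuous (fun t => c t - c' t)}.
Proof. by move=> cc cc'; exact: (within_continuousB cc cc'). Qed.

Lemma traj_pair F L T c c' : 0 <= T -> 0 <= L -> traj F T c -> traj F T c' ->
  (forall t, 0 < t < T -> `|F (c t) - F (c' t)| <= L * `|c t - c' t|) ->
  `|c T - c' T| <= gron L T * `|c 0 - c' 0| /\ `|c 0 - c' 0| <= gron L T * `|c T - c' T|.
Proof.
move=> T0 L0 [cc dc] [cc' dc'] H.
have := @gronwall_vec _ (fun t => c t - c' t) (fun t => F (c t) - F (c' t)) L 0 0 T T0 L0 (lexx 0).
rewrite !addr0 subr0; apply.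
- exact: within_subr.
- by move=> t tT; apply: is_derive_sub; [exact: dc|exact: dc'].
- by move=> t /H; rewrite addr0.
Qed.

Lemma traj_pair_le F L T D c c' : 0 <= T <= D -> 0 <= L -> traj F T c -> traj F T c' ->
  (forall t, 0 < t < T -> `|F (c t) - F (c' t)| <= L * `|c t - c' t|) ->
  forall t, 0 <= t <= T -> `|c t - c' t| <= gron L D * `|c 0 - c' 0|.
Proof.
move=> /andP[T0 TD] L0 cT cT' H t /andP[t0 tT].
have [|H1 _] := @traj_pair F L t c c' t0 L0 (traj_sub tT cT) (traj_sub tT cT').
  by move=> s /andP[s0 st]; apply: H; rewrite s0 (lt_le_trans st).
by rewrite (le_trans H1)// ler_wpM2r// gron_le// (le_trans tT).
Qed.

(** The Lipschitz bound is available only in a tube about [c0]. The Gronwall estimate, valid while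
    [c] is in the tube, keeps it strictly inside, so [bootstrap] applies. *)
Lemma shadow F L (q : R) T c c0 : 0 <= T -> 0 <= L -> traj F T c -> traj F T c0 ->
  (forall t, 0 <= t <= T -> lip_on L F (nb (c0 t) q)) ->
  gron L T * `|c 0 - c0 0| < q ->
  forall t, 0 <= t <= T -> `|c t - c0 t| <= gron L T * `|c 0 - c0 0|.
Proof.
move=> T0 L0 cT c0T FL cq.
pose M := (gron L T * `|c 0 - c0 0| + q) / 2.
have Mq : M < q by rewrite /M; lra.
have q0 : 0 < q.
  by rewrite (le_lt_trans _ cq)// mulr_ge0// (le_trans _ (gron_ge2 L0 T0)).
have key t : 0 <= t <= T -> (forall s, 0 <= s <= t -> `|c s - c0 s| <= M) ->
    `|c t - c0 t| <= gron L T * `|c 0 - c0 0|.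
  move=> /andP[t0 tT] H.
  apply: (@traj_pair_le F L t T) => //; rewrite ?t0 ?lexx//; do ?exact: traj_sub tT _.
  move=> s /andP[s0 st].
  apply: (FL s); rewrite /nb/= ?subrr ?normr0//.
    by rewrite ltW// (le_trans (ltW st)).
  by rewrite (le_lt_trans (H s _))// !ltW.
have H : forall t, 0 <= t <= T -> `|c t - c0 t| < M.
  apply: bootstrap => //.
  - apply: (@within_comp _ _ _ (fun t => c t - c0 t) (fun x : E => `|x|)).
      by move=> t _; exact: norm_continuous.
    exact: within_subr cT.1 c0T.1.
  - have Gn : `|c 0 - c0 0| <= gron L T * `|c 0 - c0 0|.
      by rewrite ler_peMl// (le_trans _ (gron_ge2 L0 T0))// ler1n.
    by rewrite /M; lra.
  - by move=> t t0T H; rewrite (le_lt_trans (key t t0T H))// /M; lra.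
move=> t t0T; apply: key => // s /andP[s0 st]; apply: ltW; apply: H; rewrite s0 (le_trans st)//.
by have /andP[] := t0T.
Qed.

Lemma traj_direction F p (q e : R) T c : 0 <= e -> traj F T c ->
  (forall y, `|y - p| < q -> `|F y - F p| <= e) ->
  (forall t, 0 <= t <= T -> `|c t - p| < q) ->
  forall s t, 0 <= s -> s <= t -> t <= T -> `|c t - c s - (t - s) *: F p| <= e * (t - s).
Proof.
move=> e0 [cc dc] Fe cq s t s0 st tT.
apply: (@mean_value _ c (fun t => F (c t))) => //.
- exact: within_sub cc.
- by move=> u /andP[su ut]; apply: dc; rewrite (le_lt_trans s0 su) (lt_le_trans ut tT).
- move=> u /andP[su ut]; apply/Fe/cq.
  by rewrite (le_trans s0 (ltW su)) (le_trans (ltW ut) tT).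
Qed.

(** Near [p] the curve moves almost along [F p], so [phi] increases by almost
    [dot d (F p) * (t - s)]. The curvature of the orbit and the expansion of [phi] are each allowed
    to lose a quarter of this, which leaves one half. *)
Lemma traj_rate F (phi : E -> R) p d L r0 : 0 < r0 -> 0 <= L ->
  sdiff phi p d -> 0 < dot d (F p) -> lip_on L F (nb p r0) ->
  exists2 q, 0 < q <= r0 & forall T c, traj F T c ->
    (forall t, 0 <= t <= T -> `|c t - p| < q) ->
    forall s t, 0 <= s -> s <= t -> t <= T ->
      dot d (F p) / 2 * (t - s) <= phi (c t) - phi (c s).
Proof.
move=> r00 L0 phid a0 FL; set a := dot d (F p) in a0 *.
have n0 : 0 < 4 * (`|F p| + 1) by rewrite mulr_gt0// ltr_wpDl.
pose e1 := a / (4 * (`|F p| + 1)); have e10 : 0 < e1 by rewrite divr_gt0.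
have m0 : 0 < 12 * (`|d| + 1) by rewrite mulr_gt0// ltr_wpDl.
pose e2 := Num.min 1 (a / (12 * (`|d| + 1))).
have e20 : 0 < e2 by rewrite lt_min ltr01 divr_gt0.
have : \forall q \near 0^'+, [/\ q <= r0, q <= e2 / (L + 1) & forall y z,
   `|y - p| < q -> `|z - p| < q -> `|phi y - phi z - dot d (y - z)| <= e1 * `|y - z|].
  near=> q; split; near: q; [exact: nbhs_right_le| |exact: phid].
  by apply: nbhs_right_le; rewrite divr_gt0// ltr_wpDl.
move=> /near0_ex[q q0 [qr0 qe2 Hq]]; exists q; first by rewrite q0.
move=> T c cT cq s t s0 st tT.
have Fe2 y : `|y - p| < q -> `|F y - F p| <= e2.
  move=> yq; rewrite (le_trans (FL _ _ (lt_le_trans yq qr0) (nb_center _ r00)))//.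
  have := ltW (lt_le_trans yq qe2); rewrite ler_pdivlMr ?ltr_wpDl//.
  by have := normr_ge0 (y - p); nra.
have := traj_direction (ltW e20) cT Fe2 cq s0 st tT.
have := Hq (c t) (c s) (cq _ _) (cq _ _).
rewrite (le_trans s0 st) tT s0 (le_trans st tT) => /(_ isT isT).
set D := c t - c s; set k := t - s => H1 H2.
have k0 : 0 <= k by rewrite subr_ge0.
have H3 : `|dot d D - k * a| <= 3 * `|d| * (e2 * k).
  by rewrite /a -dotZr -dotBr (le_trans (dot_le _ _))// ler_wpM2l// mulr_ge0.
have H4 : `|D| <= k * (`|F p| + 1).
  rewrite -(subrK (k *: F p) D) (le_trans (ler_normD _ _))// normrZ (ger0_norm k0).
  rewrite mulrDr mulr1 addrC lerD2l (le_trans H2)// ler_piMl// /e2.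
  by rewrite ge_min lexx.
have H5 : 3 * `|d| * e2 <= a / 4.
  apply: (@le_trans _ _ (3 * `|d| * (a / (12 * (`|d| + 1))))).
    by rewrite ler_wpM2l ?mulr_ge0// /e2 ge_min lexx orbT.
  have d1 : 0 < `|d| + 1 by rewrite ltr_wpDl.
  have -> : 3 * `|d| * (a / (12 * (`|d| + 1))) = a / 4 * (`|d| / (`|d| + 1)).
    by field; rewrite gt_eqF.
  rewrite ler_piMr ?divr_ge0 ?(ltW a0)// ler_pdivrMr// mul1r lerDl//.
have H6 : e1 * `|D| <= a / 4 * k.
  rewrite (le_trans (ler_wpM2l (ltW e10) H4))// /e1.
  have f1 : 0 < `|F p| + 1 by rewrite ltr_wpDl.
  have -> : a / (4 * (`|F p| + 1)) * (k * (`|F p| + 1)) = a / 4 * k.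
    by field; rewrite gt_eqF.
  by [].
have H7 : 3 * `|d| * (e2 * k) <= a / 4 * k by rewrite mulrA ler_wpM2r.
move: H1 H3; rewrite !ler_norml => /andP[? _] /andP[? _]; lra.
Unshelve. all: by end_near. Qed.

Lemma traj_speed (F : E -> E) (c : R -> E) L a b T : 0 <= L -> traj F T c ->
  0 <= a -> a <= b -> b <= T -> (forall t, a <= t <= b -> `|F (c t)| <= L) ->
  `|c b - c a| <= L * (b - a).
Proof.
move=> L0 [cc dc] a0 ab bT FL.
have := @mean_value _ c (fun t => F (c t)) 0 L a b ab L0 (within_sub a0 bT cc).
rewrite scaler0 subr0; apply.
  by move=> t /andP[ta tb]; apply: dc; rewrite (le_lt_trans a0 ta) (lt_le_trans tb).
by move=> t /andP[ta tb]; rewrite subr0; apply: FL; rewrite !ltW.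
Qed.

End Trajectories.

Lemma lip_continuous {R : realType} (phi : 'rV[R]_3 -> R) p (L r : R) : 0 < L -> 0 < r ->
  (forall y z, nb p r y -> nb p r z -> `|phi y - phi z| <= L * `|y - z|) ->
  {for p, continuous phi}.
Proof.
move=> L0 r0 phiL; rewrite /prop_for /continuous_at.
apply/(@cvgrPdist_le _ _ _ (nbhs p)) => e e0; apply/nbhs_ballP.
exists (Num.min r (e / L)) => /=; first by rewrite lt_min r0 divr_gt0.
move=> y; rewrite -ball_normE /= lt_min => /andP[yr yL].
rewrite (le_trans (phiL _ _ (nb_center _ r0) _))//; first by rewrite /nb/= distrC.
by move: (ltW yL); rewrite ler_pdivlMr// mulrC.
Qed.

(** * Transversal hitting of a level set *)

Section Hitting.
Context {R : realType}.
Local Notation E := 'rV[R]_3.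
Implicit Types (c : R -> E) (t s : R).
Variables (F : E -> E) (phi : E -> R) (c0 : R -> E) (T ta : R) (d : E) (L dl : R).
Hypotheses (c0T : traj F T c0) (ta0 : 0 <= ta) (taT : ta < T).
Hypotheses (L0 : 0 < L) (dl0 : 0 < dl).
Hypothesis FL : forall t, 0 <= t <= T -> lip_on L F (nb (c0 t) dl).
Hypothesis phiL : forall t, 0 <= t <= T -> forall y z, nb (c0 t) dl y -> nb (c0 t) dl z ->
  `|phi y - phi z| <= L * `|y - z|.
Hypothesis phi_neg : forall t, ta <= t < T -> phi (c0 t) < 0.
Hypothesis phi_T : phi (c0 T) = 0.
Hypotheses (phid : sdiff phi (c0 T) d) (a0 : 0 < dot d (F (c0 T))).

(** The sign condition starts only at [ta]: an arc of X begins on the switching surface, where the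
    function to be hit vanishes as well. *)
Definition hits T1 c := [/\ ta <= T1, traj F T1 c, phi (c T1) = 0 &
  forall t, ta <= t < T1 -> phi (c t) < 0].

Let T0 : 0 < T. Proof. exact: le_lt_trans ta0 taT. Qed.

Lemma phi_neg_bound T' : T' < T ->
  exists2 m, 0 < m & forall t, ta <= t <= T' -> phi (c0 t) <= - m.
Proof.
move=> T'T; have [taT'|T'ta] := leP ta T'; last first.
  by exists 1 => // t /andP[tat /(le_trans tat)]; rewrite leNgt T'ta.
have cphi : {within `[ta, T'], continuous (fun t => phi (c0 t))}.
  apply: (@within_comp _ _ _ c0 phi); last exact: within_sub ta0 (ltW T'T) c0T.1.
  move=> t /andP[tat tT']; apply: (lip_continuous L0 dl0); apply: phiL.
  by rewrite (le_trans ta0 tat) (le_trans tT' (ltW T'T)).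
have [t0 + t0max] := EVT_max taT' cphi; rewrite in_itv/= => /andP[tat0 t0T'].
exists (- phi (c0 t0)) => [|t tT]; first by rewrite oppr_gt0 phi_neg// tat0 (le_lt_trans t0T').
by rewrite opprK; apply: t0max; rewrite in_itv.
Qed.

Let B := `|F (c0 T)| + L * dl.
Let G := gron L T.
Let TT : 0 <= T <= T. Proof. by rewrite lexx ltW. Qed.
Let B0 : 0 < B. Proof. by rewrite ltr_wpDl// mulr_gt0. Qed.
Let G2 : 2 <= G. Proof. by apply: gron_ge2; rewrite ltW. Qed.
Let G0 : 0 < G. Proof. exact: lt_le_trans G2. Qed.

Let FB y : `|y - c0 T| < dl -> `|F y| <= B.
Proof.
move=> yd; rewrite /B -(subrK (F (c0 T)) (F y)) addrC (le_trans (ler_normD _ _))// lerD2l.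
rewrite (le_trans (FL TT yd (nb_center _ dl0)))// ler_wpM2l ?ltW//.
Qed.

(** Between [ta] and [T - h] the function is bounded away from 0 on [c0], so a nearby curve cannot
    hit; by [T + h] the rate of growth would have made it positive. [Num.min t T] keeps the
    reference at its end point when [c] lasts longer than [c0]. *)
Lemma hit_single eta : 0 < eta -> exists2 r, 0 < r & forall T1 c, hits T1 c ->
  `|c 0 - c0 0| < r ->
  `|T1 - T| <= eta /\ forall t, 0 <= t <= T1 -> `|c t - c0 (Num.min t T)| <= eta.
Proof.
move=> eta0.
have [q /andP[q0 qdl] Hq] := traj_rate dl0 (ltW L0) phid a0 (FL TT).
move: (a0) Hq; set a := dot d _ => a0' Hq.
(* [h] is the tolerated time error: at speed [B], the displacement during [h] is at most a quarter
   of [q] and of [eta]. *)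
pose h := Num.min eta (Num.min q eta / (4 * B)).
have h0 : 0 < h by rewrite lt_min eta0 divr_gt0// ?lt_min ?q0 ?eta0// mulr_gt0.
have Bh : B * h <= Num.min q eta / 4.
  have : h <= Num.min q eta / (4 * B) by rewrite /h ge_min lexx orbT.
  rewrite ler_pdivlMr ?mulr_gt0//; lra.
have Bhq : B * h <= q / 4 by rewrite (le_trans Bh)// ler_pM2r// ge_min lexx.
have Bhe : B * h <= eta / 4 by rewrite (le_trans Bh)// ler_pM2r// ge_min lexx orbT.
have heta : h <= eta by rewrite /h ge_min lexx.
have Th : T - h < T by rewrite ltrBlDr ltrDl.
have [m m0 Hm] := phi_neg_bound Th.
pose k := Num.min (Num.min dl (m / L)) (Num.min (Num.min (q / 2) (eta / 2)) (a * h / (4 * L))).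
have k0 : 0 < k by rewrite !lt_min dl0 !divr_gt0 ?mulr_gt0.
exists (k / G); first by rewrite divr_gt0.
move=> T1 c [taT1 cT phicT phic] cr.
have T10 : 0 <= T1 by exact: le_trans taT1.
have Gk : G * `|c 0 - c0 0| < k by move: cr; rewrite ltr_pdivlMr// mulrC.
have [kdl km kq ke ka] : [/\ k <= dl, L * k <= m, k <= q / 2, k <= eta / 2 & L * k <= a * h / 4].
  have /andP[/andP[-> H1] /andP[/andP[-> ->] H2]] :
    ((k <= dl) && (k <= m / L)) && (((k <= q / 2) && (k <= eta / 2)) && (k <= a * h / (4 * L))).
    by rewrite -!le_min.
  split=> //; first by move: H1; rewrite ler_pdivlMr// mulrC.
  move: H2; rewrite ler_pdivlMr ?mulr_gt0//; lra.
have near0 t : 0 <= t <= Num.min T1 T -> `|c t - c0 t| < k.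
  move=> tm; apply: le_lt_trans (Gk).
  have m0' : 0 <= Num.min T1 T by rewrite le_min T10 ltW.
  have mT : Num.min T1 T <= T by rewrite ge_min lexx orbT.
  have GG : gron L (Num.min T1 T) <= G by apply: gron_le => //; exact: ltW.
  apply: le_trans (_ : gron L (Num.min T1 T) * `|c 0 - c0 0| <= _); last by rewrite ler_wpM2r.
  apply: (@shadow _ F L dl (Num.min T1 T)) => //; first exact: ltW.
  - by apply: traj_sub cT; rewrite ge_min lexx.
  - exact: traj_sub mT c0T.
  - by move=> s /andP[s0 sT]; apply: FL; rewrite s0 (le_trans sT).
  - rewrite (lt_le_trans _ kdl)// (le_lt_trans _ Gk)// ler_wpM2r//.
have phinear t : 0 <= t <= Num.min T1 T -> `|phi (c t) - phi (c0 t)| < L * k.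
  move=> tm; have /andP[t0 tmT] := tm; have tT : 0 <= t <= T.
    by rewrite t0 (le_trans tmT)// ge_min lexx orbT.
  have H := near0 t tm.
  rewrite (le_lt_trans (phiL tT _ (nb_center _ dl0)))//; first exact: lt_le_trans H kdl.
  by rewrite ltr_pM2l.
have slow T2 : T <= T2 -> T2 <= T1 -> T2 <= T + h ->
    forall t, 0 <= t <= T2 - T -> `|c (t + T) - c T| <= B * t /\ `|c (t + T) - c0 T| < q.
  move=> TT2 T2T1 T2h t tT2.
  have T00 := ltW T0.
  have cT' : traj F (T2 - T) (fun t => c (t + T)).
    by apply: traj_shift => //; exact: traj_sub cT.
  have T20 : 0 <= T2 - T by rewrite subr_ge0.
  have := @traj_slow _ F (T2 - T) (fun t => c (t + T)) (c0 T) q B T20 (ltW B0) cT'.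
  rewrite add0r; apply => //.
    by move=> y yq; apply: FB; exact: lt_le_trans qdl.
  have := near0 T; rewrite (min_r (le_trans TT2 T2T1)) lexx T00 => /(_ isT).
  have : B * (T2 - T) <= B * h by rewrite ler_pM2l//; lra.
  lra.
have T1lo : T - h < T1.
  rewrite ltNge; apply/negP => T1h.
  have T1T : T1 <= T by exact: le_trans T1h (ltW Th).
  have := phinear T1; rewrite (min_l T1T) T10 lexx => /(_ isT).
  rewrite phicT sub0r normrN ler0_norm; last first.
    by apply: ltW; apply: phi_neg; rewrite taT1 (le_lt_trans T1h).
  have := Hm T1; rewrite taT1 T1h => /(_ isT); lra.
have T1hi : T1 < T + h.
  rewrite ltNge; apply/negP => T1h.
  have TT1 : T <= T1 by rewrite (le_trans _ T1h)// lerDl ltW.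
  have HT : T <= T + h by rewrite lerDl ltW.
  have cT' : traj F h (fun t => c (t + T)).
    have -> : h = T + h - T by ring.
    apply: traj_shift; first exact: ltW.
    exact: traj_sub cT.
  have := Hq h _ cT' _ 0 h (lexx 0) (ltW h0) (lexx h).
  rewrite add0r subr0 => H.
  have {}H : a / 2 * h <= phi (c (h + T)) - phi (c T).
    apply: H => t th; apply: (slow (T + h) _ _ _ t _).2 => //.
    by have -> : T + h - T = h by ring.
  have : phi (c (h + T)) <= 0.
    have [<-|neq] := eqVneq T1 (h + T); first by rewrite phicT.
    apply/ltW/phic; rewrite lt_neqAle eq_sym neq/= addrC T1h andbT.
    by rewrite (le_trans (ltW taT)).
  have := phinear T; rewrite (min_r TT1) lexx (ltW T0) => /(_ isT).
  rewrite phi_T subr0 ltr_norml => /andP[? _].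
  have : 0 < a * h by rewrite mulr_gt0.
  lra.
split; first by rewrite ler_norml; apply/andP; split; lra.
move=> t /andP[t0 tT1]; have [tT|Tt] := leP t T.
  have H := near0 t; apply: ltW; apply: lt_le_trans (H _) _; last by lra.
  by rewrite t0 le_min tT1.
have TT1 : T <= T1 := le_trans (ltW Tt) tT1.
have tTT : 0 <= t - T <= T1 - T by rewrite subr_ge0 (ltW Tt) lerD2r.
have [H _] := slow T1 TT1 (lexx _) (ltW T1hi) _ tTT.
rewrite subrK in H.
have := near0 T; rewrite (min_r TT1) lexx (ltW T0) => /(_ isT).
have := ler_normD (c t - c T) (c T - c0 T); rewrite subrKA.
have : B * (t - T) <= B * h by rewrite ler_pM2l//; lra.
lra.
Qed.

(** When the first curve hits, the value of [phi] on the other one is of the order of their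
    distance. It then rises at rate at least [a / 2], so the second hit follows after a time
    proportional to that distance. *)
Lemma hit_pair : exists C r, [/\ 0 < C, 0 < r & forall T1 c1 T2 c2, hits T1 c1 -> hits T2 c2 ->
  `|c1 0 - c0 0| < r -> `|c2 0 - c0 0| < r ->
  `|T1 - T2| <= C * `|c1 0 - c2 0| /\
  forall t, 0 <= t <= Num.min T1 T2 -> `|c1 t - c2 t| <= C * `|c1 0 - c2 0|].
Proof.
have [q /andP[q0 qdl] Hq] := traj_rate dl0 (ltW L0) phid a0 (FL TT).
move: (a0) Hq; set a := dot d _ => a0' Hq.
have q20 : 0 < q / 2 by rewrite divr_gt0.
have [e e0 He] := (within_itvP _ _ _).1 c0T.1 T TT _ q20.
pose eta := Num.min (Num.min 1 (q / 4)) (e / 2).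
have eta0 : 0 < eta by rewrite !lt_min ltr01 !divr_gt0.
have [eta1 etaq etae] : [/\ eta <= 1, eta <= q / 4 & eta <= e / 2].
  have /andP[/andP[-> ->] ->] : ((eta <= 1) && (eta <= q / 4)) && (eta <= e / 2).
    by rewrite -!le_min.
  by [].
have [r r0 Hr] := hit_single eta0.
pose G' := gron L (T + 1).
have T10 : 0 <= T + 1 by rewrite addr_ge0// ltW.
have G'2 : 2 <= G' by apply: gron_ge2 => //; exact: ltW.
have G'0 : 0 < G' by exact: lt_le_trans G'2.
have K0 : 0 < 2 * L * G' / a by rewrite divr_gt0// mulr_gt0// mulr_gt0.
exists (G' + 2 * L * G' / a), r; split=> //; first by rewrite addr_gt0.
suff wl T1 c1 T2 c2 : hits T1 c1 -> hits T2 c2 ->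
    `|c1 0 - c0 0| < r -> `|c2 0 - c0 0| < r -> T1 <= T2 ->
    T2 - T1 <= (G' + 2 * L * G' / a) * `|c1 0 - c2 0| /\
    forall t, 0 <= t <= T1 -> `|c1 t - c2 t| <= (G' + 2 * L * G' / a) * `|c1 0 - c2 0|.
  move=> T1 c1 T2 c2 h1 h2 r1 r2; have [T12|T21] := leP T1 T2.
    have [H1 H2] := wl _ _ _ _ h1 h2 r1 r2 T12; split=> //.
    by rewrite distrC ger0_norm// subr_ge0.
  have [H1 H2] := wl _ _ _ _ h2 h1 r2 r1 (ltW T21); split.
    by rewrite gtr0_norm ?subr_gt0// [`|c1 0 - _|]distrC.
  by move=> t /H2; rewrite distrC [`|c1 0 - _|]distrC.
move=> h1 h2 r1 r2 T12.
have [HT1 Hc1] := Hr _ _ h1 r1; have [HT2 Hc2] := Hr _ _ h2 r2.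
have [ta1 c1T phi1 _] := h1; have [ta2 c2T phi2 _] := h2.
have T1ge : 0 <= T1 by exact: le_trans ta1.
have min0 t : 0 <= t -> 0 <= Num.min t T <= T.
  by move=> t0; rewrite le_min t0 (ltW T0) ge_min lexx orbT.
have etadl : eta < dl by rewrite (le_lt_trans etaq)// (lt_le_trans _ qdl)//; lra.
have T1D : 0 <= T1 <= T + 1.
  by rewrite T1ge; move: HT1; rewrite ler_norml => /andP[_]; lra.
have close t : 0 <= t <= T1 -> `|c1 t - c2 t| <= G' * `|c1 0 - c2 0|.
  apply: (traj_pair_le (F := F) (L := L) (T := T1) (D := T + 1)) => //; first exact: ltW.
    exact: traj_sub c2T.
  move=> s /andP[s0 sT].
  have s1 : 0 <= s <= T1 by rewrite !ltW.
  have s2 : 0 <= s <= T2 by rewrite ltW//= (le_trans (ltW sT)).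
  apply: (FL (min0 s (ltW s0))); rewrite /nb/= (le_lt_trans _ etadl)//.
    exact: Hc1.
  exact: Hc2.
split; last first.
  move=> t tT; rewrite (le_trans (close t tT))// ler_wpM2r// lerDl ltW//.
have shift2 : traj F (T2 - T1) (fun t => c2 (t + T1)).
  by apply: traj_shift.
have T21 : 0 <= T2 - T1 by rewrite subr_ge0.
have := Hq _ _ shift2 _ 0 (T2 - T1) (lexx 0) T21 (lexx _).
rewrite subr0 add0r subrK phi2 sub0r => H.
have {}H : a / 2 * (T2 - T1) <= - phi (c2 T1).
  apply: H => t /andP[t0 tT].
  have tT1 : 0 <= t + T1 <= T2 by apply/andP; split; lra.
  have := Hc2 _ tT1.
  have : `|c0 (Num.min (t + T1) T) - c0 T| < q / 2.
    apply: He; first by apply: min0; lra.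
    have [le|lt] := leP (t + T1) T; last by rewrite subrr normr0.
    rewrite distrC ger0_norm ?subr_ge0//.
    move: HT1; rewrite ler_norml => /andP[? _]; lra.
  have := ler_normD (c2 (t + T1) - c0 (Num.min (t + T1) T)) (c0 (Num.min (t + T1) T) - c0 T).
  rewrite subrKA; lra.
have T11 : 0 <= T1 <= T1 by rewrite T1ge lexx.
have T12' : 0 <= T1 <= T2 by rewrite T1ge.
have N1 : nb (c0 (Num.min T1 T)) dl (c1 T1) by exact: le_lt_trans (Hc1 _ T11) etadl.
have N2 : nb (c0 (Num.min T1 T)) dl (c2 T1) by exact: le_lt_trans (Hc2 _ T12') etadl.
have := phiL (min0 _ T1ge) N1 N2; rewrite phi1 sub0r normrN => H'.
have {}H' : - phi (c2 T1) <= L * (G' * `|c1 0 - c2 0|).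
  rewrite (le_trans _ (ler_wpM2l (ltW L0) (close _ T11)))// (le_trans _ H')//.
  by rewrite -normrN ler_norm.
have H3 : T2 - T1 <= 2 * L * G' / a * `|c1 0 - c2 0|.
  have -> : 2 * L * G' / a * `|c1 0 - c2 0| = (2 * (L * (G' * `|c1 0 - c2 0|))) / a.
    by field; rewrite gt_eqF.
  rewrite ler_pdivlMr//; lra.
rewrite (le_trans H3)// ler_wpM2r// lerDr ltW//.
Qed.

End Hitting.

(** * The sliding flow near the pseudo-focus *)

Section PlaneFocus.
Context {R : realType}.

(** A zero [A 1 0] or a nonnegative discriminant would produce a real eigenvalue. So the
    characteristic roots are [a] plus or minus [i b], and trace and determinant follow. *)
Lemma plane_focus (A : 'M[R]_2) :
  (forall l : R[i], eigenvalue (map_mx (real_complex R) A) l ->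
     0 < complex.Re l /\ complex.Im l != 0) ->
  exists a b : R, [/\ 0 < a, b != 0, A 1 0 != 0, A 0 0 + A 1 1 = a *+ 2 &
    A 0 0 * A 1 1 - A 0 1 * A 1 0 = a ^+ 2 + b ^+ 2].
Proof.
move=> eig; set p := A 0 0; set q := A 0 1; set r := A 1 0; set s := A 1 1.
have r0 : r != 0.
  apply/eqP => r0.
  have /eig[_] : eigenvalue (map_mx (real_complex R) A) (real_complex R s).
    apply/eigenvalueP; exists (delta_mx 0 1).
      apply/rowP => j; rewrite -rowE !mxE; case: (unliftP 0 j) => [k|] ->.
        by rewrite ord1 /= mulr1; congr (real_complex R (A _ _)); exact/val_inj.
      by rewrite /= mulr0 -/r r0.
    by apply/eqP => /rowP/(_ 1); rewrite !mxE => /eqP; rewrite oner_eq0.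
  by rewrite /= eqxx.
(* For a root [l] of the characteristic polynomial, the row [(r, l - p)] is a left eigenvector; it
   is nonzero because [r] is. *)
have eigl (l : R[i]) : l ^+ 2 - (real_complex R (p + s)) * l + real_complex R (p * s - q * r) = 0 ->
    0 < complex.Re l /\ complex.Im l != 0.
  move=> l0; apply: eig; apply/eigenvalueP.
  exists (\row_j (if j == 0 then real_complex R r else l - real_complex R p)); last first.
    apply/eqP => /rowP/(_ 0); rewrite !mxE eqxx => /(congr1 (@complex.Re R))/= /eqP.
    by rewrite (negPf r0).
  have E1 : lift ord0 ord0 = 1 :> 'I_2 by exact/val_inj.
  have E0 : ord0 = 0 :> 'I_2 by exact/val_inj.
  apply/rowP => j; rewrite !mxE !big_ord_recl big_ord0 !mxE E1 E0/= addr0.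
  have [->|j1] := eqVneq j 0.
    by rewrite -/p -/r; ring.
  have -> : j = 1.
    by apply/val_inj; case: j j1 => -[|[|//]].
  rewrite -/q -/s; apply/eqP; rewrite -subr_eq0; apply/eqP; rewrite -[RHS]oppr0 -l0.
  rewrite rmorphD rmorphB rmorphM rmorphM; ring.
pose D := ((p + s) ^+ 2 - 4 * (p * s - q * r)).
have [D0|D0] := leP 0 D.
  pose l := (p + s + Num.sqrt D) / 2.
  have [|_] := eigl (real_complex R l); last by rewrite /= eqxx.
  rewrite -rmorphXn -rmorphM -rmorphB -rmorphD.
  have -> : l ^+ 2 - (p + s) * l + (p * s - q * r) = (Num.sqrt D ^+ 2 - D) / 4.
    by rewrite /l /D; field.
  by rewrite sqr_sqrtr// subrr mul0r rmorph0.
pose a := (p + s) / 2; pose b := Num.sqrt (- D) / 2.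
have b2 : b ^+ 2 = - D / 4.
  by rewrite /b exprMn sqr_sqrtr ?oppr_ge0 ?ltW//; field.
have b0 : 0 < b by rewrite divr_gt0// sqrtr_gt0 oppr_gt0.
have H : p * s - q * r = a ^+ 2 + b ^+ 2 by rewrite b2 /a /D; field.
have [|/= a0 _] := eigl (Complex a b).
  have -> : p + s = a *+ 2 by rewrite /a mulr2n; field.
  rewrite H expr2; apply/eqP; rewrite eq_complex/=; apply/andP; split; apply/eqP; ring.
exists a, b; split=> //; first by rewrite gt_eqF.
by rewrite /a mulr2n; field.
Qed.
End PlaneFocus.

Section FocusFunctionals.
Context {R : realType}.
Local Notation E := 'rV[R]_3.

(** In the basis formed by the rows of [B] and [X0], [f] is the first dual coordinate and [g] is
    forced by the first of the two relations with [J]; the second relation is then Cayley-Hamilton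
    for [A]. Both functionals kill the direction [X0], transverse to the tangent plane, so that
    errors along the arriving arc will be invisible to them. *)
Lemma focus_functionals (n X0 : E) (J : 'M[R]_3) (B : 'M[R]_(2, 3)) (A : 'M[R]_2) :
  row_free B -> (forall i, dot n (row i B) = 0) -> B *m J = A *m B ->
  (forall l : R[i], eigenvalue (map_mx (real_complex R) A) l ->
     0 < complex.Re l /\ complex.Im l != 0) ->
  dot n X0 != 0 ->
  exists (a b C : R) (f g : E), [/\ 0 < a, b != 0, 0 < C, dot f X0 = 0 & dot g X0 = 0] /\
    (forall z, dot n z = 0 -> dot f (z *m J) = a * dot f z - b * dot g z /\
       dot g (z *m J) = b * dot f z + a * dot g z) /\
    forall z, `|z| <= C * (`|dot f z| + `|dot g z| + `|dot n z|).
Proof.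
move=> Bfree nB BJ /plane_focus[a [b [a0 b0 r0 trA detA]]] nX0.
pose B3 : 'M[R]_3 := col_mx B X0.
have dotmx (u v : E) : v *m u^T = (dot u v)%:M.
  apply/matrixP => i j; rewrite !ord1 !mxE eqxx mulr1n; apply: eq_bigr => k _.
  by rewrite !mxE mulrC.
have nB0 : B *m n^T = 0.
  apply/row_matrixP => i; rewrite row_mul dotmx nB row0.
  by apply/matrixP => k l; rewrite !mxE mul0rn.
(* Pairing a linear relation among the rows with [n] kills the coefficient of [X0]; the freeness of
   [B] then kills the others. *)
have B3u : B3 \in unitmx.
  rewrite -row_free_unit; apply/inj_row_free => v.
  rewrite /B3 -[v](hsubmxK (n1 := 2) (n2 := 1)) => H; move: H.
  rewrite (mul_row_col (lsubmx (v : 'rV_(2 + 1))) (rsubmx (v : 'rV_(2 + 1)))).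
  set v1 := lsubmx _; set v2 := rsubmx _ => H.
  have v20 : v2 = 0.
    have /(congr1 (fun M => (M *m n^T) 0 0)) := H.
    rewrite mulmxDl -!mulmxA nB0 mulmx0 add0r dotmx mul0mx !mxE big_ord_recl big_ord0.
    rewrite !mxE eqxx mulr1n addr0 => /eqP; rewrite mulf_eq0 (negPf nX0) orbF => /eqP H0.
    by apply/matrixP => i j; rewrite !ord1 !mxE.
  have v10 : v1 = 0.
    by apply: (row_free_inj Bfree); rewrite mul0mx -H v20 mul0mx addr0.
  by rewrite v10 v20 row_mx0.
pose W := invmx B3; pose k i : E := (col i W)^T.
have kE i (z : E) : dot (k i) z = (z *m W) 0 i.
  by rewrite mxE; apply: eq_bigr => j _; rewrite !mxE mulrC.
pose i0 : 'I_3 := lshift 1 (0 : 'I_2); pose i1 : 'I_3 := lshift 1 (1 : 'I_2).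
pose i2 : 'I_3 := rshift 2 (0 : 'I_1).
have kX i : dot (k i) X0 = (i == i2)%:R.
  have X0E : X0 = delta_mx 0 i2 *m B3.
    rewrite -rowE; apply/rowP => j; rewrite mxE.
    by rewrite (col_mxEd B X0).
  by rewrite kE X0E mulmxK// mxE eqxx.
have decz (z : E) : z = z *m W *m B3 by rewrite mulmxKV.
have nz (z : E) : dot n z = dot (k i2) z * dot n X0.
  have /(congr1 (fun M => (M *m n^T) 0 0)) := decz z.
  rewrite dotmx !mxE eqxx mulr1n => ->.
  pose y : 'rV_(2 + 1) := z *m W.
  have -> : z *m W *m B3 = lsubmx y *m B + rsubmx y *m X0.
    by rewrite -(mul_row_col (lsubmx y) (rsubmx y) B X0) hsubmxK.
  have : ((lsubmx y *m B + rsubmx y *m X0) *m n^T) 0 0 = dot (k i2) z * dot n X0.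
    rewrite mulmxDl -!mulmxA nB0 mulmx0 add0r dotmx mxE big_ord_recl big_ord0 addr0.
    by rewrite !mxE eqxx mulr1n kE !mxE.
  by rewrite mxE.
pose p := A 0 0; pose r := A 1 0.
have kJ (z : E) : dot n z = 0 ->
    dot (k i0) (z *m J) = dot (k i0) z * A 0 0 + dot (k i1) z * A 1 0 /\
    dot (k i1) (z *m J) = dot (k i0) z * A 0 1 + dot (k i1) z * A 1 1.
  move=> z0; pose y : 'rV_(2 + 1) := z *m W.
  have y20 : rsubmx y = 0.
    apply/matrixP => i j; rewrite !ord1 !mxE; have := nz z.
    rewrite z0 => /esym/eqP; rewrite mulf_eq0 (negPf nX0) orbF kE => /eqP.
    by rewrite !mxE.
  have zE : z = lsubmx y *m B.
    rewrite {1}[z]decz -/y -{1}(hsubmxK y) (mul_row_col (lsubmx y) (rsubmx y) B X0).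
    by rewrite y20 mul0mx addr0.
  have zJ : z *m J *m W = row_mx (lsubmx y *m A) 0 :> 'rV_(2 + 1).
    rewrite {1}zE -(mulmxA _ B J) BJ mulmxA.
    have -> : lsubmx y *m A *m B = row_mx (lsubmx y *m A) 0 *m B3.
      by rewrite (mul_row_col (lsubmx y *m A) 0 B X0) mul0mx addr0.
    by rewrite mulmxK.
  have E1 : lift ord0 ord0 = 1 :> 'I_2 by exact/val_inj.
  have E0 : ord0 = 0 :> 'I_2 by exact/val_inj.
  have kl (i : 'I_2) : dot (k (lshift 1 i)) (z *m J) =
      dot (k i0) z * A 0 i + dot (k i1) z * A 1 i.
    rewrite !kE zJ (row_mxEl (lsubmx y *m A) 0) mxE !big_ord_recl big_ord0 addr0 E1 E0.
    by rewrite !(mxE lsubmx_key).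
  by split; rewrite -kl.
pose f := k i0; pose g := (b^-1 * (a - A 0 0)) *: k i0 - (b^-1 * A 1 0) *: k i1.
have gE z : dot g z = ((a - A 0 0) * dot (k i0) z - A 1 0 * dot (k i1) z) / b.
  by rewrite /g dotBl !dotZl; ring.
have sE : A 1 1 = a + a - A 0 0 by rewrite -mulr2n -trA addrAC subrr add0r.
have bE : b * b = A 0 0 * A 1 1 - A 0 1 * A 1 0 - a * a.
  by rewrite detA !expr2; ring.
pose m := 1 + (`|a - A 0 0| + `|b|) / `|A 1 0| + `|dot n X0|^-1.
have m1 : 0 <= (`|a - A 0 0| + `|b|) / `|A 1 0| by rewrite divr_ge0// addr_ge0.
have m2 : 0 <= `|dot n X0|^-1 by rewrite invr_ge0.
have C0 : 0 < `|B3| * m + 1 by rewrite ltr_wpDl// mulr_ge0// !addr_ge0.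
exists a, b, (`|B3| * m + 1), f, g; split; [split=> //|split].
- by rewrite /f kX.
- by rewrite gE !kX/= !mulr0 subrr mul0r.
- move=> z z0; have [H0 H1] := kJ z z0; rewrite gE gE /f H0 H1; split.
    by rewrite mulrCA divff// mulr1 -/p -/r; ring.
  have fb u v w : u = b * b * w + a * v -> u / b = b * w + a * (v / b).
    by move=> ->; field.
  by apply: fb; rewrite bE sE -/p -/r; ring.
move=> z; set S := _ + _ + _.
have S0 : 0 <= S by rewrite !addr_ge0.
have k0S : `|dot (k i0) z| <= S by rewrite /S -/f -addrA lerDl addr_ge0.
have gS : `|dot g z| <= S by rewrite /S addrAC lerDr addr_ge0.
have nS : `|dot n z| <= S by rewrite /S lerDr addr_ge0.
have k1S : `|dot (k i1) z| <= (`|a - A 0 0| + `|b|) / `|A 1 0| * S.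
  have -> : dot (k i1) z = ((a - A 0 0) * dot (k i0) z - b * dot g z) / A 1 0.
    by rewrite gE; field; rewrite r0 b0.
  rewrite normrM normfV mulrAC ler_wpM2r ?invr_ge0// (le_trans (ler_normB _ _))//.
  by rewrite !normrM mulrDl lerD// ler_wpM2l.
have k2S : `|dot (k i2) z| <= `|dot n X0|^-1 * S.
  have -> : dot (k i2) z = (dot n X0)^-1 * dot n z by rewrite (nz z) mulrC mulfK.
  by rewrite normrM normfV ler_wpM2l ?invr_ge0.
have kS : `|dot (k i0) z| + `|dot (k i1) z| + `|dot (k i2) z| <= m * S.
  by rewrite /m 2!mulrDl mul1r !lerD.
have B3le i j : `|B3 i j| <= `|B3|.
  rewrite [leRHS]/Num.Def.normr/= mx_normrE.
  exact: (le_bigmax _ (fun ij : 'I_3 * 'I_3 => `|B3 ij.1 ij.2|) (i, j)).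
apply: (@le_trans _ _ (`|B3| * m * S)); last by rewrite mulrDl lerDl mul1r.
apply: norm_le_coord => [|j]; first by rewrite !mulr_ge0// !addr_ge0.
have -> : z 0 j = (z *m W *m B3) 0 j by rewrite -decz.
rewrite mxE (le_trans (ler_norm_sum _ _ _))//.
rewrite (@le_trans _ _ (\sum_i `|B3| * `|dot (k i) z|))//.
  by apply: ler_sum => i _; rewrite normrM kE mulrC ler_wpM2r.
rewrite -mulr_sumr -mulrA ler_wpM2l// (le_trans _ kS)//.
rewrite !big_ord_recl big_ord0 addr0 addrA.
have -> : ord0 = i0 by exact/val_inj.
have -> : lift i0 ord0 = i1 by exact/val_inj.
by have -> : lift i0 (lift ord0 ord0) = i2 by exact/val_inj.
Qed.
End FocusFunctionals.

(** * Smoothness of the Filippov data and passage from solutions to trajectories *)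

Section FilippovSmoothness.
Context {R : realType}.
Local Notation E := 'rV[R]_3.
Implicit Types (x y z v : E) (A : set E).

Lemma class_C_C1 {W : normedModType R} k A (f : E -> W) : class_C k.+1 A f -> class_C 1 A f.
Proof.
move=> [df cf]; split=> // v; have := cf v; case: k {cf} => [//|k] [dfv _] x Ax.
by apply: differentiable_continuous; exact: dfv.
Qed.

Lemma class_C1_coord A (F : E -> E) i : open A -> class_C 1 A F ->
  class_C 1 A (fun x => F x 0 i).
Proof.
move=> oA [dF cF]; split=> [x Ax|v x Ax].
  apply: (differentiable_comp (f := F) (g := fun y : E => y 0 i)); first exact: dF.
  exact: differentiable_coord.
have DE y : A y -> 'D_v (fun x => F x 0 i) y = ('D_v F y) 0 i.
  by move=> Ay; rewrite derive_mx ?mxE//; apply: diff_derivable; exact: dF.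
have cc : {for x, continuous (fun y => ('D_v F y) 0 i)}.
  apply: (@continuous_comp _ _ _ ('D_v F) (fun y : E => y 0 i) x); first exact: cF.
  exact: coord_continuous.
rewrite /prop_for /continuous_at DE//; apply: cvg_trans cc.
have N : \forall y \near x, ('D_v F y) 0 i = 'D_v (fun x => F x 0 i) y.
  by apply: filterS (open_nbhs_nbhs (conj oA Ax)) => y Ay; rewrite DE.
exact: near_eq_cvg N.
Qed.

Variables (Z : @filippov R) (r : nat).
Hypotheses (r1 : (1 <= r)%N) (sZ : piecewise_C Z r).
Local Notation h := (sw Z).
Local Notation X := (fX Z).
Local Notation Y := (fY Z).

Lemma class_C_on_C1at (F : E -> E) x : class_C_on r (dom Z) F -> dom Z x -> C1at F x.
Proof.
move=> [A [oA DA cF]] Dx i; exists (grad (fun x => F x 0 i) x).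
apply: (C1_sdiff oA); last exact: DA.
apply: class_C1_coord => //; apply: class_C_C1 (_ : class_C r.-1.+1 A F).
by rewrite prednK.
Qed.

Lemma C1at_X x : dom Z x -> C1at X x.
Proof. by apply: class_C_on_C1at; case: sZ. Qed.

Lemma C1at_Y x : dom Z x -> C1at Y x.
Proof. by apply: class_C_on_C1at; case: sZ. Qed.

Lemma sdiff_h x : dom Z x -> sdiff h x (grad h x).
Proof.
move=> Dx; have [_ [A [oA DA ch]] _ _ _] := sZ.
by apply: (C1_sdiff oA); [exact: class_C_C1 ch|exact: DA].
Qed.

Lemma sdiff_sum n (f : 'I_n -> E -> R) (d : 'I_n -> E) x :
  (forall i, sdiff (f i) x (d i)) -> sdiff (fun y => \sum_i f i y) x (\sum_i d i).
Proof.
elim: n f d => [|n IH] f d fd.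
  rewrite big_ord0; under eq_fun do rewrite big_ord0; exact: sdiff_cst.
rewrite big_ord_recl; under eq_fun do rewrite big_ord_recl.
by apply: sdiffD => //; exact: IH.
Qed.

Lemma sdiff_lie (F : E -> E) x : C1at F x -> dom Z x -> sdiff (lie F h) x (grad (lie F h) x).
Proof.
move=> FC Dx; suff [d H] : exists d, sdiff (lie F h) x d by rewrite (sdiff_grad H).
have [_ [A [oA DA [_ ch]]] _ _ _] := sZ.
have /choice[d dP] i : exists d, sdiff (fun y => (grad h y) 0 i * F y 0 i) x d.
  have -> : (fun y => (grad h y) 0 i * F y 0 i) = (fun y => 'D_(delta_mx 0 i) h y * F y 0 i).
    by apply/funext => y; rewrite mxE.
  have [d dP] := FC i.
  by eexists; apply: sdiffM dP; apply: (C1_sdiff oA); [exact: ch|exact: DA].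
by exists (\sum_i d i); exact: sdiff_sum.
Qed.

Definition sm_lieX x (Dx : dom Z x) := sdiff_lie (C1at_X Dx) Dx.
Definition sm_lieY x (Dx : dom Z x) := sdiff_lie (C1at_Y Dx) Dx.

Lemma C1at_slide x : dom Z x -> lie Y h x - lie X h x != 0 -> C1at (slide Z) x.
Proof.
move=> Dx den0 i; have [dX HX] := C1at_X Dx i; have [dY HY] := C1at_Y Dx i.
have HV := sdiffV den0 (sdiffB (sm_lieY Dx) (sm_lieX Dx)).
have HN := sdiffB (sdiffM (sm_lieY Dx) HX) (sdiffM (sm_lieX Dx) HY).
have H := sdiffM HV HN; eexists.
suff -> : (fun y => slide Z y 0 i) = (fun y => (lie Y h y - lie X h y)^-1 *
    (lie Y h y * X y 0 i - lie X h y * Y y 0 i)) by exact: H.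
by apply/funext => y; rewrite /slide !mxE.
Qed.

Lemma slide_eqX x : lie X h x = 0 -> lie Y h x != 0 -> slide Z x = X x.
Proof.
by move=> X0 Y0; rewrite /slide X0 subr0 scale0r subr0 scalerA mulVf// scale1r.
Qed.

Lemma solution_traj (F : E -> E) (D : set E) (a b : R) (c : R -> E) :
  solution F D `[a, b] c ->
  traj F (b - a) (fun t => c (t + a)) /\ forall t, 0 <= t <= b - a -> D (c (t + a)).
Proof.
move=> [/within_itvP cc Dc dc]; split; last first.
  by move=> t /andP[t0 tT]; apply: Dc; rewrite in_itv/=; apply/andP; split; lra.
split.
  apply/within_itvP => t /andP[t0 tT] e e0.
  have [|d d0 dP] := cc (t + a) _ e e0; first by apply/andP; split; lra.
  exists d => // u /andP[u0 uT] ut; apply: dP; first by apply/andP; split; lra.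
  by rewrite opprD addrACA subrr addr0.
move=> t /andP[t0 tT].
have H : is_derive (t + a) 1 c (F (c (t + a))).
  apply: dc; rewrite interior_itv; rewrite /= in_itv/=; apply/andP; split; lra.
have [H1 H2] := H.
have E1 : (fun h : R => h^-1 *: (c ((h *: (1 : R) + t) + a) - c (t + a))) =
          (fun h : R => h^-1 *: (c (h *: (1 : R) + (t + a)) - c (t + a))).
  by apply/funext => k; rewrite addrA.
apply: DeriveDef; first by rewrite /derivable E1.
by rewrite /derive E1.
Qed.

Lemma solution_sub (F : E -> E) (D : set E) (a b : R) (c : R -> E) :
  a <= b -> solution F D `]-oo, b] c -> solution F D `[a, b] c.
Proof.
move=> ab [cc Dc dc]; split.
- by apply: continuous_subspaceW cc => t /=; rewrite !in_itv/= => /andP[].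
- by move=> t; rewrite in_itv/= => /andP[_ tb]; apply: Dc; rewrite in_itv/=.
- by move=> t; rewrite interior_itv /= in_itv/= => /andP[_ tb]; apply: dc; rewrite interior_itv /= in_itv.
Qed.

End FilippovSmoothness.

(** * Linear behaviour of the sliding field on chords of the switching surface *)

Section Focus.
Context {R : realType}.
Local Notation E := 'rV[R]_3.
Implicit Types (x y z v f g : E).

Definition N1 f g z := `|dot f z| + `|dot g z|.

Lemma N1_ge0 f g z : 0 <= N1 f g z.
Proof. by rewrite addr_ge0. Qed.

Lemma N1_le f g z : N1 f g z <= 3 * (`|f| + `|g|) * `|z|.
Proof. by rewrite /N1 mulrDr mulrDl lerD// dot_le. Qed.

(** The linearization is read on differences of two points of the surface, with [f] and [g] as
    coordinates there; [S] then acts as a similarity with dilation part [a] and rotation part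
    [b]. *)
Definition focus_at (h : E -> R) (S : E -> E) (p0 f g : E) (a b C : R) :=
  [/\ 0 < a, b != 0, 0 < C & forall e, 0 < e -> exists2 q, 0 < q &
    forall y z, nb p0 q y -> nb p0 q z -> h y = 0 -> h z = 0 ->
    [/\ `|y - z| <= C * N1 f g (y - z),
        `|dot f (S y - S z) - (a * dot f (y - z) - b * dot g (y - z))| <= e * N1 f g (y - z) &
        `|dot g (S y - S z) - (b * dot f (y - z) + a * dot g (y - z))| <= e * N1 f g (y - z)]].

(** A chord of the surface is tangent only up to an error of order [e1]. Removing a multiple of [X0]
    makes it exactly tangent without changing its [f] and [g]; the cost appears only through the
    image of [X0] under [J]. *)
Lemma focus_at_exists (h : E -> R) (S : E -> E) (p0 X0 : E) :
  sdiff h p0 (grad h p0) -> C1at S p0 -> dot (grad h p0) X0 != 0 ->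
  (exists (B : 'M[R]_(2, 3)) (A : 'M[R]_2),
    [/\ row_free B, (forall i, dot (grad h p0) (row i B) = 0),
        B *m 'J S p0 = A *m B &
        forall l : R[i], eigenvalue (map_mx (real_complex R) A) l ->
          0 < complex.Re l /\ complex.Im l != 0]) ->
  exists a b C f g, [/\ focus_at h S p0 f g a b C, dot f X0 = 0 & dot g X0 = 0].
Proof.
move=> hs SC nX0 [B [A [Bf nB BJ eig]]].
have [J SJ] := C1at_vsdiff SC; rewrite (vsdiff_jacobian SC SJ) in BJ.
set n := grad h p0 in hs nX0 nB.
have [a [b [C [f [g [[a0 b0 C0 fX gX] [fgJ zC]]]]]]] := focus_functionals Bf nB BJ eig nX0.
exists a, b, (2 * C), f, g; split=> //; split=> //; first by rewrite mulr_gt0.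
move=> e e0.
pose F := `|f| + `|g|; have F0 : 0 <= F by rewrite addr_ge0.
pose XJ := `|X0 *m J|; have XJ0 : 0 <= XJ by exact: normr_ge0.
pose nX := `|dot n X0|; have nXp : 0 < nX by rewrite normr_gt0.
pose m1 := 3 * F * XJ / nX; have m10 : 0 <= m1 by rewrite divr_ge0 ?mulr_ge0// ltW.
pose k := 1 + 3 * F + m1.
have k0 : 0 < k by rewrite ltr_pwDl// ?ltr_pwDl// mulr_ge0.
(* The first bound absorbs the normal part of the chord in the norm estimate; the second keeps the
   total error, of weight [k], below [e]. *)
pose e1 := Num.min (1 / (2 * C)) (e / (2 * C * k)).
have e10 : 0 < e1 by rewrite lt_min !divr_gt0// !mulr_gt0.
have : \forall q \near 0^'+, (forall y z, `|y - p0| < q -> `|z - p0| < q ->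
    `|h y - h z - dot n (y - z)| <= e1 * `|y - z|) /\
   forall y z, `|y - p0| < q -> `|z - p0| < q ->
    `|S y - S z - (y - z) *m J| <= e1 * `|y - z|.
  by near=> q; split; near: q; [exact: hs|exact: SJ].
move=> /near0_ex[q q0 [hq Sq]]; exists q => // y z yq zq hy hz.
set w := y - z.
have nw : `|dot n w| <= e1 * `|w| by have := hq y z yq zq; rewrite hy hz subrr sub0r normrN.
have Cw : `|w| <= 2 * C * N1 f g w.
  have := zC w; rewrite -/(N1 f g w).
  have : C * (e1 * `|w|) <= `|w| / 2.
    have : e1 <= 1 / (2 * C) by rewrite /e1 ge_min lexx.
    rewrite ler_pdivlMr ?mulr_gt0// => H1.
    have : (e1 * (2 * C)) * `|w| <= `|w| by rewrite ler_piMl.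
    lra.
  have : C * `|dot n w| <= C * (e1 * `|w|) by rewrite ler_wpM2l// ltW.
  rewrite mulrDr; lra.
pose s := dot n w / dot n X0; pose t := w - s *: X0.
have nt : dot n t = 0 by rewrite /t dotBr dotZr /s divfK// subrr.
have [ft gt] := fgJ t nt.
have sle : `|s| <= e1 * `|w| / nX by rewrite /s normrM normfV ler_wpM2r// invr_ge0 ltW.
have fE : dot f t = dot f w by rewrite /t dotBr dotZr fX mulr0 subr0.
have gE : dot g t = dot g w by rewrite /t dotBr dotZr gX mulr0 subr0.
rewrite fE gE in ft gt.
have wE : w *m J = t *m J + s *: (X0 *m J).
  by rewrite scalemxAl -mulmxDl /t subrK.
have fin (u : E) c : `|u| <= F -> dot u (t *m J) = c ->
    `|dot u (S y - S z) - c| <= e * N1 f g w.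
  move=> uF uc.
  have -> : dot u (S y - S z) - c = dot u (S y - S z - w *m J) + s * dot u (X0 *m J).
    have wJ : dot u (w *m J) = c + s * dot u (X0 *m J) by rewrite wE dotDr dotZr uc.
    by rewrite (dotBr u (S y - S z)) wJ; ring.
  apply: (@le_trans _ _ (k * e1 * `|w|)).
    have E0 : 0 <= e1 * `|w| by rewrite mulr_ge0// ltW.
    have H1 : `|dot u (S y - S z - w *m J)| <= 3 * F * (e1 * `|w|).
      rewrite (le_trans (dot_le _ _))//; apply: ler_pM => //; last exact: Sq.
      by rewrite ler_wpM2l.
    have H2 : `|s * dot u (X0 *m J)| <= m1 * (e1 * `|w|).
      rewrite normrM; apply: (@le_trans _ _ (e1 * `|w| / nX * (3 * F * XJ))).
        apply: ler_pM => //; rewrite (le_trans (dot_le _ _))// ler_wpM2r//.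
        by rewrite ler_wpM2l.
      have -> : m1 * (e1 * `|w|) = e1 * `|w| / nX * (3 * F * XJ) by rewrite /m1; ring.
      by [].
    have -> : k * e1 * `|w| = e1 * `|w| + 3 * F * (e1 * `|w|) + m1 * (e1 * `|w|).
      by rewrite /k; ring.
    have := ler_normD (dot u (S y - S z - w *m J)) (s * dot u (X0 *m J)).
    lra.
  have : e1 <= e / (2 * C * k) by rewrite /e1 ge_min lexx orbT.
  rewrite ler_pdivlMr ?mulr_gt0// => H.
  apply: (@le_trans _ _ (k * e1 * (2 * C * N1 f g w))).
    by rewrite ler_wpM2l// mulr_ge0// ltW.
  have -> : k * e1 * (2 * C * N1 f g w) = (e1 * (2 * C * k)) * N1 f g w by ring.
  by rewrite ler_wpM2r// N1_ge0.
split=> //; [apply: fin ft|apply: fin gt]; by rewrite /F ?lerDl ?lerDr.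
Unshelve. all: by end_near. Qed.

Section Contraction.
Variables (h : E -> R) (S : E -> E) (p0 f g : E) (a b C : R).
Hypothesis foc : focus_at h S p0 f g a b C.

(** The rotation terms cancel in the derivative of [Q], the sum of the squares of [f] and [g], so
    along [- S] it decays at rate [2 a], of which the tolerance [a / 4] spoils at most half. The
    factor 2 pays for comparing a sum of absolute values with a Euclidean length. *)
Lemma focus_contraction : exists2 q, 0 < q & forall (T : R) (c c' : R -> E), 0 <= T ->
  traj (fun x => - S x) T c -> traj (fun x => - S x) T c' ->
  (forall t, 0 <= t <= T -> [/\ nb p0 q (c t), nb p0 q (c' t), h (c t) = 0 & h (c' t) = 0]) ->
  N1 f g (c T - c' T) <= 2 * expR (- (a / 2) * T) * N1 f g (c 0 - c' 0).
Proof.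
have [a0 b0 C0 H] := foc.
have [q q0 Hq] := H (a / 4) (divr_gt0 a0 (ltr0n _ 4)).
exists q => // T c c' T0 [cc dc] [cc' dc'] inq.
pose z t := c t - c' t; pose w t := S (c t) - S (c' t).
have cz : {within `[0, T], continuous z} by exact: within_subr.
have dz t : 0 < t < T -> is_derive t 1 z (- w t).
  have -> : - w t = - S (c t) - - S (c' t) by rewrite /w opprB opprK addrC.
  by move=> tT; apply: is_derive_sub; [exact: dc|exact: dc'].
pose Q t := dot f (z t) ^+ 2 + dot g (z t) ^+ 2.
pose dQ t := 2 * dot f (z t) * - dot f (w t) + 2 * dot g (z t) * - dot g (w t).
have cQ : {within `[0, T], continuous Q}.
  apply: (@within_comp _ _ _ z (fun v : E => dot f v ^+ 2 + dot g v ^+ 2)) cz => t _.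
  have sqc (u v : E) : {for v, continuous (fun v : E => dot u v ^+ 2)}.
    exact: (continuous_comp (@dot_continuous _ u v) (@exprn_continuous _ 2 _)).
  by apply: continuousD; exact: sqc.
have dQP t : 0 < t < T -> is_derive t 1 Q (dQ t).
  move=> /dz dzt.
  have df := is_derive_dotr f dzt; have dg := is_derive_dotr g dzt.
  have d1 := is_deriveM df df; have d2 := is_deriveM dg dg.
  have := is_deriveD d1 d2.
  have -> : (fun t => dot f (z t)) * (fun t => dot f (z t)) + (fun t => dot g (z t)) * (fun t => dot g (z t)) = Q.
    by apply/funext => s; rewrite /Q !fctE !expr2.
  move=> D; apply: is_derive_eq D _.
  by rewrite /dQ !dotNr /GRing.scale/=; ring.
have QK : Q T <= expR (- a * (T - 0)) * Q 0.
  apply: gronwall1 cQ dQP _ => // t /andP[t0 tT].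
  have [|n1 n2 h1 h2] := inq t; first by rewrite !ltW.
  have [_ ] := Hq _ _ n1 n2 h1 h2.
  rewrite -/(z t) -/(w t) /dQ /Q /N1.
  set x := dot f (z t); set y := dot g (z t); set x' := dot f (w t); set y' := dot g (w t).
  move=> H1 H2.
  have K1 : `|x * (x' - (a * x - b * y))| <= a / 4 * (`|x| * (`|x| + `|y|)).
    by rewrite normrM mulrCA ler_wpM2l.
  have K2 : `|y * (y' - (b * x + a * y))| <= a / 4 * (`|y| * (`|x| + `|y|)).
    by rewrite normrM mulrCA ler_wpM2l.
  have K3 : `|x| * (`|x| + `|y|) + `|y| * (`|x| + `|y|) <= 2 * (x ^+ 2 + y ^+ 2).
    have := sqr_ge0 (`|x| - `|y|); have := real_normK (num_real x); have := real_normK (num_real y).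
    lra.
  have {}K3 : a / 4 * (`|x| * (`|x| + `|y|) + `|y| * (`|x| + `|y|)) <= a / 4 * (2 * (x ^+ 2 + y ^+ 2)).
    by rewrite ler_wpM2l// divr_ge0// ltW.
  move: K1 K2; rewrite !ler_norml => /andP[K1 _] /andP[K2 _].
  lra.
have Nge := N1_ge0 f g.
rewrite -ler_sqr ?nnegrE ?mulr_ge0 ?expR_ge0//.
rewrite !exprMn -expRM_natl.
have -> : 2 * (- (a / 2) * T) = - a * (T - 0) by field.
set ee := expR _ in QK *; have ee0 : 0 <= ee by exact: expR_ge0.
have Q0 : Q 0 <= N1 f g (c 0 - c' 0) ^+ 2.
  rewrite /Q /N1 -/(z 0).
  have := real_normK (num_real (dot f (z 0))); have := real_normK (num_real (dot g (z 0))).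
  have : 0 <= `|dot f (z 0)| * `|dot g (z 0)| by rewrite mulr_ge0.
  lra.
have QT : N1 f g (c T - c' T) ^+ 2 <= 2 * Q T.
  rewrite /Q /N1 -/(z T).
  have := real_normK (num_real (dot f (z T))); have := real_normK (num_real (dot g (z T))).
  have := sqr_ge0 (`|dot f (z T)| - `|dot g (z T)|).
  lra.
have : ee * Q 0 <= ee * N1 f g (c 0 - c' 0) ^+ 2 by rewrite ler_wpM2l.
have : 0 <= ee * N1 f g (c 0 - c' 0) ^+ 2 by rewrite mulr_ge0// sqr_ge0.
lra.
Qed.

End Contraction.
End Focus.

(** * Running the sliding flow backward from near [q0] to near [p0] *)

Section Backward.
Context {R : realType}.
Local Notation E := 'rV[R]_3.
Variables (h : E -> R) (S : E -> E) (p0 q0 f g : E) (a b C : R) (beta : R -> E).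
Hypothesis foc : focus_at h S p0 f g a b C.
Hypotheses (Sp0 : S p0 = 0) (hp0 : h p0 = 0) (SCp0 : C1at S p0) (qp : q0 != p0).
Hypothesis beta0 : beta 0 = q0.
Hypothesis beta_traj : forall T, 0 <= T -> traj (fun x => - S x) T beta.
Hypothesis beta_C1 : forall t, 0 <= t -> C1at S (beta t).
Hypothesis beta_lim : forall e, 0 < e -> exists2 T, 0 <= T & `|beta T - p0| < e.

Definition back (tau : R) (c : R -> E) := [/\ 0 <= tau, traj (fun x => - S x) tau c &
  forall t, 0 <= t <= tau -> h (c t) = 0].

Lemma beta_tube T : 0 <= T -> exists L q, [/\ 0 < L, 0 < q &
  forall t, 0 <= t <= T -> lip_on L (fun x => - S x) (nb (beta t) q)].
Proof.
move=> T0; have [|L [q [L0 q0' H]]] := compact_lip (traj_compact (beta_traj T0)) (F := S).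
  by move=> _ [t + <-]; rewrite /= in_itv/= => /andP[t0 _]; exact: beta_C1.
exists L, q; split=> // t tT y z yq zq; rewrite /= opprK addrC distrC.
by apply: (H (beta t)) => //; exists t => //=; rewrite in_itv.
Qed.

Lemma cst_traj (F : E -> E) T p : F p = 0 -> traj F T (fun=> p).
Proof.
move=> Fp; split=> [|t _]; last by rewrite Fp; exact: is_derive_cst.
by apply: continuous_subspaceT => t; exact: cst_continuous.
Qed.

(** Uniqueness of solutions: an orbit that reached the equilibrium [p0] would, in reversed time,
    stay there, and so [q0] would equal [p0]. *)
Lemma beta_ne t : 0 <= t -> beta t != p0.
Proof.
move=> t0; apply/eqP => bt.
have cT := traj_rev (beta_traj t0).
have pT : traj (fun x => - - S x) t (fun=> p0) by apply: cst_traj; rewrite Sp0 !oppr0.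
have [L [q [q1 Hq]]] := C1at_lip SCp0.
pose L' := Num.max L 0.
have L'0 : 0 <= L' by rewrite le_max lexx orbT.
have := @shadow _ (fun x => - - S x) L' q t (fun s => beta (t - s)) (fun=> p0) t0 L'0 cT pT.
rewrite /= subr0 bt subrr normr0 mulr0 => H.
have {}H := H _ q1 t; rewrite t0 lexx subrr beta0 in H.
have : `|q0 - p0| <= 0.
  apply: H => // s _ y z yq zq; rewrite !opprK (le_trans (Hq _ _ yq zq))//.
  by rewrite ler_wpM2r// le_max lexx.
by rewrite normr_le0 subr_eq0 (negPf qp).
Qed.

Let K := 3 * (`|f| + `|g|).
Let K0 : 0 <= K. Proof. by rewrite mulr_ge0// addr_ge0. Qed.

(** The orbit is compared with the equilibrium itself. The contraction towards [p0] holds as long as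
    the orbit is in a small ball, and it prevents the orbit from leaving. *)
Lemma back_stay rho : 0 < rho -> exists2 d, 0 < d & forall tau c T0, back tau c ->
  0 <= T0 -> T0 <= tau -> `|c T0 - p0| < d ->
  forall t, T0 <= t <= tau -> nb p0 rho (c t).
Proof.
move=> rho0; have [a0 b0 C0 Hf] := foc.
have [q1 q10 Hq1] := focus_contraction foc.
have [q2 q20 Hq2] := Hf 1 ltr01.
pose r1 := Num.min rho (Num.min q1 q2).
have r10 : 0 < r1 by rewrite !lt_min rho0 q10.
have [r1rho r1q1 r1q2] : [/\ r1 <= rho, r1 <= q1 & r1 <= q2].
  by have /andP[-> /andP[-> ->]] : (r1 <= rho) && ((r1 <= q1) && (r1 <= q2)) by rewrite -!le_min.
have CK : 0 <= C * K by rewrite mulr_ge0// ltW.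
have k0 : 0 < 8 * (C * K + 1) by rewrite mulr_gt0// ltr_wpDl.
pose d := r1 / (8 * (C * K + 1)).
have d0 : 0 < d by rewrite divr_gt0.
have dE : d * (8 * (C * K + 1)) = r1 by rewrite /d divfK// gt_eqF.
have Cd : 0 <= C * K * d by rewrite mulr_ge0// ltW.
exists d => // tau c T0 [tau0 cT hc] T00 T0tau cd.
have sT : traj (fun x => - S x) (tau - T0) (fun t => c (t + T0)) by exact: traj_shift.
suff H : forall t, 0 <= t <= tau - T0 -> `|c (t + T0) - p0| < r1 / 2.
  move=> t /andP[Tt ttau]; have := H (t - T0); rewrite subrK => H'.
  rewrite /nb/= (lt_le_trans (H' _)) ?(le_trans _ r1rho)//; last by lra.
  by apply/andP; split; lra.
have tauT0 : 0 <= tau - T0 by rewrite subr_ge0.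
apply: bootstrap => //; first exact: traj_dist_within sT.
  rewrite add0r; lra.
move=> t /andP[t0 tT] H.
have := Hq1 t (fun t => c (t + T0)) (fun=> p0) t0 (traj_sub tT sT).
have pT : traj (fun x => - S x) t (fun=> p0) by apply: cst_traj; rewrite Sp0 oppr0.
move=> /(_ pT) H'.
have hcT s : 0 <= s <= t -> h (c (s + T0)) = 0.
  by move=> /andP[s0 st]; apply: hc; rewrite addr_ge0//= -lerBrDr (le_trans st).
have {}H' : N1 f g (c (t + T0) - p0) <= 2 * expR (- (a / 2) * t) * N1 f g (c (0 + T0) - p0).
  apply: H' => s st; split=> //; last exact: hcT.
    by rewrite /nb/= (le_lt_trans (H s st))//; lra.
  by rewrite /nb/= subrr normr0.
have e1 : expR (- (a / 2) * t) <= 1.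
  by rewrite -expR0 ler_expR mulNr oppr_le0 mulr_ge0// divr_ge0// ltW.
have N1n := N1_ge0 f g (c (0 + T0) - p0).
have N1K : N1 f g (c (0 + T0) - p0) <= K * d.
  rewrite add0r (le_trans (N1_le _ _ _))// ler_wpM2l// ltW//.
have [|||| Cle _ _] := Hq2 (c (t + T0)) p0.
- by rewrite /nb/= (le_lt_trans (H t _)) ?t0 ?lexx//; lra.
- by rewrite /nb/= subrr normr0.
- by apply: hcT; rewrite t0 lexx.
- exact: hp0.
have : C * N1 f g (c (t + T0) - p0) <= C * (2 * (K * d)).
  rewrite ler_wpM2l ?(ltW C0)// (le_trans H')// -mulrA ler_wpM2l//.
  by rewrite (le_trans _ N1K)// ler_piMl.
have -> : C * (2 * (K * d)) = 2 * (C * K * d) by ring.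
lra.
Qed.

(** Up to time [T0] two backward orbits follow [beta] and separate by a bounded factor; afterwards
    they stay near [p0] and contract. As [beta] keeps a positive distance from [p0] on bounded time
    intervals, ending very close to [p0] forces a long duration, hence as much contraction as
    desired. *)
Lemma back_main rho e : 0 < rho -> 0 < e -> exists2 r, 0 < r &
  forall t1 c1 t2 c2, back t1 c1 -> back t2 c2 ->
    `|c1 0 - q0| < r -> `|c2 0 - q0| < r -> `|c1 t1 - p0| < r -> `|c2 t2 - p0| < r ->
    t1 <= t2 -> N1 f g (c1 t1 - c2 t1) <= e * `|c1 0 - c2 0| /\
    forall t, t1 <= t <= t2 -> nb p0 rho (c2 t).
Proof.
move=> rho0 e0; have [a0 b0 C0 Hf] := foc.
have [q1 q10 Hq1] := focus_contraction foc.
pose r1 := Num.min rho q1.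
have r10 : 0 < r1 by rewrite lt_min rho0.
have [d d0 Hd] := back_stay r10.
have [T0 T00 bT0] := beta_lim (divr_gt0 d0 (ltr0n _ 2)).
have [L0 [w0 [L00 w00 tube0]]] := beta_tube T00.
pose G0 := gron L0 T0.
have G02 : 2 <= G0 by apply: gron_ge2 => //; exact: ltW.
have G00 : 0 < G0 by exact: lt_le_trans G02.
pose k := 2 * K * G0 + 1.
have KG : 0 <= 2 * K * G0 by apply: mulr_ge0; [exact: mulr_ge0|exact: ltW].
have k0 : 0 < k by rewrite ltr_wpDl.
(* This time suffices for the contraction to beat the separation [G0] accumulated before [T0]; it is
   read off from [1 + y <= expR y]. *)
pose x := 2 * k / (a * e).
have x0 : 0 < x by rewrite divr_gt0// mulr_gt0.
have decay y : x <= y -> 2 * expR (- (a / 2) * y) * (K * G0) <= e.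
  move=> xy.
  have H1 : k / e <= expR (a / 2 * y).
    apply: le_trans (expR_ge1Dx _); rewrite ler_wpDl//.
    apply: (@le_trans _ _ (a / 2 * x)); last by rewrite ler_wpM2l// divr_ge0// ltW.
    have -> : a / 2 * x = k / e by rewrite /x; field; rewrite !gt_eqF.
    by [].
  have ke0 : 0 < k / e by rewrite divr_gt0.
  have H2 : expR (- (a / 2) * y) <= e / k.
    rewrite mulNr expRN -[leRHS]invf_div lef_pV2 ?posrE ?expR_gt0//.
  have : 2 * K * G0 * expR (- (a / 2) * y) <= 2 * K * G0 * (e / k) by rewrite ler_wpM2l.
  have : 2 * K * G0 * (e / k) <= k * (e / k).
    by rewrite ler_wpM2r ?divr_ge0 ?(ltW e0) ?(ltW k0)// /k lerDl.
  have -> : k * (e / k) = e by field; rewrite gt_eqF.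
  lra.
pose T1 := T0 + x.
have T10 : 0 <= T1 by rewrite addr_ge0// ltW.
have [L1 [w1 [L10 w10 tube1]]] := beta_tube T10.
pose G1 := gron L1 T1.
have G12 : 2 <= G1 by apply: gron_ge2 => //; exact: ltW.
have G10 : 0 < G1 by exact: lt_le_trans G12.
have [tm + Hm] := EVT_min T10 (traj_dist_within (p := p0) (beta_traj T10)).
rewrite in_itv/= => /andP[tm0 _]; set m := `|_| in Hm.
have m0 : 0 < m by rewrite normr_gt0 subr_eq0 beta_ne.
(* The two bounds by [m / 2] ensure that an orbit following [beta] cannot end within [r] of [p0] at
   or before time [T1]; the others keep it in the tubes and bring it within [d] of [p0] at time
   [T0]. *)
pose r := Num.min (Num.min (w0 / G0) (d / 2 / G0)) (Num.min (w1 / G1) (Num.min (m / 2 / G1) (m / 2))).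
have r0 : 0 < r by rewrite !lt_min !divr_gt0.
have [rw0 rd rw1 rm1 rm] : [/\ r * G0 <= w0, r * G0 <= d / 2, r * G1 <= w1, r * G1 <= m / 2 & r <= m / 2].
  have /andP[/andP[H1 H2] /andP[H3 /andP[H4 H5]]] :
    ((r <= w0 / G0) && (r <= d / 2 / G0)) && ((r <= w1 / G1) && ((r <= m / 2 / G1) && (r <= m / 2))).
    by rewrite -!le_min.
  by split=> //; rewrite -ler_pdivlMr.
exists r => //.
have single t c : back t c -> `|c 0 - q0| < r -> `|c t - p0| < r ->
    [/\ T1 < t, forall s, 0 <= s <= T0 -> nb (beta s) w0 (c s) & `|c T0 - p0| < d].
  move=> [t0 cT hc] cr ctr.
  have near1 s : 0 <= s <= Num.min t T1 -> `|c s - beta s| < m / 2.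
    move=> smin; have M0 : 0 <= Num.min t T1 by rewrite le_min t0.
    have MT1 : Num.min t T1 <= T1 by rewrite ge_min lexx orbT.
    have MG : gron L1 (Num.min t T1) <= G1 by apply: gron_le => //; exact: ltW.
    have cl : gron L1 (Num.min t T1) * `|c 0 - beta 0| < r * G1.
      rewrite beta0 (le_lt_trans (ler_wpM2r (normr_ge0 _) MG))// mulrC ltr_pM2r//.
    have := @shadow _ (fun x => - S x) L1 w1 (Num.min t T1) c beta M0 (ltW L10).
    move=> /(_ _ (beta_traj M0) _ (lt_le_trans cl rw1)) H.
    rewrite (le_lt_trans (H _ _ _ smin))//.
    - by apply: traj_sub cT; rewrite ge_min lexx.
    - by move=> s' /andP[s'0 s'm]; apply: tube1; rewrite s'0 (le_trans s'm).
    - exact: lt_le_trans cl rm1.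
  have T1t : T1 < t.
    rewrite ltNge; apply/negP => tT1.
    have := near1 t; rewrite (min_l tT1) t0 lexx => /(_ isT) H.
    have : m <= `|beta t - p0| by apply: Hm; rewrite in_itv/= t0.
    have := ler_normB (c t - p0) (c t - beta t).
    rewrite opprB addrC addrA subrK => H1 H2.
    lra.
  have T0t : T0 <= t by rewrite (le_trans _ (ltW T1t))// lerDl ltW.
  have near0 s : 0 <= s <= T0 -> `|c s - beta s| < r * G0.
    move=> sT0.
    have cl : gron L0 T0 * `|c 0 - beta 0| < r * G0.
      by rewrite beta0 mulrC ltr_pM2r.
    have := @shadow _ (fun x => - S x) L0 w0 T0 c beta T00 (ltW L00) (traj_sub T0t cT) (beta_traj T00) tube0 (lt_le_trans cl rw0).
    by move=> /(_ s sT0) H; exact: le_lt_trans cl.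
  split=> // [s sT0|]; first exact: lt_le_trans (near0 s sT0) rw0.
  have := near0 T0; rewrite T00 lexx => /(_ isT).
  have := ler_normD (c T0 - beta T0) (beta T0 - p0); rewrite subrKA.
  lra.
move=> t1 c1 t2 c2 B1 B2 c1r c2r c1t c2t t12.
have [T1t1 n1 d1] := single _ _ B1 c1r c1t.
have [T1t2 n2 d2] := single _ _ B2 c2r c2t.
have T0T1 : T0 <= T1 by rewrite lerDl ltW.
have T0t1 : T0 <= t1 by exact: le_trans (ltW T1t1).
have T0t2 : T0 <= t2 by exact: le_trans (ltW T1t2).
have S1 := Hd _ _ _ B1 T00 T0t1 d1.
have S2 := Hd _ _ _ B2 T00 T0t2 d2.
split; last first.
  move=> t /andP[t1t tt2]; rewrite /nb/= (lt_le_trans (S2 t _))//.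
    by rewrite (le_trans T0t1).
  by rewrite ge_min lexx.
have [t10 c1T h1] := B1; have [t20 c2T h2] := B2.
have D0 : `|c1 T0 - c2 T0| <= G0 * `|c1 0 - c2 0|.
  apply: (@traj_pair_le _ (fun x => - S x) L0 T0 T0 c1 c2) => //; rewrite ?T00 ?lexx//.
  - exact: ltW.
  - exact: traj_sub c1T.
  - exact: traj_sub c2T.
  - by move=> s /andP[s0 sT]; apply: (tube0 s); rewrite ?ltW//; [apply: n1|apply: n2]; rewrite !ltW.
have t1T0 : 0 <= t1 - T0 by rewrite subr_ge0.
have := Hq1 (t1 - T0) (fun t => c1 (t + T0)) (fun t => c2 (t + T0)) t1T0.
rewrite !add0r !subrK => H.
have {}H : N1 f g (c1 t1 - c2 t1) <= 2 * expR (- (a / 2) * (t1 - T0)) * N1 f g (c1 T0 - c2 T0).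
  apply: H.
  - exact: traj_shift.
  - by apply: traj_shift => //; exact: traj_sub c2T.
  - move=> s /andP[s0 st].
    have st1 : s + T0 <= t1 by rewrite -lerBrDr.
    have st2 : s + T0 <= t2 by exact: le_trans t12.
    have s1 : T0 <= s + T0 <= t1 by rewrite lerDr s0.
    have s2 : T0 <= s + T0 <= t2 by rewrite lerDr s0.
    split.
    + by rewrite /nb/= (lt_le_trans (S1 _ s1))// ge_min lexx orbT.
    + by rewrite /nb/= (lt_le_trans (S2 _ s2))// ge_min lexx orbT.
    + by apply: h1; rewrite addr_ge0.
    + by apply: h2; rewrite addr_ge0.
have xt1 : x <= t1 - T0 by rewrite lerBrDl ltW.
have e2 : 0 <= 2 * expR (- (a / 2) * (t1 - T0)) by rewrite mulr_ge0// expR_ge0.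
rewrite (le_trans H)//.
apply: (@le_trans _ _ (2 * expR (- (a / 2) * (t1 - T0)) * (K * (G0 * `|c1 0 - c2 0|)))).
  by rewrite ler_wpM2l// (le_trans (N1_le _ _ _))// ler_wpM2l.
by rewrite (mulrA K) mulrA ler_wpM2r// decay.
Qed.

End Backward.

(** * Displacement along the sliding flow during a short delay *)

Section Drift.
Context {R : realType}.
Local Notation E := 'rV[R]_3.
Variables (h : E -> R) (S : E -> E) (p0 f g : E) (a b C : R).
Hypothesis foc : focus_at h S p0 f g a b C.
Hypotheses (Sp0 : S p0 = 0) (hp0 : h p0 = 0) (SCp0 : C1at S p0).

(** Since [S p0 = 0], both the speed and its variation are proportional to the distance from [p0].
    The error is therefore relative to [N1 f g (c 0 - p0)], however close to [p0] the orbit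
    starts. *)
Lemma focus_drift e : 0 < e -> exists rho d, [/\ 0 < rho, 0 < d & forall T c,
  0 <= T <= d -> traj S T c ->
  (forall t, 0 <= t <= T -> nb p0 rho (c t)) -> h (c 0) = 0 ->
  `|dot f (c T - c 0) - T * (a * dot f (c 0 - p0) - b * dot g (c 0 - p0))| <=
      e * T * N1 f g (c 0 - p0) /\
  `|dot g (c T - c 0) - T * (b * dot f (c 0 - p0) + a * dot g (c 0 - p0))| <=
      e * T * N1 f g (c 0 - p0)].
Proof.
move=> e0; have [a0 b0 C0 Hf] := foc.
have e20 : 0 < e / 2 by rewrite divr_gt0.
have [q1 q10 Hq1] := Hf _ e20.
have [L1 [q2 [q20 Hq2]]] := C1at_lip SCp0.
pose L := Num.max L1 1; have L0 : 0 < L by rewrite lt_max ltr01 orbT.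
pose G := gron L 1; have G2 : 2 <= G by apply: gron_ge2 => //; exact: ltW.
have G0 : 0 < G by exact: lt_le_trans G2.
pose K := 3 * (`|f| + `|g|) * (L * (L * (G * C))) + 1.
have fg0 : 0 <= 3 * (`|f| + `|g|) by rewrite mulr_ge0// addr_ge0.
have LL0 : 0 <= L * (L * (G * C)) by apply/ltW; do 3?[apply: mulr_gt0 => //].
have K0 : 0 < K by rewrite ltr_wpDl// mulr_ge0.
pose d := Num.min 1 (e / 2 / K).
have d0 : 0 < d by rewrite lt_min ltr01 divr_gt0.
have d1 : d <= 1 by rewrite /d ge_min lexx.
have dK : K * d <= e / 2.
  by rewrite mulrC -ler_pdivlMr// /d ge_min lexx orbT.
pose rho := Num.min q1 q2.
have rho0 : 0 < rho by rewrite lt_min q10.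
have rq1 y : nb p0 rho y -> nb p0 q1 y.
  by move=> H; rewrite /nb/= (lt_le_trans H)// ge_min lexx.
have rq2 y : nb p0 rho y -> `|y - p0| < q2.
  by move=> H; rewrite (lt_le_trans H)// ge_min lexx orbT.
have Sl y z : nb p0 rho y -> nb p0 rho z -> `|S y - S z| <= L * `|y - z|.
  move=> /rq2 yq /rq2 zq; rewrite (le_trans (Hq2 _ _ yq zq))// ler_wpM2r//.
  by rewrite /L le_max lexx.
have p0n r : 0 < r -> nb p0 r p0 by exact: nb_center.
exists rho, d; split=> // T c /andP[T0 Td] cT cn h0.
have c0n : nb p0 rho (c 0) by apply: cn; rewrite lexx T0.
have [Cl Hff Hgg] := Hq1 _ _ (rq1 _ c0n) (p0n _ q10) h0 hp0.
set P := c 0 - p0 in Cl Hff Hgg *.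
have pT : traj S T (fun=> p0) by exact: cst_traj.
have T1 : 0 <= T <= 1 by rewrite T0 (le_trans Td).
have near t : 0 <= t <= T -> `|c t - p0| <= G * `|P|.
  apply: (@traj_pair_le _ S L T 1 c (fun=> p0) T1 (ltW L0) cT pT) => s /andP[s0 sT].
  by apply: Sl; [apply: cn; rewrite !ltW|exact: p0n].
have LG0 : 0 <= L * (G * `|P|) by rewrite !mulr_ge0// ltW.
have spd t : 0 <= t <= T -> `|c t - c 0| <= L * (G * `|P|) * d.
  move=> /andP[t0 tT]; apply: (@le_trans _ _ (L * (G * `|P|) * t)).
    rewrite -[X in _ * X]subr0; apply: (traj_speed LG0 cT) => // s /andP[s0 st].
    have sT : 0 <= s <= T by rewrite s0 (le_trans st).
    have := Sl _ _ (cn s sT) (p0n _ rho0); rewrite Sp0 subr0 => /le_trans; apply.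
    by rewrite ler_wpM2l ?(ltW L0)// near.
  by rewrite ler_wpM2l// (le_trans tT).
have m0 : 0 <= L * (L * (G * `|P|) * d) by rewrite mulr_ge0 ?(ltW L0)// mulr_ge0// ltW.
have mv : `|c T - c 0 - T *: S (c 0)| <= L * (L * (G * `|P|) * d) * T.
  have := @mean_value _ c (fun t => S (c t)) (S (c 0)) _ 0 T T0 m0 cT.1 cT.2.
  rewrite subr0; apply => t /andP[t0 tT]; have tt : 0 <= t <= T by rewrite !ltW.
  by rewrite (le_trans (Sl _ _ (cn t tt) c0n))// ler_wpM2l ?(ltW L0)// spd.
rewrite -/P in near spd mv.
have fin (u : E) v : `|u| <= `|f| + `|g| -> `|dot u (S (c 0) - S p0) - v| <= e / 2 * N1 f g P ->
    `|dot u (c T - c 0) - T * v| <= e * T * N1 f g P.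
  move=> uF uv; rewrite Sp0 subr0 in uv.
  have -> : dot u (c T - c 0) - T * v = dot u (c T - c 0 - T *: S (c 0)) + T * (dot u (S (c 0)) - v).
    by rewrite (dotBr u (c T - c 0)) dotZr; ring.
  have H1 : `|T * (dot u (S (c 0)) - v)| <= T * (e / 2 * N1 f g P).
    by rewrite normrM (ger0_norm T0) ler_wpM2l.
  have H2 : `|dot u (c T - c 0 - T *: S (c 0))| <= T * (e / 2 * N1 f g P).
    rewrite (le_trans (dot_le _ _))//.
    apply: (@le_trans _ _ (3 * (`|f| + `|g|) * (L * (L * (G * (C * N1 f g P)) * d) * T))).
      apply: ler_pM => //; first by rewrite ler_wpM2l.
      rewrite (le_trans mv)// ler_wpM2r// ler_wpM2l ?(ltW L0)// ler_wpM2r ?(ltW d0)//.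
      by rewrite ler_wpM2l ?(ltW L0)// ler_wpM2l ?(ltW G0).
    have -> : 3 * (`|f| + `|g|) * (L * (L * (G * (C * N1 f g P)) * d) * T) =
      T * (3 * (`|f| + `|g|) * (L * (L * (G * C))) * d * N1 f g P) by ring.
    rewrite ler_wpM2l// ler_wpM2r ?N1_ge0// (le_trans _ dK)// ler_wpM2r ?(ltW d0)//.
    by rewrite lerDl.
  rewrite (le_trans (ler_normD _ _))// (le_trans (lerD H2 H1))//.
  by have -> : T * (e / 2 * N1 f g P) + T * (e / 2 * N1 f g P) = e * T * N1 f g P by field.
by split; apply: fin => //; rewrite ?lerDl ?lerDr.
Qed.

(* The rotation by [b] keeps the two displacements from cancelling. *)
Lemma focus_noncancel (F G p t e1 e2 A B : R) : 0 < a -> b != 0 ->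
  A = p * F - t * (a * F - b * G) + e1 -> B = p * G - t * (b * F + a * G) + e2 ->
  (`|F| + `|G|) * (`|p| + `|t|) <= 2 * (1 + (a + 1) / `|b|) * (`|A| + `|B| + (`|e1| + `|e2|)).
Proof.
move=> a0 b0 EA EB; set N := `|F| + `|G|; set W := (X in _ <= _ * X).
have N0 : 0 <= N by rewrite addr_ge0.
have [->|Nn] := eqVneq N 0.
  by rewrite mul0r mulr_ge0 ?mulr_ge0 ?addr_ge0 ?divr_ge0 ?addr_ge0// ltW.
have Np : 0 < N by rewrite lt_neqAle eq_sym Nn.
have bp : 0 < `|b| by rewrite normr_gt0.
have Q2 : N * N <= 2 * (F * F + G * G).
  have := sqr_ge0 (`|F| - `|G|); have := real_normK (num_real F); have := real_normK (num_real G).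
  by rewrite /N !expr2; lra.
have Q0 : 0 <= F * F + G * G by rewrite addr_ge0// -expr2 sqr_ge0.
have gen v x y : v * (F * F + G * G) = (A - e1) * x + (B - e2) * y -> `|x| <= N -> `|y| <= N ->
    `|v| * N <= 2 * W.
  move=> E xN yN; rewrite -(ler_pM2r Np) -mulrA.
  apply: (@le_trans _ _ (2 * (`|v| * (F * F + G * G)))).
    by rewrite (mulrCA 2); apply: ler_wpM2l.
  rewrite -[X in _ * (_ * X)](ger0_norm Q0) -normrM E -mulrA ler_wpM2l//.
  rewrite (le_trans (ler_normD _ _))// !normrM.
  have H1 : `|A - e1| * `|x| <= (`|A| + `|e1|) * N by apply: ler_pM => //; exact: ler_normB.
  have H2 : `|B - e2| * `|y| <= (`|B| + `|e2|) * N by apply: ler_pM => //; exact: ler_normB.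
  rewrite (le_trans (lerD H1 H2))//.
  by have -> : (`|A| + `|e1|) * N + (`|B| + `|e2|) * N = W * N by rewrite /W; ring.
have FN : `|F| <= N by rewrite lerDl.
have GN : `|G| <= N by rewrite lerDr.
(* Combining the two equations with weights [F], [G] isolates [p - t * a]; weights [G], [- F]
   isolate [t * b]. *)
have H1 : `|p - t * a| * N <= 2 * W by apply: (gen _ F G) => //; rewrite EA EB; ring.
have H2 : `|t * b| * N <= 2 * W by apply: (gen _ G (- F)); rewrite ?normrN// EA EB; ring.
have tE : `|t| = `|t * b| / `|b| by rewrite normrM mulfK// gt_eqF.
have ple : `|p| <= `|p - t * a| + `|t| * a.
  have := ler_normD (p - t * a) (t * a).
  by rewrite subrK (normrM t) (gtr0_norm a0).
have H3 : `|t| * N <= 2 * W / `|b|.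
  by rewrite tE mulrAC ler_wpM2r// invr_ge0 ltW.
rewrite mulrDr.
have H4 : N * `|p| <= 2 * W + a * (2 * W / `|b|).
  apply: (@le_trans _ _ (N * (`|p - t * a| + `|t| * a))); first by rewrite ler_wpM2l.
  have -> : N * (`|p - t * a| + `|t| * a) = `|p - t * a| * N + a * (`|t| * N) by ring.
  by rewrite lerD// ler_wpM2l// ltW.
rewrite mulrC in H3; rewrite (le_trans (lerD H4 H3))//.
have -> : 2 * W + a * (2 * W / `|b|) + 2 * W / `|b| = 2 * (1 + (a + 1) / `|b|) * W by ring.
by [].
Qed.

End Drift.

(** * The arc of X *)

Section Cross.
Context {R : realType}.
Local Notation E := 'rV[R]_3.
Implicit Types (u v n m z : E).

Let i0 : 'I_3 := ord0.
Let i1 : 'I_3 := lift ord0 ord0.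
Let i2 : 'I_3 := lift ord0 (lift ord0 ord0).

Lemma dotE u v : dot u v = u 0 i0 * v 0 i0 + u 0 i1 * v 0 i1 + u 0 i2 * v 0 i2.
Proof. by rewrite /dot !big_ord_recl big_ord0 addr0 addrA. Qed.

Definition cross u v : E := \row_i
  if i == i0 then u 0 i1 * v 0 i2 - u 0 i2 * v 0 i1
  else if i == i1 then u 0 i2 * v 0 i0 - u 0 i0 * v 0 i2
  else u 0 i0 * v 0 i1 - u 0 i1 * v 0 i0.

Lemma row3P u v : u 0 i0 = v 0 i0 -> u 0 i1 = v 0 i1 -> u 0 i2 = v 0 i2 -> u = v.
Proof.
move=> e0 e1 e2; apply/rowP => i.
case: (unliftP i0 i) => [j|] -> //; case: (unliftP ord0 j) => [k|] -> //.
by rewrite (ord1 k).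
Qed.

(** The vector [v] shows that [n] and [m] are independent, so their cross product [u] is nonzero and
    directs the line orthogonal to both. The bound on [z] is its expansion in the reciprocal
    basis. *)
Lemma cross_basis n m v : dot n v = 0 -> dot m v != 0 -> n != 0 ->
  exists u C, 0 < C /\ forall z, `|z| <= C * (`|dot u z| + `|dot n z| + `|dot m z|).
Proof.
move=> nv mv n0; pose u := cross n m.
have u0 : u != 0.
  apply: contra_neq n0 => u0.
  have E1 : dot m v *: n = dot n v *: m - cross u v.
    by apply: row3P; rewrite !mxE/= /u ?mxE/= !dotE; ring.
  have cu0 : cross u v = 0 by rewrite u0; apply: row3P; rewrite !mxE/= ?mxE; ring.
  move: E1; rewrite nv cu0 scale0r subr0 => /eqP; rewrite scaler_eq0 (negPf mv) => /eqP//.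
have D0 : 0 < dot u u.
  by rewrite (lt_le_trans _ (le_dotvv u))// exprn_gt0// normr_gt0.
have zE z : dot u u *: z = dot u z *: u + dot n z *: cross m u + dot m z *: cross u n.
  by apply: row3P; rewrite !mxE/= !dotE /u ?mxE/=; ring.
pose S := `|u| + `|cross m u| + `|cross u n|.
have S0 : 0 <= S by rewrite !addr_ge0.
exists u, (S / dot u u + 1); split=> [|z]; first by rewrite ltr_wpDl// divr_ge0// ltW.
set Q := (X in _ * X); have Q0 : 0 <= Q by rewrite !addr_ge0.
apply: (@le_trans _ _ (S / dot u u * Q)); last by rewrite [leRHS]mulrDl lerDl mul1r.
rewrite mulrAC ler_pdivlMr// mulrC -[dot u u in leLHS](gtr0_norm D0) -normrZ zE.
apply: (@le_trans _ _ (`|u| * Q + `|cross m u| * Q + `|cross u n| * Q)); last by rewrite /S !mulrDl.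
rewrite (le_trans (ler_normD _ _))// lerD//; last first.
  by rewrite normrZ mulrC ler_wpM2l// /Q lerDr addr_ge0.
rewrite (le_trans (ler_normD _ _))// lerD//.
  by rewrite normrZ mulrC ler_wpM2l// /Q -addrA lerDl addr_ge0.
by rewrite normrZ mulrC ler_wpM2l// /Q addrAC lerDr addr_ge0.
Qed.

End Cross.

(** * Arcs of X from the fold curve to a neighbourhood of [p0] *)

Section XPhase.
Context {R : realType}.
Local Notation E := 'rV[R]_3.
Variables (h : E -> R) (X : E -> E) (D : set E) (p0 q0 : E) (t0 : R) (c0 : R -> E).
Local Notation phi := (lie X h).
Hypothesis hs : forall x, D x -> sdiff h x (grad h x).
Hypothesis phis : forall x, D x -> sdiff phi x (grad phi x).
Hypothesis XC : forall x, D x -> C1at X x.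
Hypotheses (t00 : 0 < t0) (c0T : traj X t0 c0) (c00 : c0 0 = q0) (c0t0 : c0 t0 = p0).
Hypothesis c0D : forall t, 0 <= t <= t0 -> D (c0 t).
Hypothesis c0h : forall t, 0 < t < t0 -> 0 < h (c0 t).
Hypotheses (hp0 : h p0 = 0) (hq0 : h q0 = 0) (phiq0 : phi q0 = 0).
Hypotheses (fold : 0 < dot (grad phi q0) (X q0)) (phip0 : phi p0 < 0).
Hypothesis nq0 : grad h q0 != 0.

Definition fold_curve x := [/\ D x, h x = 0 & phi x = 0].

(** The start is required to lie on the fold curve, where [lie X h] vanishes; this condition is what
    pins down the starting time in [xarc_back]. *)
Definition xarc (x : E) (s : R) (c : R -> E) :=
  [/\ 0 < s, traj X s c, (forall t, 0 <= t <= s -> D (c t)), c 0 = x /\ fold_curve x &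
    (forall t, 0 < t < s -> 0 < h (c t)) /\ h (c s) = 0].

Lemma Dq0 : D q0. Proof. by rewrite -c00; apply: c0D; rewrite lexx ltW. Qed.
(** At the fold, [X q0] is orthogonal to the gradient of [h] but not to that of [lie X h], so these
    are independent and [u] is the tangent direction of the curve. Chords near [q0] are almost
    parallel to it; the second estimate says that two chords are nearly in the ratio of their
    [u]-coordinates. *)
Lemma fold_curve_coord : exists u C, 0 < C /\ forall e, 0 < e -> exists2 r, 0 < r &
  forall x y, fold_curve x -> fold_curve y -> nb q0 r x -> nb q0 r y ->
   `|x - y| <= C * `|dot u (x - y)| /\ forall z, fold_curve z -> nb q0 r z ->
   `|dot u (y - z) *: (x - y) - dot u (x - y) *: (y - z)| <=
     e * (`|dot u (y - z)| * `|dot u (x - y)|).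
Proof.
have nX : dot (grad h q0) (X q0) = 0 by rewrite -phiq0.
have mX : dot (grad phi q0) (X q0) != 0 by rewrite gt_eqF.
have [u [C [C0 zC]]] := cross_basis nX mX nq0.
exists u, (2 * C); split=> [|e e0]; first by rewrite mulr_gt0.
pose e1 := Num.min (1 / (4 * C)) (e / (8 * C * C)).
have e10 : 0 < e1 by rewrite lt_min !divr_gt0// !mulr_gt0.
have : \forall r \near 0^'+, (forall y z, `|y - q0| < r -> `|z - q0| < r ->
    `|h y - h z - dot (grad h q0) (y - z)| <= e1 * `|y - z|) /\
   forall y z, `|y - q0| < r -> `|z - q0| < r ->
    `|phi y - phi z - dot (grad phi q0) (y - z)| <= e1 * `|y - z|.
  by apply: filterI; [exact: hs Dq0 _ e10|exact: phis Dq0 _ e10].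
move=> /near0_ex[r r0 [hr phir]]; exists r => //.
have tang x y : fold_curve x -> fold_curve y -> nb q0 r x -> nb q0 r y ->
   [/\ `|dot (grad h q0) (x - y)| <= e1 * `|x - y|,
       `|dot (grad phi q0) (x - y)| <= e1 * `|x - y| &
       `|x - y| <= 2 * C * `|dot u (x - y)|].
  move=> [_ hx px] [_ hy py] xr yr.
  have H1 : `|dot (grad h q0) (x - y)| <= e1 * `|x - y|.
    by have := hr x y xr yr; rewrite hx hy subrr sub0r normrN.
  have H2 : `|dot (grad phi q0) (x - y)| <= e1 * `|x - y|.
    by have := phir x y xr yr; rewrite px py subrr sub0r normrN.
  split=> //; have := zC (x - y).
  have : e1 <= 1 / (4 * C) by rewrite /e1 ge_min lexx.
  rewrite ler_pdivlMr ?mulr_gt0// => H3.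
  have : (e1 * (4 * C)) * `|x - y| <= `|x - y| by rewrite ler_piMl.
  have : C * `|dot (grad h q0) (x - y)| <= C * (e1 * `|x - y|) by rewrite ler_wpM2l// ltW.
  have : C * `|dot (grad phi q0) (x - y)| <= C * (e1 * `|x - y|) by rewrite ler_wpM2l// ltW.
  rewrite !mulrDr; lra.
move=> x y gx gy xr yr; have [nxy mxy uxy] := tang x y gx gy xr yr; split=> // z gz zr.
have [nyz myz uyz] := tang y z gy gz yr zr.
set al := dot u (y - z) in uyz *; set al' := dot u (x - y) in uxy *.
set w := (X in `|X|).
(* The weights cancel the [u]-component of [w]; what remains lies along the two gradients, where
   chords are small. *)
have uw : dot u w = 0 by rewrite /w dotBr !dotZr -/al -/al' mulrC subrr.
have key k : `|dot k (x - y)| <= e1 * `|x - y| -> `|dot k (y - z)| <= e1 * `|y - z| ->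
    `|dot k w| <= 4 * C * e1 * (`|al| * `|al'|).
  move=> k1 k2; rewrite /w dotBr !dotZr (le_trans (ler_normB _ _))// !normrM.
  have : `|al| * `|dot k (x - y)| <= `|al| * (e1 * (2 * C * `|al'|)).
    by rewrite ler_wpM2l// (le_trans k1)// ler_wpM2l// ltW.
  have : `|al'| * `|dot k (y - z)| <= `|al'| * (e1 * (2 * C * `|al|)).
    by rewrite ler_wpM2l// (le_trans k2)// ler_wpM2l// ltW.
  lra.
have := zC w; rewrite uw normr0 add0r => /le_trans; apply.
apply: (@le_trans _ _ (C * (4 * C * e1 * (`|al| * `|al'|) + 4 * C * e1 * (`|al| * `|al'|)))).
  by rewrite ler_wpM2l ?(ltW C0)// lerD// key.
have : e1 <= e / (8 * C * C) by rewrite /e1 ge_min lexx orbT.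
rewrite ler_pdivlMr ?mulr_gt0// => H.
have -> : C * (4 * C * e1 * (`|al| * `|al'|) + 4 * C * e1 * (`|al| * `|al'|)) =
  (e1 * (8 * C * C)) * (`|al| * `|al'|) by ring.
by rewrite ler_wpM2r// mulr_ge0.
Qed.

Lemma xtube : exists L q, [/\ 0 < L, 0 < q & forall t, 0 <= t <= t0 ->
  [/\ lip_on L X (nb (c0 t) q),
      (forall y z, nb (c0 t) q y -> nb (c0 t) q z -> `|h y - h z| <= L * `|y - z|) &
      (forall y, nb (c0 t) q y -> `|X y| <= L)]].
Proof.
pose P L (A : set E) := [/\ lip_on L X A,
  (forall y z, A y -> A z -> `|h y - h z| <= L * `|y - z|) & (forall y, A y -> `|X y| <= L)].
have [||L [q [L0 q00 H]]] := compact_tube (traj_compact c0T) (P := P).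
- move=> L L' A B LL AB [H1 H2 H3]; split.
  + by move=> y z Ay Az; rewrite (le_trans (H1 _ _ (AB _ Ay) (AB _ Az)))// ler_wpM2r.
  + by move=> y z Ay Az; rewrite (le_trans (H2 _ _ (AB _ Ay) (AB _ Az)))// ler_wpM2r.
  + by move=> y Ay; rewrite (le_trans (H3 _ (AB _ Ay))).
- move=> _ [t + <-]; rewrite /= in_itv/= => tt0; have Dt := c0D tt0.
  have [L1 [r1 [r10 H1]]] := C1at_lip (XC Dt).
  have [r2 r20 H2] := near0_ex (sdiff_lip (hs Dt)).
  set L2 := 3 * _ + 1 in H2.
  pose r := Num.min r1 r2.
  have r0 : 0 < r by rewrite lt_min r10.
  have rr1 y : nb (c0 t) r y -> `|y - c0 t| < r1.
    by move=> H; rewrite (lt_le_trans H)// ge_min lexx.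
  have rr2 y : nb (c0 t) r y -> `|y - c0 t| < r2.
    by move=> H; rewrite (lt_le_trans H)// ge_min lexx orbT.
  pose L := Num.max (Num.max L1 L2) (`|X (c0 t)| + `|L1| * r).
  exists L, r; split=> //; split.
  + move=> y z yr zr; rewrite (le_trans (H1 _ _ (rr1 _ yr) (rr1 _ zr)))//.
    by rewrite ler_wpM2r// /L !le_max lexx.
  + move=> y z yr zr; rewrite (le_trans (H2 _ _ (rr2 _ yr) (rr2 _ zr)))//.
    by rewrite ler_wpM2r// /L !le_max lexx orbT.
  + move=> y yr; apply: (@le_trans _ _ (`|X (c0 t)| + `|L1| * r)); last by rewrite /L le_max lexx orbT.
    rewrite -(subrK (X (c0 t)) (X y)) addrC (le_trans (ler_normD _ _))// lerD2l.
    rewrite (le_trans (H1 _ _ (rr1 _ yr) (rr1 _ (nb_center _ r0))))//.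
    rewrite (@le_trans _ _ (`|L1| * `|y - c0 t|))// ?ler_wpM2r ?ler_norm//.
    by rewrite ler_wpM2l// ltW.
exists L, q; split=> // t tt0; apply: H.
by exists t => //=; rewrite in_itv.
Qed.

(** Near a visible fold [lie X h] increases from 0 along the arc and so is positive; a return to
    [h = 0] before [ta] would make it vanish in between, by Rolle's theorem. The hitting lemmas can
    thus ignore the initial contact with the surface. *)
Lemma fold_exit : exists ta r, [/\ 0 < ta, ta < t0, 0 < r & forall x s c, xarc x s c ->
  nb q0 r x -> ta <= s].
Proof.
have [L [q [L0 qq0 H]]] := xtube.
have t0t0 : (0 : R) <= 0 <= t0 by rewrite lexx ltW.
have [Xl _ XB] := H 0 t0t0; rewrite c00 in Xl XB.
have [q1 /andP[q10 q1q] Hq1] := traj_rate qq0 (ltW L0) (phis Dq0) fold Xl.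
pose ta := Num.min (t0 / 2) (q1 / (2 * L)).
have ta0 : 0 < ta by rewrite lt_min !divr_gt0 ?mulr_gt0.
have taL : L * ta <= q1 / 2.
  have : ta <= q1 / (2 * L) by rewrite /ta ge_min lexx orbT.
  by rewrite ler_pdivlMr ?mulr_gt0//; lra.
exists ta, (q1 / 2); split=> //; first by rewrite /ta gt_min ltr_pdivrMr// ltr_pMr// ltr1n.
  by rewrite divr_gt0.
move=> x s c [s0 cT cD [cx [Dx hx px]] [ch chs]] xq.
rewrite leNgt; apply/negP => sta.
have inq : forall t, 0 <= t <= s -> `|c t - q0| < q1.
  have := @traj_slow _ X s c q0 q1 L (ltW s0) (ltW L0) cT.
  have XB' y : `|y - q0| < q1 -> `|X y| <= L by move=> yq; apply: XB; exact: lt_le_trans q1q.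
  move=> /(_ XB') H'; have {}H' := H' _; move=> t ts.
  have : `|c 0 - q0| + L * s < q1.
    have : L * s < L * ta by rewrite ltr_pM2l.
    by move: xq; rewrite cx /nb/=; lra.
  by move=> /H' => /(_ t ts)[].
have phic t : 0 < t -> t <= s -> 0 < phi (c t).
  move=> tt ts; have := Hq1 s c cT inq 0 t (lexx 0) (ltW tt) ts.
  rewrite cx px !subr0; apply: lt_le_trans.
  by rewrite mulr_gt0// divr_gt0.
have hcont : {within `[0, s], continuous (h \o c)}.
  apply: within_comp cT.1 => t ts; exact: sdiff_continuous (hs (cD t ts)).
have hd t : t \in `]0, s[ -> is_derive t 1 (h \o c) (phi (c t)).
  rewrite in_itv/= => ts; have ts' : 0 <= t <= s by case/andP: ts => *; rewrite !ltW.
  exact: is_derive_sdiff (cT.2 t ts) (hs (cD t ts')).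
have [t] := MVT s0 hd hcont; rewrite in_itv/= => /andP[tt ts].
rewrite /= chs cx hx subrr subr0 => /esym/eqP.
by rewrite mulf_eq0 (gt_eqF s0) orbF gt_eqF// phic// ltW.
Qed.

Let t0t0 : 0 <= t0 <= t0. Proof. by rewrite lexx ltW. Qed.
Let z0t0 : (0 : R) <= 0 <= t0. Proof. by rewrite lexx ltW. Qed.

Lemma xarc0 : xarc q0 t0 c0.
Proof.
split=> //; first by split=> //; split=> //; rewrite -c00; exact: c0D.
by split=> //; rewrite c0t0.
Qed.

Lemma arrival_sdiff : sdiff (fun x => - h x) (c0 t0) (- grad h p0).
Proof. by apply: sdiffN; rewrite c0t0; apply: hs; rewrite -c0t0; exact: c0D. Qed.

Lemma arrival_rate : 0 < dot (- grad h p0) (X (c0 t0)).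
Proof. by rewrite dotNl oppr_gt0 c0t0. Qed.

Lemma xarc_pair : exists C r, [/\ 0 < C, 0 < r & forall x1 s1 c1 x2 s2 c2,
  xarc x1 s1 c1 -> xarc x2 s2 c2 -> nb q0 r x1 -> nb q0 r x2 ->
  `|s1 - s2| <= C * `|x1 - x2| /\
  forall t, 0 <= t <= Num.min s1 s2 -> `|c1 t - c2 t| <= C * `|x1 - x2|].
Proof.
have [ta [r [ta0 tat0 r0 H]]] := fold_exit.
have [L [q [L0 qp HT]]] := xtube.
have := @hit_pair _ X (fun x => - h x) c0 t0 ta (- grad h p0) L q c0T (ltW ta0) tat0 L0 qp.
case.
- by move=> t /HT[].
- by move=> t /HT[_ H2 _] y z yq zq; rewrite opprK addrC distrC; exact: H2.
- by move=> t /andP[tat tt0]; rewrite oppr_lt0 c0h// tt0 (lt_le_trans ta0).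
- by rewrite c0t0 hp0 oppr0.
- exact: arrival_sdiff.
- exact: arrival_rate.
move=> C [r' [C0 r'0 H']]; exists C, (Num.min r r'); split=> //; first by rewrite lt_min r0.
have hit x s c : xarc x s c -> nb q0 r x -> hits X (fun x => - h x) ta s c.
  move=> xc xr; have tas := H x s c xc xr.
  have [s0 cT cD _ [ch chs]] := xc; split=> //; first by rewrite chs oppr0.
  by move=> t /andP[tat ts]; rewrite oppr_lt0 ch// ts (lt_le_trans ta0).
move=> x1 s1 c1 x2 s2 c2 xc1 xc2; rewrite /nb/= !lt_min => /andP[x1r x1r'] /andP[x2r x2r'].
have [_ _ _ [c1x _] _] := xc1; have [_ _ _ [c2x _] _] := xc2.
have := H' _ _ _ _ (hit _ _ _ xc1 x1r) (hit _ _ _ xc2 x2r).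
by rewrite c00 c1x c2x; apply.
Qed.

Lemma xarc_near eta : 0 < eta -> exists2 r, 0 < r & forall x s c, xarc x s c -> nb q0 r x ->
  [/\ `|s - t0| <= eta, forall t, 0 <= t <= s -> `|c t - c0 (Num.min t t0)| <= eta &
      `|c s - p0| <= eta].
Proof.
move=> eta0.
have [ta [r [ta0 tat0 r0 H]]] := fold_exit.
have [L [q [L0 qp HT]]] := xtube.
have e20 : 0 < eta / 2 by rewrite divr_gt0.
have [d d0 Hd] := (within_itvP _ _ _).1 c0T.1 t0 t0t0 _ e20.
have eta'0 : 0 < Num.min (eta / 2) (d / 2) by rewrite lt_min e20 divr_gt0.
have [||||||r' r'0 H'] := @hit_single _ X (fun x => - h x) c0 t0 ta (- grad h p0) L q c0T (ltW ta0) tat0 L0 qp _ _ _ _ _ _ _ eta'0.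
- by move=> t /HT[].
- by move=> t /HT[_ H2 _] y z yq zq; rewrite opprK addrC distrC; exact: H2.
- by move=> t /andP[tat tt0]; rewrite oppr_lt0 c0h// tt0 (lt_le_trans ta0).
- by rewrite c0t0 hp0 oppr0.
- exact: arrival_sdiff.
- exact: arrival_rate.
exists (Num.min r r'); first by rewrite lt_min r0.
move=> x s c xc; rewrite /nb/= lt_min => /andP[xr xr'].
have tas := H x s c xc xr.
have [s0 cT cD [cx _] [ch chs]] := xc.
have hit : hits X (fun x => - h x) ta s c.
  split=> //; first by rewrite chs oppr0.
  by move=> t /andP[tat ts]; rewrite oppr_lt0 ch// ts (lt_le_trans ta0).
have := H' _ _ hit; rewrite cx c00 => /(_ xr')[].
rewrite le_min => /andP[st0 sd] cc.
have etale : Num.min (eta / 2) (d / 2) <= eta / 2 by rewrite ge_min lexx.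
split.
- by rewrite (le_trans st0)// ler_pdivrMr// ler_pMr// ler1n.
- by move=> t ts; rewrite (le_trans (cc t ts))// (le_trans etale)// ler_pdivrMr// ler_pMr// ler1n.
- have s_s : 0 <= s <= s by rewrite lexx ltW.
  have := le_trans (cc s s_s) etale.
  have m0 : 0 <= Num.min s t0 <= t0 by rewrite le_min (ltW s0) (ltW t00)/= ge_min lexx orbT.
  have : `|c0 (Num.min s t0) - c0 t0| < eta / 2.
    apply: Hd => //; have [le|lt] := leP s t0; last by rewrite subrr normr0.
    by rewrite (le_lt_trans sd)// ltr_pdivrMr// ltr_pMr// ltr1n.
  have := ler_normD (c s - c0 (Num.min s t0)) (c0 (Num.min s t0) - c0 t0).
  rewrite subrKA c0t0.
  move=> {H H' HT Hd hit cc cT cD ch}; lra.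
Qed.

(* Running both trajectories backward from their arrival points, the times
   being shifted so that the arrivals are simultaneous. *)
Lemma xarc_back : exists C r, [/\ 0 < C, 0 < r & forall x1 s1 c1 x2 s2 c2,
  xarc x1 s1 c1 -> xarc x2 s2 c2 -> nb q0 r x1 -> nb q0 r x2 ->
  `|x1 - x2| <= C * `|c1 s1 - c2 s2|].
Proof.
have [L [q [L0 qp HT]]] := xtube.
have Dq : D q0 by rewrite -c00; exact: c0D.
have [Xl _ XB] := HT 0 z0t0; rewrite c00 in Xl XB.
have [q1 /andP[q10 q1q] Hq1] := traj_rate qp (ltW L0) (phis Dq) fold Xl.
set a := dot _ _ in Hq1; have a0 : 0 < a by exact: fold.
have [q2 q20 Hq2] := near0_ex (sdiff_lip (phis Dq)).
set Lp := 3 * _ + 1 in Hq2.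
have Lp0 : 0 < Lp by rewrite ltr_wpDl// mulr_ge0.
pose q3 := Num.min q1 q2; have q30 : 0 < q3 by rewrite lt_min q10.
have q3q1 : q3 <= q1 by rewrite ge_min lexx.
have q3q2 : q3 <= q2 by rewrite ge_min lexx orbT.
have q3q : q3 <= q by exact: le_trans q1q.
pose eta := Num.min (1 / 2) (q3 / (2 * (1 + 2 * L))).
have L20 : 0 < 2 * (1 + 2 * L) by rewrite mulr_gt0// addr_gt0// mulr_gt0.
have eta0 : 0 < eta by rewrite lt_min !divr_gt0.
have eta1 : eta <= 1 / 2 by rewrite /eta ge_min lexx.
have etaq : eta + L * (2 * eta) < q3.
  have : eta <= q3 / (2 * (1 + 2 * L)) by rewrite /eta ge_min lexx orbT.
  rewrite ler_pdivlMr//; have : 0 < L * eta by rewrite mulr_gt0.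
  lra.
have [r r0 Hr] := xarc_near eta0.
pose G := gron L (t0 + 1).
have G2 : 2 <= G by apply: gron_ge2; [exact: ltW|rewrite addr_ge0// ltW].
have G0 : 0 < G by exact: lt_le_trans G2.
have C0 : 0 < G + L * (2 * (Lp * G) / a).
  by apply: addr_gt0 => //; apply: mulr_gt0 => //; apply: divr_gt0 => //; apply: mulr_gt0 => //; exact: mulr_gt0.
exists (G + L * (2 * (Lp * G) / a)), (Num.min r q3); split=> //; first by rewrite lt_min r0.
suff wl x1 s1 c1 x2 s2 c2 : xarc x1 s1 c1 -> xarc x2 s2 c2 ->
    nb q0 r x1 -> nb q0 r x2 -> nb q0 q3 x1 -> s1 <= s2 ->
    `|x1 - x2| <= (G + L * (2 * (Lp * G) / a)) * `|c1 s1 - c2 s2|.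
  move=> x1 s1 c1 x2 s2 c2 xc1 xc2 x1n x2n.
  have /andP[x1r x1q] : (`|x1 - q0| < r) && (`|x1 - q0| < q3) by rewrite -lt_min.
  have /andP[x2r x2q] : (`|x2 - q0| < r) && (`|x2 - q0| < q3) by rewrite -lt_min.
  have [s12|s21] := leP s1 s2; first exact: (wl _ _ _ _ _ _ xc1 xc2 x1r x2r x1q s12).
  rewrite distrC [`|c1 _ - _|]distrC.
  exact: (wl _ _ _ _ _ _ xc2 xc1 x2r x1r x2q (ltW s21)).
move=> xc1 xc2 x1r x2r x1q s12.
have [s1t c1c0 _] := Hr _ _ _ xc1 x1r; have [s2t c2c0 _] := Hr _ _ _ xc2 x2r.
have [s10 c1T c1D [c1x [_ _ px1]] _] := xc1.
have [s20 c2T c2D [c2x [_ _ px2]] _] := xc2.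
pose sg := s2 - s1.
have sg0 : 0 <= sg by rewrite subr_ge0.
have sge : sg <= 2 * eta.
  by move: s1t s2t; rewrite !ler_norml /sg => /andP[? ?] /andP[? ?]; move: {HT Hr Hq1 Hq2 c1c0 c2c0} eta0; lra.
have min0 t : 0 <= t -> 0 <= Num.min t t0 <= t0.
  by move=> tt; rewrite le_min tt (ltW t00) ge_min lexx orbT.
have minD t k : 0 <= k -> Num.min (t + k) t0 - Num.min t t0 <= k /\ Num.min t t0 <= Num.min (t + k) t0.
  move=> k0; split; last by rewrite le_min2// lerDl.
  rewrite lerBlDr; have [le|lt] := leP t t0; first by rewrite ge_min addrC lexx.
  by rewrite ge_min lerDr k0 orbT.
have c0sp t k : 0 <= t -> 0 <= k -> `|c0 (Num.min (t + k) t0) - c0 (Num.min t t0)| <= L * k.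
  move=> tt k0; have [H1 H2] := minD t k k0.
  have /andP[m1 _] := min0 t tt; have /andP[_ m2] := min0 (t + k) (addr_ge0 tt k0).
  rewrite (le_trans (traj_speed (ltW L0) c0T m1 H2 m2 _))//.
    move=> w /andP[w1 w2]; have [|_ _ HB] := HT w; first by rewrite (le_trans m1 w1) (le_trans w2 m2).
    exact/HB/nb_center.
  by rewrite ler_wpM2l// ltW.
have c2sh t : 0 <= t -> t + sg <= s2 -> `|c2 (t + sg) - c0 (Num.min t t0)| < q3.
  move=> tt ts; have H1 := c2c0 (t + sg); have H2 := c0sp t sg tt sg0.
  have H3 : 0 <= t + sg <= s2 by rewrite addr_ge0.
  have := H1 H3 => {}H1.
  have := ler_normD (c2 (t + sg) - c0 (Num.min (t + sg) t0)) (c0 (Num.min (t + sg) t0) - c0 (Num.min t t0)).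
  rewrite subrKA => H4; rewrite (le_lt_trans H4)// (le_lt_trans _ etaq)// lerD//.
  by rewrite (le_trans H2)// ler_wpM2l// ltW.
have sgs2 : sg <= s2 by rewrite /sg lerBlDr lerDl ltW.
have sE : s2 - sg = s1 by rewrite /sg subKr.
have c2T' : traj X s1 (fun t => c2 (t + sg)) by rewrite -sE; exact: traj_shift.
have pair : `|x1 - c2 sg| <= G * `|c1 s1 - c2 s2|.
  have [|_] := @traj_pair _ X L s1 c1 (fun t => c2 (t + sg)) (ltW s10) (ltW L0) c1T c2T'.
    move=> t /andP[tt ts]; have [Hl _ _] := HT _ (min0 t (ltW tt)); apply: Hl.
      rewrite /nb/= (le_lt_trans (c1c0 _ _)) ?ltW//.
      by rewrite (lt_le_trans _ q3q)// (le_lt_trans _ etaq)// lerDl mulr_ge0 ?mulr_ge0 ?ltW.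
    rewrite /nb/= (lt_le_trans (c2sh _ (ltW tt) _))//.
    by rewrite -lerBrDr sE ltW.
  rewrite add0r c1x [s1 + sg]addrC /sg subrK => H.
  rewrite (le_trans H)// ler_wpM2r// gron_le ?(ltW L0)//.
  move: s1t; rewrite ler_norml => /andP[_]; rewrite lerBlDl => /le_trans; apply.
  by rewrite lerD2l (le_trans eta1)// ler_pdivrMr// mul1r ler1n.
have c2q t : 0 <= t <= sg -> `|c2 t - q0| < q3.
  move=> /andP[tt ts].
  have := c2c0 t; rewrite tt (le_trans ts sgs2) => /(_ isT) H1.
  have := c0sp 0 t (lexx 0) tt; rewrite add0r (min_l (ltW t00)) c00 => H2.
  have := ler_normD (c2 t - c0 (Num.min t t0)) (c0 (Num.min t t0) - q0).
  rewrite subrKA => H4; rewrite (le_lt_trans H4)// (le_lt_trans _ etaq)// lerD//.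
  by rewrite (le_trans H2)// ler_wpM2l ?(ltW L0)// (le_trans ts).
have c2q1 t : 0 <= t <= sg -> `|c2 t - q0| < q1 by move=> /c2q /lt_le_trans; apply.
(* The fold sets the clock: [lie X h] vanishes at [x2] and at [x1], hence is small at [c2 sg], which
   is close to [x1], but it grows along [c2] at a definite rate. So the delay [sg] is of the order
   of the distance between the arrival points. *)
have := Hq1 sg c2 (traj_sub sgs2 c2T) c2q1 0 sg (lexx 0) sg0 (lexx _).
rewrite c2x px2 !subr0 => rate.
have sgsg : 0 <= sg <= sg by rewrite sg0 lexx.
have := Hq2 (c2 sg) x1 (lt_le_trans (c2q sg sgsg) q3q2) (lt_le_trans x1q q3q2).
rewrite px1 subr0 distrC => lipp.
have sgle : sg <= 2 * (Lp * G) / a * `|c1 s1 - c2 s2|.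
  rewrite mulrAC ler_pdivlMr//.
  have K1 : Lp * `|x1 - c2 sg| <= Lp * (G * `|c1 s1 - c2 s2|) by rewrite ler_wpM2l// ltW.
  have K2 := ler_norm (phi (c2 sg)).
  have -> : 2 * (Lp * G) * `|c1 s1 - c2 s2| = 2 * (Lp * (G * `|c1 s1 - c2 s2|)) by ring.
  rewrite -(ler_pM2l (_ : 0 < 2^-1)) ?invr_gt0// mulKf//.
  have -> : 2^-1 * (sg * a) = a / 2 * sg by ring.
  by rewrite (le_trans rate)// (le_trans K2)// (le_trans lipp).
have sp : `|c2 sg - x2| <= L * sg.
  rewrite -c2x -[sg in leRHS]subr0; apply: (traj_speed (ltW L0) c2T) => //.
  by move=> t /c2q1 tq; apply: XB; exact: lt_le_trans q1q.
rewrite -(subrKA (c2 sg)) (le_trans (ler_normD _ _))// mulrDl lerD//.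
by apply: le_trans sp _; rewrite -(mulrA L) ler_wpM2l// ltW.
Qed.

(** Up to the earlier arrival the arcs are close by [xarc_pair]; in the remaining time, itself
    proportional to the initial distance, the later arc moves at bounded speed. *)
Lemma xarc_end : exists C r, [/\ 0 < C, 0 < r & forall x1 s1 c1 x2 s2 c2,
  xarc x1 s1 c1 -> xarc x2 s2 c2 -> nb q0 r x1 -> nb q0 r x2 ->
  `|c1 s1 - c2 s2| <= C * `|x1 - x2|].
Proof.
have [L [q [L0 qp HT]]] := xtube.
have [C [r [C0 r0 Hr]]] := xarc_pair.
have [r' r'0 Hr'] := xarc_near (divr_gt0 qp (ltr0n _ 2)).
exists (C + L * C), (Num.min r r'); split=> //; first by rewrite addr_gt0// mulr_gt0.
  by rewrite lt_min r0.
suff wl x1 s1 c1 x2 s2 c2 : xarc x1 s1 c1 -> xarc x2 s2 c2 ->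
    nb q0 r x1 -> nb q0 r x2 -> nb q0 r' x2 -> s1 <= s2 ->
    `|c1 s1 - c2 s2| <= (C + L * C) * `|x1 - x2|.
  move=> x1 s1 c1 x2 s2 c2 xc1 xc2 x1n x2n.
  have /andP[x1r x1q] : (`|x1 - q0| < r) && (`|x1 - q0| < r') by rewrite -lt_min.
  have /andP[x2r x2q] : (`|x2 - q0| < r) && (`|x2 - q0| < r') by rewrite -lt_min.
  have [s12|s21] := leP s1 s2; first exact: (wl _ _ _ _ _ _ xc1 xc2 x1r x2r x2q s12).
  rewrite distrC [`|x1 - _|]distrC.
  exact: (wl _ _ _ _ _ _ xc2 xc1 x2r x1r x1q (ltW s21)).
move=> xc1 xc2 x1r x2r x2r' s12.
have [H1 H2] := Hr _ _ _ _ _ _ xc1 xc2 x1r x2r.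
have [_ c2c0 _] := Hr' _ _ _ xc2 x2r'.
have [s10 c1T _ _ _] := xc1; have [s20 c2T _ _ _] := xc2.
rewrite -(subrKA (c2 s1)) (le_trans (ler_normD _ _))// mulrDl lerD//.
  by apply: H2; rewrite (min_l s12) lexx ltW.
rewrite distrC -mulrA (le_trans (traj_speed (ltW L0) c2T (ltW s10) s12 (lexx _) _))//.
  move=> t /andP[s1t ts2]; have tt : 0 <= t by rewrite (le_trans (ltW s10)).
  have [|_ _ HB] := HT (Num.min t t0).
    by rewrite le_min tt (ltW t00) ge_min lexx orbT.
  apply: HB; rewrite /nb/= (le_lt_trans (c2c0 t _)) ?tt//.
  by rewrite ltr_pdivrMr// ltr_pMr// ltr1n.
rewrite ler_wpM2l ?(ltW L0)//; move: H1; rewrite distrC ger0_norm// subr_ge0//.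
Qed.

(* [k] kills [X p0], so the difference of the arrival times does not count. *)
Lemma xarc_arrival_lin (k : E) e : dot k (X p0) = 0 -> 0 < e ->
  exists eta r, [/\ 0 < eta, eta < t0, 0 < r & forall x1 s1 c1 x2 s2 c2,
  xarc x1 s1 c1 -> xarc x2 s2 c2 -> nb q0 r x1 -> nb q0 r x2 ->
  [/\ t0 - eta <= s1, t0 - eta <= s2 &
  `|dot k (c1 s1 - c2 s2) - dot k (c1 (t0 - eta) - c2 (t0 - eta))| <= e * `|x1 - x2|]].
Proof.
move=> kX e0.
have [L [q [L0 qp HT]]] := xtube.
have [C [r [C0 r0 Hr]]] := xarc_pair.
pose N := 3 * `|k| + 1; have N0 : 0 < N by rewrite ltr_wpDl// mulr_ge0.
have kN v : `|dot k v| <= N * `|v|.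
  by rewrite (le_trans (dot_le _ _))// ler_wpM2r// lerDl.
pose e2 := e / (2 * N * C); have e20 : 0 < e2.
  by apply: divr_gt0 => //; do 2?[apply: mulr_gt0 => //].
have e2E : N * (e2 * C) = e / 2 by rewrite /e2; field; rewrite !gt_eqF.
have NL0 : 0 < 4 * N * L * C by do 3?[apply: mulr_gt0 => //].
have L10 : 0 < 1 + L by rewrite addr_gt0.
pose rho := Num.min q (e2 / L).
have rho0 : 0 < rho by rewrite lt_min qp divr_gt0.
(* The arcs are compared at the common time [t0 - eta], no later than either arrival. From there to
   the earlier arrival their difference changes by a small multiple of the initial distance, and
   near [p0] the later arc moves almost along [X p0]. *)
pose eta := Num.min (Num.min (t0 / 2) (e / (4 * N * L * C))) (rho / (2 * (1 + L))).
have eta0 : 0 < eta.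
  rewrite !lt_min !divr_gt0//.
  by apply: mulr_gt0.
have [etat etae etar] : [/\ eta <= t0 / 2, eta <= e / (4 * N * L * C) & eta <= rho / (2 * (1 + L))].
  have /andP[/andP[-> ->] ->] : ((eta <= t0 / 2) && (eta <= e / (4 * N * L * C))) && (eta <= rho / (2 * (1 + L))).
    by rewrite -!le_min.
  by [].
have etat0 : eta < t0 by rewrite (le_lt_trans etat)// ltr_pdivrMr// ltr_pMr// ltr1n.
have [r' r'0 Hr'] := xarc_near eta0.
exists eta, (Num.min r r'); split=> //; first by rewrite lt_min r0.
suff wl x1 s1 c1 x2 s2 c2 : xarc x1 s1 c1 -> xarc x2 s2 c2 ->
    nb q0 r x1 -> nb q0 r x2 -> nb q0 r' x1 -> nb q0 r' x2 -> s1 <= s2 ->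
    [/\ t0 - eta <= s1, t0 - eta <= s2 &
    `|dot k (c1 s1 - c2 s2) - dot k (c1 (t0 - eta) - c2 (t0 - eta))| <= e * `|x1 - x2|].
  move=> x1 s1 c1 x2 s2 c2 xc1 xc2 x1n x2n.
  have /andP[x1r x1q] : (`|x1 - q0| < r) && (`|x1 - q0| < r') by rewrite -lt_min.
  have /andP[x2r x2q] : (`|x2 - q0| < r) && (`|x2 - q0| < r') by rewrite -lt_min.
  have [s12|s21] := leP s1 s2; first exact: (wl _ _ _ _ _ _ xc1 xc2 x1r x2r x1q x2q s12).
  have [H1 H2 H3] := wl _ _ _ _ _ _ xc2 xc1 x2r x1r x2q x1q (ltW s21).
  split=> //; move: H3; rewrite [`|x2 - _|]distrC !dotBr; set u := t0 - eta.
  have -> : dot k (c1 s1) - dot k (c2 s2) - (dot k (c1 u) - dot k (c2 u)) =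
    - (dot k (c2 s2) - dot k (c1 s1) - (dot k (c2 u) - dot k (c1 u))) by ring.
  by rewrite normrN.
move=> xc1 xc2 x1r x2r x1r' x2r' s12.
have [H1 H2] := Hr _ _ _ _ _ _ xc1 xc2 x1r x2r.
have [s1t c1c0 _] := Hr' _ _ _ xc1 x1r'; have [s2t c2c0 _] := Hr' _ _ _ xc2 x2r'.
have [s10 c1T _ _ _] := xc1; have [s20 c2T _ _ _] := xc2.
have dist (w : R) : `|w - t0| <= eta -> t0 - eta <= w /\ w <= t0 + eta.
  by rewrite ler_distl => /andP[].
have [s1lo s1hi] := dist _ s1t; have [s2lo s2hi] := dist _ s2t; split=> //.
set s := t0 - eta in s1lo s2lo *.
have s_0 : 0 < s by rewrite subr_gt0.
have min0 t : 0 <= t -> 0 <= Num.min t t0 <= t0.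
  by move=> tt; rewrite le_min tt (ltW t00) ge_min lexx orbT.
have etaq : eta < q.
  rewrite (le_lt_trans etar)// ltr_pdivrMr ?mulr_gt0// (le_lt_trans (_ : rho <= q))//.
    by rewrite ge_min lexx.
  rewrite ltr_pMr// mulrDr mulr1 ltr_wpDr//; last by rewrite ltr1n.
  by rewrite mulr_ge0// ltW.
have D1 : `|(c1 s1 - c2 s1) - (c1 s - c2 s)| <= L * (C * `|x1 - x2|) * (2 * eta).
  have LC0 : 0 <= L * (C * `|x1 - x2|) by do 2?[apply: mulr_ge0 => //]; exact: ltW.
  have := @mean_value _ (fun t => c1 t - c2 t) (fun t => X (c1 t) - X (c2 t)) 0 _ s s1 s1lo LC0.
  rewrite scaler0 subr0 => H; apply: le_trans (H _ _ _) _.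
  - apply: within_subr; first exact: within_sub (ltW s_0) (lexx _) c1T.1.
    exact: within_sub (ltW s_0) s12 c2T.1.
  - move=> t /andP[st ts]; apply: is_derive_sub; [apply: c1T.2|apply: c2T.2].
      by rewrite (lt_trans s_0 st).
    by rewrite (lt_trans s_0 st) (lt_le_trans ts).
  - move=> t /andP[st ts]; rewrite subr0; have tt : 0 <= t by rewrite ltW// (lt_trans s_0 st).
    have [Hl _ _] := HT _ (min0 t tt).
    rewrite (le_trans (Hl _ _ _ _))//.
    + by rewrite /nb/= (le_lt_trans (c1c0 t _))// tt ltW.
    + by rewrite /nb/= (le_lt_trans (c2c0 t _))// tt ltW// (lt_le_trans ts).
    + by rewrite ler_wpM2l ?(ltW L0)//; apply: H2; rewrite (min_l s12) tt ltW.
  - rewrite ler_wpM2l// /s opprB addrCA -lerBrDl; lra.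
have Dp : D p0 by rewrite -c0t0; exact: c0D.
have D2 : `|c2 s2 - c2 s1 - (s2 - s1) *: X p0| <= e2 * (s2 - s1).
  apply: (@mean_value _ c2 (fun t => X (c2 t))) => //; first exact: ltW.
  - exact: within_sub (ltW s10) (lexx _) c2T.1.
  - by move=> t /andP[ts1 ts2]; apply: c2T.2; rewrite (lt_trans s10 ts1).
  move=> t /andP[ts1 ts2]; have tt : 0 <= t by rewrite ltW// (lt_trans s10 ts1).
  have t2 : 0 <= t <= s2 by rewrite tt ltW.
  have [Hl _ _] := HT _ t0t0; rewrite c0t0 in Hl.
  have cl : `|c2 t - p0| < rho.
    have h1 := c2c0 t t2.
    have h2 : `|c0 (Num.min t t0) - p0| <= L * eta.
      have /andP[m1 m2] := min0 t tt.
      rewrite -c0t0 distrC (le_trans (traj_speed (ltW L0) c0T m1 m2 (lexx _) _))//.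
        move=> w /andP[w1 w2]; have [|_ _ HB] := HT w; first by rewrite (le_trans m1 w1).
        exact/HB/nb_center.
      rewrite ler_wpM2l ?(ltW L0)// lerBlDr -lerBlDl le_min; apply/andP; split.
        by rewrite (le_trans s1lo)// ltW.
      by rewrite /s gerBl ltW.
    have := ler_normD (c2 t - c0 (Num.min t t0)) (c0 (Num.min t t0) - p0).
    rewrite subrKA => h3; rewrite (le_lt_trans h3)// (le_lt_trans (lerD h1 h2))//.
    have -> : eta + L * eta = eta * (1 + L) by ring.
    rewrite -ltr_pdivlMr// (le_lt_trans etar)// invfM mulrA mulrAC ltr_pdivrMr// ltr_pMr ?ltr1n//.
    by rewrite divr_gt0.
  have clq : `|c2 t - p0| < q by rewrite (lt_le_trans cl)// ge_min lexx.
  rewrite (le_trans (Hl _ _ clq (nb_center _ qp)))// mulrC -ler_pdivlMr//.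
  by rewrite (le_trans (ltW cl))// ge_min lexx orbT.
have -> : dot k (c1 s1 - c2 s2) - dot k (c1 s - c2 s) =
    dot k ((c1 s1 - c2 s1) - (c1 s - c2 s)) - dot k (c2 s2 - c2 s1 - (s2 - s1) *: X p0).
  by rewrite !(dotDr, dotNr, dotZr) kX mulr0; ring.
rewrite (le_trans (ler_normB _ _))//.
have K1 : `|dot k ((c1 s1 - c2 s1) - (c1 s - c2 s))| <= e / 2 * `|x1 - x2|.
  rewrite (le_trans (kN _))//.
  apply: (@le_trans _ _ (N * (L * (C * `|x1 - x2|) * (2 * eta)))).
    by rewrite ler_wpM2l// ltW.
  have -> : N * (L * (C * `|x1 - x2|) * (2 * eta)) = (eta * (4 * N * L * C)) / 2 * `|x1 - x2| by field.
  rewrite ler_wpM2r// ler_pM2r ?invr_gt0//; move: etae; rewrite ler_pdivlMr//.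
have K2 : `|dot k (c2 s2 - c2 s1 - (s2 - s1) *: X p0)| <= e / 2 * `|x1 - x2|.
  rewrite (le_trans (kN _))// -e2E -(mulrA N) ler_wpM2l ?(ltW N0)// (le_trans D2)//.
  rewrite -(mulrA e2) ler_wpM2l ?(ltW e20)//.
  by move: H1; rewrite distrC ger0_norm// subr_ge0.
by rewrite (le_trans (lerD K1 K2))// -mulrDl -splitr.
Qed.

(** Seen through [k], the arrival points form a differentiable curve through [p0] with parameter
    [dot u]. The chords of the fold curve are nearly proportional, [quad_on] and Gronwall keep the
    combination [Zt] small until [t0 - eta], and [xarc_arrival_lin] covers the rest. The arc [c0] of
    [q0] serves as the third arc. *)
Lemma xarc_proportional (u k : E) (Cu : R) e : 0 < Cu ->
  (forall e, 0 < e -> exists2 r, 0 < r &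
    forall x y, fold_curve x -> fold_curve y -> nb q0 r x -> nb q0 r y ->
    `|x - y| <= Cu * `|dot u (x - y)| /\ forall z, fold_curve z -> nb q0 r z ->
    `|dot u (y - z) *: (x - y) - dot u (x - y) *: (y - z)| <=
     e * (`|dot u (y - z)| * `|dot u (x - y)|)) ->
  dot k (X p0) = 0 -> 0 < e ->
  exists2 r, 0 < r & forall x1 s1 c1 x2 s2 c2,
  xarc x1 s1 c1 -> xarc x2 s2 c2 -> nb q0 r x1 -> nb q0 r x2 ->
  `|dot u (x2 - q0) * dot k (c1 s1 - c2 s2) - dot u (x1 - x2) * dot k (c2 s2 - p0)| <=
    e * (`|dot u (x2 - q0)| * `|dot u (x1 - x2)|).
Proof.
move=> Cu0 Hu kX e0.
have [C [rC [C0 rC0 HC]]] := xarc_pair.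
have c0C1 p : (c0 @` `[0, t0]) p -> C1at X p.
  by move=> [t + <-]; rewrite /= in_itv/= => tt; apply: XC; exact: c0D.
have [Lq Lq0 Hq'] := compact_quad (traj_compact c0T) c0C1.
have Hq e' : 0 < e' -> exists2 r, 0 < r & forall t, 0 <= t <= t0 -> quad_on Lq e' X (nb (c0 t) r).
  move=> e'0; have [r r0 H] := Hq' e' e'0.
  by exists r => // t tt; apply: H; exists t => //=; rewrite in_itv.
pose N := 3 * `|k| + 1; have N0 : 0 < N by rewrite ltr_wpDl// mulr_ge0.
have kN v : `|dot k v| <= N * `|v|.
  by rewrite (le_trans (dot_le _ _))// ler_wpM2r// lerDl.
pose G := gron Lq t0.
have G2 : 2 <= G by apply: gron_ge2; exact: ltW.
have G0 : 0 < G by exact: lt_le_trans G2.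
have NG0 : 0 < N * G by exact: mulr_gt0.
have CC0 : 0 < C * Cu by exact: mulr_gt0.
(* Half of [e] is reserved for the combination carried along the arcs, and a quarter for each of the
   two corrections at arrival. *)
pose e1 := e / (4 * Cu); have e10 : 0 < e1 by apply: divr_gt0 => //; exact: mulr_gt0.
pose e2 := e / (4 * (N * G)); have e20 : 0 < e2 by apply: divr_gt0 => //; exact: mulr_gt0.
pose e3 := e2 / (2 * (C * Cu)); have e30 : 0 < e3 by apply: divr_gt0 => //; exact: mulr_gt0.
have [eta [r1 [eta0 etat0 r10 Hlin]]] := xarc_arrival_lin kX e10.
have [r2 r20 Hcoord] := Hu e2 e20.
have [q qp Hquad] := Hq e3 e30.
have q20 : 0 < q / 2 by rewrite divr_gt0.
have [r3 r30 Hnear] := xarc_near q20.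
pose r := Num.min (Num.min r1 r2) (Num.min r3 rC).
have r0 : 0 < r by rewrite !lt_min r10 r20 r30.
exists r => // x1 s1 c1 x2 s2 c2 xc1 xc2 x1n x2n.
have nbr x : nb q0 r x -> [/\ nb q0 r1 x, nb q0 r2 x, nb q0 r3 x & nb q0 rC x].
  rewrite /nb/= => xr; have : `|x - q0| < r := xr.
  by rewrite /r !lt_min => /andP[/andP[? ?] /andP[? ?]].
have [x1r1 x1r2 x1r3 x1rC] := nbr _ x1n; have [x2r1 x2r2 x2r3 x2rC] := nbr _ x2n.
have xc0 := xarc0.
have [q0r1 q0r2 q0r3 q0rC] := nbr _ (nb_center q0 r0).
have [s10 c1T _ [c1x g1] _] := xc1; have [s20 c2T _ [c2x g2] _] := xc2.
have [_ _ _ [_ g0] _] := xc0.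
have [d12 Hz] := Hcoord x1 x2 g1 g2 x1r2 x2r2.
have {}Hz := Hz q0 g0 q0r2.
have [d20 _] := Hcoord x2 q0 g2 g0 x2r2 q0r2.
set al := dot u (x2 - q0) in Hz d20 *; set al' := dot u (x1 - x2) in Hz d12 *.
have [s1e s2e lin12] := Hlin _ _ _ _ _ _ xc1 xc2 x1r1 x2r1.
have [_ s0e lin20] := Hlin _ _ _ _ _ _ xc2 xc0 x2r1 q0r1.
rewrite c0t0 in lin20.
have [_ pair12] := HC _ _ _ _ _ _ xc1 xc2 x1rC x2rC.
have [_ pair20] := HC _ _ _ _ _ _ xc2 xc0 x2rC q0rC.
have [_ n1 _] := Hnear _ _ _ xc1 x1r3; have [_ n2 _] := Hnear _ _ _ xc2 x2r3.
set s := t0 - eta in s1e s2e s0e lin12 lin20.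
have s_0 : 0 < s by rewrite subr_gt0.
have st0 : s <= t0 by rewrite gerBl ltW.
pose Zt t := al *: (c1 t - c2 t) - al' *: (c2 t - c0 t).
pose Wt t := al *: (X (c1 t) - X (c2 t)) - al' *: (X (c2 t) - X (c0 t)).
have A0 : 0 <= `|al| * `|al'| by rewrite mulr_ge0.
pose m := e3 * (2 * (C * Cu)) * (`|al| * `|al'|).
have mE : m = e2 * (`|al| * `|al'|) by rewrite /m /e3 divfK// gt_eqF// mulr_gt0.
have m0 : 0 <= m by rewrite mE mulr_ge0// ltW.
have scd (a : R) (c : R -> E) (w : E) (t : R) : is_derive t 1 c w -> is_derive t 1 (fun t => a *: c t) (a *: w).
  by move=> d; exact: (is_deriveZ a d).
have scw (a : R) (c : R -> E) b b' : {within `[b, b'], continuous c} ->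
    {within `[b, b'], continuous (fun t => a *: c t)}.
  move=> cc; apply: (@within_comp _ _ _ c (fun v : E => a *: v)) cc => t _; exact: scaler_continuous.
have w1 : {within `[0, s], continuous c1} by exact: within_sub (lexx _) s1e c1T.1.
have w2 : {within `[0, s], continuous c2} by exact: within_sub (lexx _) s2e c2T.1.
have w0 : {within `[0, s], continuous c0} by exact: within_sub (lexx _) st0 c0T.1.
have Zw : {within `[0, s], continuous Zt}.
  by apply: within_subr; apply: scw; exact: within_subr.
have Zd t : 0 < t < s -> is_derive t 1 Zt (Wt t).
  move=> /andP[tt ts]; apply: is_derive_sub; apply: scd; apply: is_derive_sub.
  - by apply: c1T.2; rewrite tt (lt_le_trans ts).
  - by apply: c2T.2; rewrite tt (lt_le_trans ts).
  - by apply: c2T.2; rewrite tt (lt_le_trans ts).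
  - by apply: c0T.2; rewrite tt (lt_le_trans ts).
have Wle t : 0 < t < s -> `|Wt t| <= Lq * `|Zt t| + m.
  move=> /andP[tt ts].
  have tt0 : t <= t0 by rewrite ltW// (lt_le_trans ts).
  have t1 : 0 <= t <= s1 by rewrite ltW//= ltW// (lt_le_trans ts).
  have t2 : 0 <= t <= s2 by rewrite ltW//= ltW// (lt_le_trans ts).
  have tr : 0 <= t <= t0 by rewrite ltW.
  have q2q : q / 2 < q by rewrite ltr_pdivrMr// ltr_pMr// ltr1n.
  have nn1 : nb (c0 t) q (c1 t) by have := n1 t t1; rewrite (min_l tt0) => /le_lt_trans; apply.
  have nn2 : nb (c0 t) q (c2 t) by have := n2 t t2; rewrite (min_l tt0) => /le_lt_trans; apply.
  have nn0 : nb (c0 t) q (c0 t) by exact: nb_center.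
  rewrite (le_trans (Hquad t tr _ _ _ _ al al' nn1 nn2 nn2 nn0))// lerD2l /m -mulrA ler_wpM2l ?(ltW e30)//.
  have H1 : `|c1 t - c2 t| <= C * (Cu * `|al'|).
    rewrite (le_trans (pair12 t _)) ?ler_wpM2l ?(ltW C0)//.
    by rewrite ltW//= le_min !ltW// (lt_le_trans ts).
  have H2 : `|c2 t - c0 t| <= C * (Cu * `|al|).
    rewrite (le_trans (pair20 t _)) ?ler_wpM2l ?(ltW C0)//.
    by rewrite ltW//= le_min !ltW// (lt_le_trans ts).
  have -> : 2 * (C * Cu) * (`|al| * `|al'|) = `|al| * (C * (Cu * `|al'|)) + `|al'| * (C * (Cu * `|al|)) by ring.
  by rewrite lerD// ler_wpM2l.
have [Zs _] := gronwall_vec (ltW s_0) (ltW Lq0) m0 Zw Zd Wle.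
have Zse : `|Zt s| <= 2 * (G * e2) * (`|al| * `|al'|).
  rewrite (le_trans Zs)// subr0.
  have Z0 : `|Zt 0| <= e2 * (`|al| * `|al'|) by rewrite /Zt c1x c2x c00.
  apply: (@le_trans _ _ (G * (e2 * (`|al| * `|al'|) + m))).
    apply: ler_pM => //; first by rewrite (le_trans _ (gron_ge2 (ltW Lq0) (ltW s_0))).
    - by rewrite addr_ge0.
    - by apply: gron_le => //; exact: ltW.
    - by rewrite lerD2r.
  by rewrite mE; have -> : G * (e2 * (`|al| * `|al'|) + e2 * (`|al| * `|al'|)) = 2 * (G * e2) * (`|al| * `|al'|) by ring.
have -> : al * dot k (c1 s1 - c2 s2) - al' * dot k (c2 s2 - p0) =
  dot k (Zt s) + al * (dot k (c1 s1 - c2 s2) - dot k (c1 s - c2 s))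
   - al' * (dot k (c2 s2 - p0) - dot k (c2 s - c0 s)).
  by rewrite /Zt !(dotDr, dotNr, dotZr); ring.
have K0 : `|dot k (Zt s)| <= e / 2 * (`|al| * `|al'|).
  rewrite (le_trans (kN _))// (le_trans (ler_wpM2l (ltW N0) Zse))//.
  have -> : N * (2 * (G * e2) * (`|al| * `|al'|)) = e / 2 * (`|al| * `|al'|); last by [].
  by rewrite /e2; field; rewrite !gt_eqF.
have K1 : `|al * (dot k (c1 s1 - c2 s2) - dot k (c1 s - c2 s))| <= e / 4 * (`|al| * `|al'|).
  rewrite normrM [leRHS]mulrCA ler_wpM2l// (le_trans lin12)//.
  rewrite (le_trans (ler_wpM2l (ltW e10) d12))//.
  have -> : e1 * (Cu * `|al'|) = e / 4 * `|al'|; last by [].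
  by rewrite /e1; field; rewrite gt_eqF.
have K2 : `|al' * (dot k (c2 s2 - p0) - dot k (c2 s - c0 s))| <= e / 4 * (`|al| * `|al'|).
  rewrite normrM (mulrC `|al|) [leRHS]mulrCA ler_wpM2l// (le_trans lin20)//.
  rewrite (le_trans (ler_wpM2l (ltW e10) d20))//.
  have -> : e1 * (Cu * `|al|) = e / 4 * `|al|; last by [].
  by rewrite /e1; field; rewrite gt_eqF.
rewrite (le_trans (ler_normB _ _))// (le_trans (lerD (ler_normD _ _) (lexx _)))//.
rewrite (le_trans (lerD (lerD K0 K1) K2))// -!mulrDl; apply: ler_wpM2r => //.
by have -> : e / 2 + e / 4 + e / 4 = e by field.
Qed.

Variables (S : E -> E) (f g : E) (a b C : R) (beta : R -> E) (u : E) (Cu : R).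
Hypothesis foc : focus_at h S p0 f g a b C.
Hypotheses (fX : dot f (X p0) = 0) (gX : dot g (X p0) = 0).
Hypotheses (Sp0 : S p0 = 0) (SCp0 : C1at S p0) (qp : q0 != p0).
Hypothesis beta0 : beta 0 = q0.
Hypothesis beta_traj : forall T, 0 <= T -> traj (fun x => - S x) T beta.
Hypothesis beta_C1 : forall t, 0 <= t -> C1at S (beta t).
Hypothesis beta_lim : forall e, 0 < e -> exists2 T, 0 <= T & `|beta T - p0| < e.
Hypothesis Cu0 : 0 < Cu.
Hypothesis Hu : forall e, 0 < e -> exists2 r, 0 < r &
  forall x y, fold_curve x -> fold_curve y -> nb q0 r x -> nb q0 r y ->
   `|x - y| <= Cu * `|dot u (x - y)| /\ forall z, fold_curve z -> nb q0 r z ->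
   `|dot u (y - z) *: (x - y) - dot u (x - y) *: (y - z)| <=
     e * (`|dot u (y - z)| * `|dot u (x - y)|).

(* The sliding part of the passage, of duration [tau], is run backward. *)
Definition passage (x y : E) (tau : R) := exists s c b,
  [/\ xarc x s c, back h S tau b, b tau = c s, b 0 = y & fold_curve y].

(** The difference [v] of the two backward orbits at time [t1] is contracted relative to [y1 - y2].
    It is also the arrival difference minus the drift of [th] during the delay. Multiplied by [al],
    these two become images of [th - p0] with coefficients [p] and [al * tau], so [focus_noncancel]
    bounds [p] in terms of [v]. *)
Lemma passage_expand : exists d r, [/\ 0 < d, 0 < r & forall x1 y1 t1 x2 y2 t2,
  passage x1 y1 t1 -> passage x2 y2 t2 ->
  nb q0 r x1 -> nb q0 r x2 -> nb q0 r y1 -> nb q0 r y2 -> `|t1 - t2| <= d ->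
  2 * `|dot u (x1 - x2)| <= `|dot u (y1 - y2)|].
Proof.
have [a0 b0 C0 Hf] := foc.
have [C1 [r1 [C10 r10 Hback]]] := xarc_back.
have [C2 [r2 [C20 r20 Hend]]] := xarc_end.
have xc0 := xarc0.
(* [M] converts an arrival difference measured by [N1] into a coordinate difference on the fold
   curve, through [xarc_back]. Below, [e] lets the errors take up half of [W], and the tolerance
   [(4 * K * M * Cu)^-1] makes the final factor exactly 2. *)
have [M ME] : exists M, M = 3 * `|u| * (C1 * C) + 1 by eexists.
have uC0 : 0 <= 3 * `|u| * (C1 * C) by rewrite !mulr_ge0// ltW.
have M0 : 0 < M by rewrite ME ltr_wpDl.
have b_0 : 0 < `|b| by rewrite normr_gt0.
have [K KE] : exists K, K = 2 * (1 + (a + 1) / `|b|) by eexists.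
have K2 : 2 <= K by rewrite KE ler_pMr// lerDl divr_ge0// addr_ge0// ltW.
have K21 : 1 <= 2 * K by rewrite (le_trans (ler1n R 2))// (le_trans K2)// ler_peMl ?(le_trans _ K2)// ler1n.
have K0 : 0 < K by exact: lt_le_trans K2.
have KM0 : 0 < 4 * K * (M + 1) by rewrite !mulr_gt0// addr_gt0.
have [e eE] : exists e, e = (4 * K * (M + 1))^-1 by eexists.
have e0 : 0 < e by rewrite eE invr_gt0.
have KMC0 : 0 < 4 * K * M * Cu by rewrite !mulr_gt0.
have eps0 : 0 < (4 * K * M * Cu)^-1 by rewrite invr_gt0.
have [r3 r30 Hpf] := xarc_proportional Cu0 Hu fX e0.
have [r4 r40 Hpg] := xarc_proportional Cu0 Hu gX e0.
have [rho [d [rho0 d0 Hdrift]]] := focus_drift foc Sp0 hp0 SCp0 e0.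
have [r5 r50 Hmain] := back_main foc Sp0 hp0 SCp0 qp beta0 beta_traj beta_C1 beta_lim rho0 eps0.
have [q1 q10 Hq1] := Hf 1 ltr01.
have [r6 r60 Hcoord] := Hu ltr01.
have eta0 : 0 < Num.min r5 q1 / 2 by rewrite divr_gt0// lt_min r50.
have [r7 r70 Hnear] := xarc_near eta0.
pose r := Num.min (Num.min (Num.min r1 r2) (Num.min r3 r4)) (Num.min r5 (Num.min r6 r7)).
have r0 : 0 < r by rewrite !lt_min r10 r20 r30 r40 r50 r60.
have nbr x : nb q0 r x -> [/\ nb q0 r1 x, nb q0 r2 x, nb q0 r3 x & nb q0 r4 x] /\
    [/\ nb q0 r5 x, nb q0 r6 x & nb q0 r7 x].
  rewrite /nb/= => xr; have : `|x - q0| < r := xr.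
  by rewrite /r !lt_min => /andP[/andP[/andP[? ?] /andP[? ?]] /andP[? /andP[? ?]]].
exists d, r; split=> //.
suff wl x1 y1 t1 x2 y2 t2 : passage x1 y1 t1 -> passage x2 y2 t2 ->
    nb q0 r x1 -> nb q0 r x2 -> nb q0 r y1 -> nb q0 r y2 -> t2 - t1 <= d -> t1 <= t2 ->
    2 * `|dot u (x1 - x2)| <= `|dot u (y1 - y2)|.
  move=> x1 y1 t1 x2 y2 t2 P1 P2 x1r x2r y1r y2r; have [t12|/ltW t21] := leP t1 t2.
    by rewrite distrC ger0_norm ?subr_ge0// => td; exact: (wl _ _ _ _ _ _ P1 P2).
  rewrite ger0_norm ?subr_ge0// => td.
  rewrite -(opprB x2) -(opprB y2) !dotNr !normrN.
  exact: (wl _ _ _ _ _ _ P2 P1).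
move=> [s1 [c1 [b1 [xc1 B1 bc1 by1 gy1]]]] [s2 [c2 [b2 [xc2 B2 bc2 by2 gy2]]]].
move=> /nbr[[x1r1 x1r2 x1r3 x1r4] [x1r5 x1r6 x1r7]].
move=> /nbr[[x2r1 x2r2 x2r3 x2r4] [x2r5 x2r6 x2r7]].
move=> /nbr[_ [y1r5 y1r6 _]] /nbr[_ [y2r5 y2r6 _]] t12 t12'.
have [[q0r1 q0r2 _ _] [_ q0r6 _]] := nbr _ (nb_center q0 r0).
have [_ _ _ [_ gx1] [_ hth1]] := xc1; have [_ _ _ [_ gx2] [_ hth2]] := xc2.
have [_ _ _ [_ gq0] _] := xc0.
have [_ _ th1] := Hnear _ _ _ xc1 x1r7; have [_ _ th2] := Hnear _ _ _ xc2 x2r7.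
have half v : `|v - p0| <= Num.min r5 q1 / 2 -> `|v - p0| < r5 /\ nb p0 q1 v.
  move=> H; have : `|v - p0| < Num.min r5 q1.
    rewrite (le_lt_trans H)// ltr_pdivrMr// ltr_pMr ?ltr1n//.
    by rewrite lt_min r50.
  by rewrite lt_min => /andP[].
have {}[th1r th1q] := half _ th1; have {}[th2r th2q] := half _ th2.
rewrite -bc1 in th1r th1q hth1; rewrite -bc2 in th2r th2q hth2.
have := Hmain _ _ _ _ B1 B2; rewrite by1 by2 => /(_ y1r5 y2r5 th1r th2r t12')[contr tube].
have := Hpf _ _ _ _ _ _ xc1 xc2 x1r3 x2r3; have := Hpg _ _ _ _ _ _ xc1 xc2 x1r4 x2r4.
have bk12 := Hback _ _ _ _ _ _ xc1 xc2 x1r1 x2r1.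
have bk20 := Hback _ _ _ _ _ _ xc2 xc0 x2r1 q0r1.
have en20 := Hend _ _ _ _ _ _ xc2 xc0 x2r2 q0r2.
rewrite c0t0 -bc2 in bk20 en20; rewrite -bc1 -bc2 in bk12; rewrite -bc1 -bc2.
have [cx20 _] := Hcoord x2 q0 gx2 gq0 x2r6 q0r6.
have [cy12 _] := Hcoord y1 y2 gy1 gy2 y1r6 y2r6.
set th := b2 t2 in th2r th2q hth2 bk12 bk20 en20 *.
set P := th - p0 in bk20 en20 *.
set al := dot u (x2 - q0) in cx20 *; set p := dot u (x1 - x2).
move=> Eg Ef.
have [CP _ _] := Hq1 _ _ th2q (nb_center _ q10) hth2 hp0.
have [C12 _ _] := Hq1 _ _ th1q th2q hth1 hth2.
rewrite -/th -/P in CP C12.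
have [t20 b2T hb2] := B2; have [t10 _ _] := B1.
pose tau := t2 - t1; have tau0 : 0 <= tau by rewrite subr_ge0.
have taut2 : tau <= t2 by rewrite /tau gerBl.
have bT : traj S tau (fun t => b2 (t2 - t)).
  apply: traj_sub taut2 _; have := traj_rev b2T.
  by have -> : (fun x => - - S x) = S by apply/funext => x; rewrite opprK.
have := Hdrift tau (fun t => b2 (t2 - t)) _ bT; rewrite tau0 subr0 => /(_ t12) H.
have [||D1 D2] := H.
- move=> t /andP[tt ttau]; apply: tube; rewrite gerBl tt andbT.
  by rewrite lerBrDr addrC -lerBrDr.
- exact: hth2.
move: D1 D2; rewrite /tau subKr -/th -/P -/tau; set w := b2 t1.
set F := dot f P; set G := dot g P.
set v := b1 t1 - w in contr *.
move=> Df Dg.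
have [N NE] : exists N, N = `|F| + `|G| by eexists.
have NP : N1 f g P = N by rewrite NE.
rewrite NP in CP Df Dg.
have N0 : 0 <= N by rewrite NE addr_ge0.
have up k z : `|k| <= C1 * (C * z) -> 0 <= z -> `|dot u k| <= M * z.
  move=> kz z0; rewrite (le_trans (dot_le _ _))//.
  apply: (@le_trans _ _ (3 * `|u| * (C1 * C) * z)); last by rewrite ME ler_wpM2r// lerDl.
  by rewrite -[leRHS]mulrA -(mulrA C1); apply: ler_wpM2l => //; exact: mulr_ge0.
have alN : `|al| <= M * N by apply: up => //; rewrite (le_trans bk20)// ler_wpM2l// ltW.
have v0 : 0 <= N1 f g v by exact: N1_ge0.
have pv : `|p| <= 2 * K * M * N1 f g v.
  (* If [al] vanishes then [x2] is [q0] and [th] is [p0], an equilibrium: there is no drift and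
     [xarc_back] alone bounds [p]. *)
  have [al0|al_n0] := eqVneq al 0.
    have P0 : P = 0.
      apply/eqP; rewrite -normr_le0 (le_trans en20)// -(mulr0 C2) ler_wpM2l ?(ltW C20)//.
      by rewrite (le_trans cx20)// al0 normr0 mulr0.
    have FG0 : F = 0 /\ G = 0 by rewrite /F /G P0 !dot0r.
    have [F0 G0] := FG0.
    have NN0 : N = 0 by rewrite NE F0 G0 !normr0 addr0.
    move: Df Dg; rewrite NN0 F0 G0 !(mulr0, subr0, addr0) !normr_le0 !dotBr !subr_eq0 => /eqP Df /eqP Dg.
    have vE : N1 f g v = N1 f g (b1 t1 - th) by rewrite /N1 !dotBr Df Dg.
    rewrite vE; apply: (@le_trans _ _ (M * N1 f g (b1 t1 - th))).
      by apply: up; [rewrite (le_trans bk12)// ler_wpM2l// ltW|exact: N1_ge0].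
    rewrite ler_wpM2r ?N1_ge0// ler_pMl//.
  have al0 : 0 < `|al| by rewrite normr_gt0.
  (* The first bracket is the error of proportionality, the second that of the drift. *)
  pose e1 := (al * dot f (b1 t1 - th) - p * F) - al * (dot f (w - th) - tau * (a * F - b * G)).
  pose e2 := (al * dot g (b1 t1 - th) - p * G) - al * (dot g (w - th) - tau * (b * F + a * G)).
  have := @focus_noncancel _ a b F G p (al * tau) e1 e2 (al * dot f v) (al * dot g v) a0 b0.
  have vE k : dot k v = dot k (b1 t1 - th) - dot k (w - th) by rewrite !dotBr; ring.
  have EA : al * dot f v = p * F - al * tau * (a * F - b * G) + e1 by rewrite vE /e1; ring.
  have EB : al * dot g v = p * G - al * tau * (b * F + a * G) + e2 by rewrite vE /e2; ring.
  move=> /(_ EA EB); rewrite -KE -NE => HK.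
  have At : `|al * tau| = `|al| * tau by rewrite normrM (ger0_norm tau0).
  have En x y : `|x| <= e * (`|al| * `|p|) -> `|y| <= e * tau * N ->
      `|x - al * y| <= e * ((M + 1) * (N * (`|p| + `|al * tau|))).
    move=> xe ye; rewrite (le_trans (ler_normB _ _))// normrM.
    have H1 : `|al| * `|y| <= `|al| * (e * tau * N) by rewrite ler_wpM2l.
    rewrite (le_trans (lerD xe H1))// At.
    have -> : e * (`|al| * `|p|) + `|al| * (e * tau * N) =
      e * (`|al| * `|p| + N * (`|al| * tau)) by ring.
    rewrite ler_wpM2l ?(ltW e0)//.
    have -> : (M + 1) * (N * (`|p| + `|al| * tau)) =
      (M + 1) * N * `|p| + (M + 1) * (N * (`|al| * tau)) by ring.
    apply: lerD; first by rewrite ler_wpM2r// (le_trans alN)// ler_wpM2r// lerDl.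
    by rewrite ler_peMl ?mulr_ge0// lerDr ltW.
  have H1 := En _ _ Ef Df; have H2 := En _ _ Eg Dg.
  rewrite -/e1 in H1; rewrite -/e2 in H2.
  set W := N * (`|p| + `|al * tau|) in HK H1 H2.
  have ABE : `|al * dot f v| + `|al * dot g v| = `|al| * N1 f g v.
    by rewrite !normrM -mulrDr.
  rewrite ABE in HK.
  have HW : W <= K * (`|al| * N1 f g v) + W / 2.
    apply: (le_trans HK); rewrite mulrDr lerD2l.
    apply: (le_trans (ler_wpM2l (ltW K0) (lerD H1 H2))).
    have -> : K * (e * ((M + 1) * W) + e * ((M + 1) * W)) = W / 2.
      have [M1n Kn] : M + 1 != 0 /\ K != 0 by rewrite !gt_eqF// addr_gt0.
      by rewrite eE; field; rewrite M1n Kn.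
    by [].
  have pW : N * `|p| <= W by rewrite ler_wpM2l// lerDl.
  (* The factor [al] introduced for proportionality is removed again: it is at most [M * N] in
     absolute value, and [N] is the factor contained in [W]. *)
  rewrite -(ler_pM2l al0).
  apply: (@le_trans _ _ (M * N * `|p|)); first by rewrite ler_wpM2r.
  have -> : `|al| * (2 * K * M * N1 f g v) = M * (2 * (K * (`|al| * N1 f g v))) by ring.
  rewrite -mulrA ler_wpM2l ?(ltW M0)// (le_trans pW)//.
  move: HW; rewrite -lerBlDr; have -> : W - W / 2 = W / 2 by field.
  by rewrite ler_pdivrMr// mulrC.
rewrite (le_trans (ler_wpM2l (ler0n _ 2) pv))//.
apply: (@le_trans _ _ (2 * (2 * K * M * ((4 * K * M * Cu)^-1 * (Cu * `|dot u (y1 - y2)|))))).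
  rewrite ler_wpM2l//; apply: ler_wpM2l; first by rewrite !mulr_ge0// ltW.
  by rewrite (le_trans contr)// ler_wpM2l// ltW.
have -> : 2 * (2 * K * M * ((4 * K * M * Cu)^-1 * (Cu * `|dot u (y1 - y2)|))) = `|dot u (y1 - y2)|.
  by field; rewrite !gt_eqF.
by [].
Qed.
End XPhase.

(** * Continuity of the return map *)

Section SlidingContinuity.
Context {R : realType}.
Local Notation E := 'rV[R]_3.
Variables (S : E -> E) (phi : E -> R) (T : R) (c0 : R -> E).
Hypotheses (T0 : 0 < T) (c0T : traj S T c0).
Hypothesis SC : forall t, 0 <= t <= T -> C1at S (c0 t).
Hypothesis phis : forall t, 0 <= t <= T -> sdiff phi (c0 t) (grad phi (c0 t)).
Hypothesis phi_neg : forall t, 0 <= t < T -> phi (c0 t) < 0.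
Hypotheses (phiT : phi (c0 T) = 0) (rate : 0 < dot (grad phi (c0 T)) (S (c0 T))).

Lemma sliding_tube : exists L q, [/\ 0 < L, 0 < q & forall t, 0 <= t <= T ->
  lip_on L S (nb (c0 t) q) /\
  (forall y z, nb (c0 t) q y -> nb (c0 t) q z -> `|phi y - phi z| <= L * `|y - z|)].
Proof.
pose P L (A : set E) := lip_on L S A /\
  (forall y z, A y -> A z -> `|phi y - phi z| <= L * `|y - z|).
have [||L [q [L0 q00 H]]] := compact_tube (traj_compact c0T) (P := P).
- move=> L L' A B LL AB [H1 H2]; split.
  + by move=> y z Ay Az; rewrite (le_trans (H1 _ _ (AB _ Ay) (AB _ Az)))// ler_wpM2r.
  + by move=> y z Ay Az; rewrite (le_trans (H2 _ _ (AB _ Ay) (AB _ Az)))// ler_wpM2r.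
- move=> _ [t + <-]; rewrite /= in_itv/= => tT.
  have [L1 [r1 [r10 H1]]] := C1at_lip (SC tT).
  have [r2 r20 H2] := near0_ex (sdiff_lip (phis tT)).
  set L2 := 3 * _ + 1 in H2.
  exists (Num.max L1 L2), (Num.min r1 r2); split; first by rewrite lt_min r10.
  split=> y z; rewrite /nb/= !lt_min => /andP[yr1 yr2] /andP[zr1 zr2].
    by rewrite (le_trans (H1 _ _ yr1 zr1))// ler_wpM2r// le_max lexx.
  by rewrite (le_trans (H2 _ _ yr2 zr2))// ler_wpM2r// le_max lexx orbT.
exists L, q; split=> // t tT; apply: H.
by exists t => //=; rewrite in_itv.
Qed.

(** The exit is a transversal hit of [phi = 0]. Sliding arcs start where [phi] is already negative,
    so [hit_single] applies from time 0; the exit point follows from the exit time by continuity of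
    [c0]. *)
Lemma sliding_exit_continuous eta : 0 < eta -> exists2 r, 0 < r & forall T1 c,
  0 <= T1 -> traj S T1 c -> (forall t, 0 <= t < T1 -> phi (c t) < 0) -> phi (c T1) = 0 ->
  `|c 0 - c0 0| < r -> `|T1 - T| <= eta /\ `|c T1 - c0 T| <= eta.
Proof.
move=> eta0; have [L [q [L0 q00 HT]]] := sliding_tube.
have TT : 0 <= T <= T by rewrite lexx ltW.
have e20 : 0 < eta / 2 by rewrite divr_gt0.
have [d d0 Hd] := (within_itvP _ _ _).1 c0T.1 T TT _ e20.
have m0 : 0 < Num.min (eta / 2) (d / 2) by rewrite lt_min e20 divr_gt0.
have FL t : 0 <= t <= T -> lip_on L S (nb (c0 t) q) by move=> /HT[].
have pL t : 0 <= t <= T -> forall y z, nb (c0 t) q y -> nb (c0 t) q z ->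
    `|phi y - phi z| <= L * `|y - z| by move=> /HT[].
have [r r0 Hr] := hit_single c0T (lexx 0) T0 L0 q00 FL pL phi_neg phiT (phis TT) rate m0.
exists r => // T1 c T10 cT cneg cphi cr.
have [|] := Hr T1 c _ cr; first by split.
rewrite le_min => /andP[Te Td] cc.
split; first by rewrite (le_trans Te)// ler_pdivrMr// ler_pMr// ler1n.
have T11 : 0 <= T1 <= T1 by rewrite lexx T10.
have := cc T1 T11; rewrite le_min => /andP[H1 _].
have H2 : `|c0 (Num.min T1 T) - c0 T| < eta / 2.
  apply: Hd; first by rewrite le_min T10 (ltW T0) ge_min lexx orbT.
  have [le|lt] := leP T1 T; last by rewrite subrr normr0.
  by rewrite (le_lt_trans Td)// ltr_pdivrMr// ltr_pMr// ltr1n.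
rewrite -(subrKA (c0 (Num.min T1 T))) (le_trans (ler_normD _ _))//.
by rewrite [leRHS]splitr lerD// ltW.
Qed.

End SlidingContinuity.

(** * Symbolic coding of an expanding map *)

Section ExpandingInterval.
Context {R : realType}.

(* A locally expanding continuous function on an interval cannot fold, since
   [F (x + s) - F x] keeps its sign. *)
Lemma expanding_itv (F : R -> R) (a b d : R) : a < b -> 0 < d ->
  {within `[a, b], continuous F} ->
  (forall s t, a <= s <= b -> a <= t <= b -> `|s - t| < d -> 2 * `|s - t| <= `|F s - F t|) ->
  2 * (b - a) <= `|F b - F a|.
Proof.
move=> ab d0 cF expd.
have ba0 : 0 < b - a by rewrite subr_gt0.
(* The step [s] divides the interval exactly and is shorter than [d], so that the expansion applies
   to each step and the increments telescope. *)
have [N N0 Nd] : exists2 N, (0 < N)%N & (b - a) / N%:R < d.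
  exists (Num.truncn ((b - a) / d)).+1 => //.
  rewrite ltr_pdivrMr ?ltr0n// mulrC -ltr_pdivrMr//.
  by have /andP[] := truncn_itv (divr_ge0 (ltW ba0) (ltW d0)).
set s := (b - a) / N%:R in Nd.
have s0 : 0 < s by rewrite divr_gt0// ltr0n.
have NsE : N%:R * s = b - a by rewrite /s mulrC divfK// pnatr_eq0 -lt0n.
have sle : s <= b - a by rewrite -NsE ler_peMl ?(ltW s0)// ler1n.
have step x : a <= x <= b - s -> 2 * s <= `|F (x + s) - F x|.
  move=> /andP[ax xb].
  have := expd (x + s) x; rewrite [x + s]addrC addrK (gtr0_norm s0) addrC; apply=> //.
    by rewrite -lerBrDr xb (le_trans ax)// lerDl ltW.
  by rewrite ax (le_trans xb)// gerBl ltW.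
have main (H : R -> R) : {within `[a, b], continuous H} ->
    (forall x, a <= x <= b - s -> 2 * s <= `|H (x + s) - H x|) -> 0 <= H (a + s) - H a ->
    2 * (b - a) <= H b - H a.
  move=> cH Hs Ha.
  pose g x := H (x + s) - H x.
  have asb : a <= b - s by rewrite lerBrDr addrC -lerBrDr.
  have cg : {within `[a, b - s], continuous g}.
    move/within_itvP in cH; apply/within_itvP => t /andP[ta tb] e e0.
    have e20 : 0 < e / 2 by rewrite divr_gt0.
    have tab : a <= t <= b by rewrite ta (le_trans tb)// gerBl ltW.
    have tsab : a <= t + s <= b by rewrite -lerBrDr tb (le_trans ta)// lerDl ltW.
    have [d1 d10 H1] := cH _ tab _ e20; have [d2 d20 H2] := cH _ tsab _ e20.
    exists (Num.min d1 d2); first by rewrite lt_min d10.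
    move=> x /andP[xa xb]; rewrite lt_min => /andP[x1 x2].
    have xab : a <= x <= b by rewrite xa (le_trans xb)// gerBl ltW.
    have xsab : a <= x + s <= b by rewrite -lerBrDr xb (le_trans xa)// lerDl ltW.
    have -> : g x - g t = (H (x + s) - H (t + s)) - (H x - H t) by rewrite /g; ring.
    rewrite (le_lt_trans (ler_normB _ _))// [ltRHS]splitr ltrD//; last exact: H1.
    by apply: H2 => //; rewrite opprD addrACA subrr addr0.
  have gpos x : a <= x <= b - s -> 2 * s <= g x.
    move=> xab; have /andP[xa xb] := xab.
    have := Hs x xab; rewrite -/(g x); have [gx|gx] := leP 0 (g x); first by rewrite ger0_norm.
    move=> _; have cgx : {within `[a, x], continuous g} by exact: within_sub (lexx _) xb cg.
    have [|c] := IVT xa cgx (v := 0).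
      by rewrite ge_min (ltW gx) orbT le_max Ha.
    rewrite in_itv/= => /andP[ac cx] gc.
    have := Hs c; rewrite ac (le_trans cx xb) -/(g c) gc normr0 => /(_ isT).
    by rewrite leNgt mulr_gt0.
  have H_N n : (n <= N)%N -> 2 * (n%:R * s) <= H (a + n%:R * s) - H a.
    elim: n => [|n IH] nN; first by rewrite mul0r addr0 mulr0 subrr.
    have := gpos (a + n%:R * s); rewrite lerDl mulr_ge0 ?(ltW s0)//= => G.
    have nsE : a + n%:R * s + s = a + n.+1%:R * s by rewrite -natr1; ring.
    have H3 : a + n%:R * s <= b - s.
      by rewrite lerBrDr nsE -lerBrDl -NsE ler_wpM2r ?(ltW s0)// ler_nat.
    have {}G := G H3; have {}IH := IH (ltnW nN); rewrite /g nsE in G.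
    have -> : 2 * (n.+1%:R * s) = 2 * s + 2 * (n%:R * s) by rewrite -natr1; ring.
    by rewrite -[leRHS](subrKA (H (a + n%:R * s))) lerD.
  have := H_N N (leqnn N); rewrite NsE.
  by rewrite [a + _]addrC subrK.
have [Fa|Fa] := leP 0 (F (a + s) - F a).
  by rewrite (le_trans (main F cF step Fa))// ler_norm.
have cN : {within `[a, b], continuous (fun x => - F x)}.
  by apply: (@within_comp _ _ _ F (fun y => - y)) cF => t _; exact: opp_continuous.
rewrite -normrN opprD (le_trans _ (ler_norm _))//; apply: (main _ cN).
  by move=> x xab; rewrite -opprD normrN; exact: step.
by rewrite -opprD oppr_ge0 ltW.
Qed.

End ExpandingInterval.

(** * Itineraries and the symbolic conjugacy *)

Section Itinerary.
Context {R : realType} {V : normedModType R}.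
Variables (K : set V) (f : V -> V) (v : V -> R) (Cv d : R).
Hypotheses (cK : compact K) (fK : forall x, K x -> K (f x)) (vc : continuous v).
Hypothesis fc : forall x, K x -> forall e, 0 < e -> exists2 r, 0 < r &
  forall y, K y -> `|y - x| < r -> `|f y - f x| < e.
Hypotheses (Cv0 : 0 < Cv) (d0 : 0 < d).
Hypothesis vK : forall x y, K x -> K y -> `|x - y| <= Cv * `|v x - v y|.
Hypothesis expd : forall x y, K x -> K y -> `|v x - v y| < d ->
  2 * `|v x - v y| <= `|v (f x) - v (f y)|.

Lemma coord_bounded : exists2 M, 0 < M & forall x, K x -> `|v x| <= M.
Proof.
have : compact (v @` K) by apply: continuous_compact => //; exact: continuous_subspaceT.
move=> /compact_bounded[M [_ HM]]; exists (Num.max M 0 + 1).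
  by rewrite ltr_wpDl// le_max lexx orbT.
move=> x Kx; apply: (HM (Num.max M 0 + 1)); last by exists x.
by rewrite (le_lt_trans (_ : M <= Num.max M 0))// ?le_max ?lexx// ltrDl.
Qed.

(** Over an interval in the image of [K], the map reads as a real function [F], continuous because
    [v] has a Lipschitz inverse on [K]. By [expanding_itv] and the intermediate value theorem its
    values cover an interval at least twice as long. *)
Lemma interval_doubles a b : a < b -> (forall t, a <= t <= b -> (v @` K) t) ->
  exists a' b', 2 * (b - a) <= b' - a' /\ forall t, a' <= t <= b' -> (v @` K) t.
Proof.
move=> ab abK.
have /choice[w wP] : forall t, exists x, a <= t <= b -> K x /\ v x = t.
  move=> t; have [tab|ntab] := boolP (a <= t <= b); last by exists point.
  by have [x Kx vx] := abK t tab; exists x.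
pose F t := v (f (w t)).
have cF : {within `[a, b], continuous F}.
  apply/within_itvP => t tab e e0; have [Kt vt] := wP t tab.
  have := @vc (f (w t)); move/(@cvgrPdist_lt _ _ _ (nbhs _)) => /(_ e e0)/nbhs_ballP[r /= r0 Hr].
  have [q q0 Hq] := fc Kt r0.
  exists (q / Cv) => [|s sab st]; first by rewrite divr_gt0.
  have [Ks vs] := wP s sab; rewrite distrC; apply: Hr; rewrite -ball_normE/= distrC.
  apply: Hq => //; rewrite (le_lt_trans (vK Ks Kt))// vs vt mulrC -ltr_pdivlMr//.
have H : 2 * (b - a) <= `|F b - F a|.
  apply: (expanding_itv ab d0 cF).
  move=> s t sab tab; have [Ks vs] := wP s sab; have [Kt vt] := wP t tab.
  by have := expd Ks Kt; rewrite vs vt.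
exists (Num.min (F a) (F b)), (Num.max (F a) (F b)); split.
  rewrite (le_trans H)//; have [ab'|ba'] := leP (F a) (F b).
    by rewrite ger0_norm ?subr_ge0.
  by rewrite ltr0_norm ?subr_lt0// opprB.
move=> t /(IVT (ltW ab) cF)[s]; rewrite in_itv/= => sab <-.
by exists (f (w s)) => //; apply: fK; exact: (wP s sab).1.
Qed.

(* An interval in [v @` K] would have images of unbounded length. *)
Lemma coord_gap a b : a < b -> exists2 t, a <= t <= b & ~ (v @` K) t.
Proof.
move=> ab; apply: contrapT => H.
have abK t : a <= t <= b -> (v @` K) t.
  by move=> tab; apply: contrapT => nt; apply: H; exists t.
have [M M0 HM] := coord_bounded.
have it n : exists a' b', n%:R * (b - a) + (b - a) <= b' - a' /\
    forall t, a' <= t <= b' -> (v @` K) t.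
  elim: n => [|n [a' [b' [ab' K']]]]; first by exists a, b; rewrite mul0r add0r.
  have ba0 : 0 < b - a by rewrite subr_gt0.
  have nba : 0 <= n%:R * (b - a) by rewrite mulr_ge0// ltW.
  have [|a2 [b2 [ab2 K2]]] := @interval_doubles a' b' _ K'.
    by rewrite -subr_gt0 (lt_le_trans _ ab')// ltr_wpDl.
  exists a2, b2; split=> //; rewrite (le_trans _ ab2)// -natr1; lra.
have ba0 : 0 < b - a by rewrite subr_gt0.
have [a' [b' [ab' K']]] := it (Num.truncn (2 * M / (b - a))).+1.
have M20 : 0 <= 2 * M / (b - a) by rewrite !divr_ge0 ?mulr_ge0// ltW.
have /andP[_] := truncn_itv M20; rewrite ltr_pdivrMr// => Mlt.
have ab'' : a' <= b'.
  rewrite -subr_ge0 (le_trans _ ab')// addr_ge0 ?mulr_ge0// ltW//.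
have [x Kx vx] := K' a' (introT andP (conj (lexx a') ab'')).
have [y Ky vy] := K' b' (introT andP (conj ab'' (lexx b'))).
have := HM x Kx; have := HM y Ky; rewrite vx vy !ler_norml => /andP[? ?] /andP[? ?].
lra.
Qed.

(** One cut is taken by [coord_gap] in each cell of a grid of mesh [d / 2]. Two values at distance
    at least [d] have a whole cell between them, hence a cut. *)
Lemma coord_cuts : exists n (c : 'I_n -> R), (forall i, ~ (v @` K) (c i)) /\
  forall x y, K x -> K y -> (forall i, (c i < v x) = (c i < v y)) -> `|v x - v y| < d.
Proof.
have [M M0 HM] := coord_bounded.
have s0 : 0 < d / 2 by rewrite divr_gt0.
pose n := (Num.truncn (2 * M / (d / 2))).+1.
have nM : 2 * M < n%:R * (d / 2).
  have M20 : 0 <= 2 * M / (d / 2) by rewrite !divr_ge0 ?mulr_ge0// ltW.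
  by have /andP[_] := truncn_itv M20; rewrite ltr_pdivrMr.
have /choice[c cP] (i : 'I_n) : exists t,
    - M + i%:R * (d / 2) <= t <= - M + i.+1%:R * (d / 2) /\ ~ (v @` K) t.
  have [|t tI tK] := @coord_gap (- M + i%:R * (d / 2)) (- M + i.+1%:R * (d / 2)).
    by rewrite ltrD2l ltr_pM2r// ltr_nat.
  by exists t.
exists n, c; split=> [i|]; first exact: (cP i).2.
suff wl x y : K x -> K y -> (forall i, (c i < v x) = (c i < v y)) -> v x <= v y -> v y - v x < d.
  move=> x y Kx Ky cxy; have [xy|/ltW yx] := leP (v x) (v y).
    by rewrite distrC ger0_norm ?subr_ge0//; exact: wl.
  by rewrite ger0_norm ?subr_ge0//; apply: wl.
move=> Kx Ky cxy xy; rewrite ltNge; apply/negP => dxy.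
have := HM x Kx; have := HM y Ky; rewrite !ler_norml => /andP[_ yM] /andP[xM _].
have x0 : 0 <= (v x + M) / (d / 2) by rewrite divr_ge0// ?(ltW s0)// -lerBlDr sub0r.
have /andP[] := truncn_itv x0; set m := Num.truncn _.
rewrite ler_pdivlMr// ltr_pdivrMr// => m1 m2.
(* As [v x] lies in cell [m], cell [m.+1] ends no higher than [v y], and its cut separates the two
   points. *)
have m3 : m.+2%:R * (d / 2) <= M + v y.
  have -> : m.+2%:R * (d / 2) = m%:R * (d / 2) + d by rewrite -!natr1; field.
  lra.
have mn : (m.+1 < n)%N.
  rewrite -(ltr_nat R) -(ltr_pM2r s0) (le_lt_trans _ nM)//.
  by rewrite -natr1 mulrDl in m3; lra.
have [/andP[c1 c2] nc] := cP (Ordinal mn).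
have : c (Ordinal mn) < v y.
  rewrite lt_neqAle; apply/andP; split; last by rewrite (le_trans c2)//; move: m3 => /=; lra.
  by apply/eqP => cy; apply: nc; exists y.
by rewrite -cxy ltNge (le_trans _ c1)//=; lra.
Qed.

Lemma iterK m x : K x -> K (iter m f x).
Proof. by move=> Kx; elim: m => //= m; exact: fK. Qed.

Lemma iter_continuous m x : K x -> forall e, 0 < e -> exists2 r, 0 < r &
  forall y, K y -> `|y - x| < r -> `|iter m f y - iter m f x| < e.
Proof.
move=> Kx; elim: m => [|m IH] e e0; first by exists e.
have [r r0 Hr] := fc (iterK m Kx) e0; have [q q0 Hq] := IH r r0.
by exists q => // y Ky yx; exact: Hr (iterK m Ky) (Hq y Ky yx).
Qed.

(* The symbol of a point records its position relative to finitely many cut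
   points outside [v @` K]; the binary coordinate plays no role. *)
Lemma expanding_conjugate : exists k (Omega : set (cantor_space * Sigma_star k)),
  [/\ (0 < k)%N, invariant_set setT (@sigma k) Omega & conjugate_on K f Omega (@sigma k)].
Proof.
have [n [c [cK' cutP]]] := coord_cuts.
pose k := #|{ffun 'I_n -> bool}|.
pose sym x : 'I_k := enum_rank [ffun i => c i < v x].
have symP x y : K x -> K y -> sym x = sym y -> `|v x - v y| < d.
  move=> Kx Ky /enum_rank_inj/ffunP sxy; apply: cutP => // i.
  by have := sxy i; rewrite !ffunE.
(* No cut is a value of [v] on [K], so the symbol is locally constant; this is the continuity of the
   coding. *)
have sym_near x : K x -> exists2 r, 0 < r & forall y, K y -> `|y - x| < r -> sym y = sym x.
  move=> Kx.
  have : \forall y \near x, forall i, (c i < v y) = (c i < v x).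
    apply: filter_forall => i; have [lt|ge] := ltP (c i) (v x).
      have := @cvgr_gt _ _ (nbhs x) (nbhs_filter x) v (v x) (@vc x) _ lt.
      by apply: filterS => y ->.
    have lt : v x < c i.
      by rewrite lt_neqAle ge andbT; apply/eqP => vxc; apply: (cK' i); exists x.
    have := @cvgr_lt _ _ (nbhs x) (nbhs_filter x) v (v x) (@vc x) _ lt.
    by apply: filterS => y yc; rewrite ltNge (ltW yc).
  move=> /nbhs_ballP[r /= r0 Hr]; exists r => // y Ky yx.
  congr enum_rank; apply/ffunP => i; rewrite !ffunE.
  by apply: Hr; rewrite -ball_normE/= distrC.
pose itin x : cantor_space * Sigma_star k := (fun=> false, fun m => sym (iter m f x)).
(* Equal symbols mean closeness below [d], which is what allows one more doubling. Long common
   itineraries thus force points together, which yields injectivity and the continuity of the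
   inverse. *)
have itin_sep m x y : K x -> K y -> (forall j, (j <= m)%N -> sym (iter j f x) = sym (iter j f y)) ->
    2 ^+ m * `|v x - v y| < d.
  move=> Kx Ky sxy.
  suff H : 2 ^+ m * `|v x - v y| <= `|v (iter m f x) - v (iter m f y)|.
    by rewrite (le_lt_trans H)//; apply: symP (sxy m (leqnn m)) => //; exact: iterK.
  elim: m sxy => [|m IH] sxy; first by rewrite expr0 mul1r.
  have Hm : `|v (iter m f x) - v (iter m f y)| < d.
    by apply: symP (sxy m _) => //; exact: iterK.
  rewrite exprS -mulrA (le_trans (ler_wpM2l _ (IH _)))//.
    by move=> j jm; apply: sxy; rewrite (leq_trans jm).
  by rewrite !iterS; apply: expd => //; exact: iterK.
have itin_close e : 0 < e -> exists m, forall x y, K x -> K y ->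
    (forall j, (j <= m)%N -> sym (iter j f x) = sym (iter j f y)) -> `|x - y| < e.
  move=> e0; have ed0 : 0 <= Cv * d / e by rewrite divr_ge0 ?mulr_ge0 ?ltW.
  exists (Num.truncn (Cv * d / e)).+1; set m := _.+1 => x y Kx Ky sxy.
  have := itin_sep m x y Kx Ky sxy.
  have /andP[_] := truncn_itv ed0; rewrite -/m ltr_pdivrMr// => Hm H.
  rewrite (le_lt_trans (vK Kx Ky))//.
  have m2 : m%:R <= 2 ^+ m :> R by rewrite -natrX ler_nat ltnW// ltn_expl.
  have m0 : 0 < m%:R :> R by rewrite ltr0n.
  rewrite -(ltr_pM2l m0) (lt_trans _ Hm)// mulrCA ltr_pM2l//.
  by rewrite (le_lt_trans _ H)// ler_wpM2r.
have itin_inj x y : K x -> K y -> itin x = itin y -> x = y.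
  move=> Kx Ky [/(congr1 (fun g : nat -> 'I_k => g)) sxy]; apply/eqP; rewrite -subr_eq0 -normr_le0.
  apply/ler_addgt0Pr => e e0; rewrite add0r ltW//.
  have [m Hm] := itin_close e e0; apply: Hm => // j _.
  by move: sxy => /(congr1 (fun g : nat -> 'I_k => g j)).
have itinS x : K x -> itin (f x) = sigma (itin x).
  by move=> Kx; rewrite /sigma/=; congr pair; apply/funext => m; rewrite /itin/= -iterSr.
exists k, (itin @` K); split.
- by rewrite /k; apply/card_gt0P; exists [ffun=> false].
- by split=> // _ [_ [x Kx <-] <-]; exists (f x); [exact: fK|exact: itinS].
exists itin; split=> [|x Kx]; last exact: itinS.
split.
- split=> [x Kx|x y /set_mem Kx /set_mem Ky|_ [x Kx <-]]; [by exists x|exact: itin_inj|by exists x].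
- apply/subspace_continuousP => x Kx.
  pose s y : Sigma_star k := fun m => sym (iter m f y).
  have c1 : (fun=> (fun=> false) : cantor_space) @ within K (nbhs x) --> ((fun=> false) : cantor_space).
    exact: cvg_cst.
  have c2 : s @ within K (nbhs x) --> s x.
    apply/cvg_sup => m A [B [[C oC <-] Cx] sBA].
    have [r r0 Hr] := sym_near _ (iterK m Kx); have [q q0 Hq] := iter_continuous m Kx r0.
    apply/nbhs_ballP; exists q => //= y; rewrite -ball_normE/= distrC => yx Ky.
    apply: sBA; move: Cx; rewrite /= /proj /s => Cx.
    by rewrite (Hr (iter m f y)) //; [exact: iterK|exact: Hq].
  exact: (cvg_pair c1 c2).
- pose psi w := get [set x | K x /\ itin x = w].
  have psiP x : K x -> psi (itin x) = x.
    move=> Kx; have [Kp] := @getPex _ [set y | K y /\ itin y = itin x] (ex_intro _ x (conj Kx erefl)).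
    exact: itin_inj.
  exists psi; split=> //; apply/subspace_continuousP => _ [x Kx <-].
  suff H : psi @ within (itin @` K) (nbhs (itin x)) --> psi (itin x) by exact: H.
  rewrite psiP//; apply/cvgrPdist_lt => e e0; have [m Hm] := itin_close e e0.
  have Nj (j : nat) : nbhs (itin x) [set w : cantor_space * Sigma_star k | w.2 j = (itin x).2 j].
    exists (setT, [set s : Sigma_star k | s j = (itin x).2 j]); last by move=> w [].
    split=> /=; first exact: filterT.
    have : nbhs ((itin x).2 : Sigma_star k) --> ((itin x).2 : Sigma_star k) by exact: cvg_id.
    move=> /cvg_sup/(_ j); apply.
    exists [set s : Sigma_star k | s j = (itin x).2 j]; split=> //.
    by exists [set a | a = (itin x).2 j] => //; exact: discrete_open.
  have N := @filter_forall _ _ (fun (j : 'I_m.+1) (w : cantor_space * Sigma_star k) =>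
    w.2 (nat_of_ord j) = (itin x).2 (nat_of_ord j)) _ (nbhs_filter (itin x)) (fun j => Nj j).
  rewrite /prop_near1 /within /nbhs/=; apply: filterS N => w wj [y Ky yw].
  rewrite -yw psiP//; apply: Hm => // j jm.
  by have := wj (Ordinal (jm : (j < m.+1)%N)); rewrite -yw /=.
Qed.

End Itinerary.

(** * The return map *)

Section ReturnMap.
Context {R : realType}.
Local Notation E := 'rV[R]_3.
Variables (Z : @filippov R) (r : nat).
Hypotheses (r1 : (1 <= r)%N) (sZ : piecewise_C Z r).
Local Notation h := (sw Z).
Local Notation X := (fX Z).
Local Notation Y := (fY Z).
Local Notation D := (dom Z).
Local Notation S := (slide Z).

Lemma sliding_open_in_switching y : sliding Z y -> \forall x \near y, switching Z x -> sliding Z x.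
Proof.
move=> [[Dy hy] Xy Yy].
have cX : {for y, continuous (lie X h)} by exact: sdiff_continuous (sm_lieX r1 sZ Dy).
have cY : {for y, continuous (lie Y h)} by exact: sdiff_continuous (sm_lieY r1 sZ Dy).
have nX := @cvgr_lt _ _ (nbhs y) (nbhs_filter y) _ _ cX _ Xy.
have nY := @cvgr_gt _ _ (nbhs y) (nbhs_filter y) _ _ cY _ Yy.
by apply: filterS2 nX nY => x Xx Yx Mx; split.
Qed.

Lemma sliding_boundary_not_sliding y : sliding_boundary Z y -> ~ sliding Z y.
Proof.
move=> [[My _] cly] /sliding_open_in_switching /cly[x [[Mx nx] Hx]].
exact: nx (Hx Mx).
Qed.

Lemma sliding_boundary_sign y : sliding_boundary Z y -> lie X h y <= 0 /\ 0 <= lie Y h y.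
Proof.
move=> [[[Dy hy] cly] _]; split.
  have cX : {for y, continuous (lie X h)} by exact: sdiff_continuous (sm_lieX r1 sZ Dy).
  rewrite leNgt; apply/negP => Xy.
  have /cly[x [[_ Xx _] Hx]] := @cvgr_gt _ _ (nbhs y) (nbhs_filter y) _ _ cX _ Xy.
  by have := lt_trans Xx Hx; rewrite ltxx.
have cY : {for y, continuous (lie Y h)} by exact: sdiff_continuous (sm_lieY r1 sZ Dy).
rewrite leNgt; apply/negP => Yy.
have /cly[x [[_ _ Yx] Hx]] := @cvgr_lt _ _ (nbhs y) (nbhs_filter y) _ _ cY _ Yy.
by have := lt_trans Yx Hx; rewrite ltxx.
Qed.

(** As the quotient in [slide] makes sense at [q0], [lie Y h] is nonzero there, hence positive, also
    nearby. A boundary point with [lie X h < 0] would then be a sliding point, so [lie X h] vanishes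
    on the boundary. There [slide] equals [X], and the rate of [lie X h] is close to its positive
    value at the fold. *)
Lemma sliding_boundary_fold q0 : sliding_boundary Z q0 -> visible_fold Z q0 -> slide_dom Z q0 ->
  exists2 rho, 0 < rho & forall y, sliding_boundary Z y -> nb q0 rho y ->
    fold_curve h X D y /\ 0 < dot (grad (lie X h) y) (S y).
Proof.
move=> bq [[Dq hq] Xq fold] [_ den].
have [_ Yq] := sliding_boundary_sign bq.
have {}Yq : 0 < lie Y h q0 by rewrite lt_neqAle Yq andbT eq_sym; move: den; rewrite Xq subr0.
have cY : {for q0, continuous (lie Y h)} by exact: sdiff_continuous (sm_lieY r1 sZ Dq).
have nY := @cvgr_gt _ _ (nbhs q0) (nbhs_filter q0) _ _ cY _ Yq.
have /nbhs_ballP[r2 /= r20 Hr2] := nY.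
set a := lie X (lie X h) q0 in fold.
have [L [r3 [r30 Hr3]]] := C1at_lip (C1at_X r1 sZ Dq).
pose B := `|X q0| + 1.
have B0 : 0 < B by rewrite ltr_wpDl.
have e0 : 0 < a / (4 * B) by rewrite divr_gt0// mulr_gt0.
have [r4 r40 Hr4] := near0_ex (sdiff_grad_near (sm_lieX r1 sZ Dq) e0).
set d := grad (lie X h) q0 in Hr4.
pose m := Num.min 1 (a / (4 * (3 * `|d| + 1))).
have d0 : 0 < 3 * `|d| + 1 by rewrite ltr_wpDl// mulr_ge0.
have m0 : 0 < m by rewrite lt_min ltr01 divr_gt0// mulr_gt0.
have L0 : 0 < `|L| + 1 by rewrite ltr_wpDl.
pose rho := Num.min (Num.min r2 r3) (Num.min r4 (m / (`|L| + 1))).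
have rho0 : 0 < rho by rewrite !lt_min r20 r30 r40 divr_gt0.
exists rho => // y by_ yr.
have : `|y - q0| < rho := yr.
rewrite /rho !lt_min => /andP[/andP[y2 y3] /andP[y4 y5]].
have [[[Dy hy] _] _] := by_.
have Yy : 0 < lie Y h y by apply: Hr2; rewrite -ball_normE/= distrC.
have Xy : lie X h y = 0.
  have [Xle _] := sliding_boundary_sign by_.
  apply/eqP; rewrite eq_le Xle/= leNgt; apply/negP => Xlt.
  by apply: (sliding_boundary_not_sliding by_); split.
split=> //; rewrite slide_eqX ?gt_eqF//.
have XL : `|X y - X q0| <= m.
  rewrite (le_trans (Hr3 y q0 y3 _)) ?subrr ?normr0//.
  move: (ltW y5); rewrite ler_pdivlMr// mulrC; apply: le_trans.
  by rewrite ler_wpM2r// (le_trans (ler_norm _))// lerDl.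
have [m1 ma] : m <= 1 /\ m <= a / (4 * (3 * `|d| + 1)).
  by split; rewrite /m ge_min lexx ?orbT.
have XB : `|X y| <= B.
  have := ler_normD (X q0) (X y - X q0); rewrite addrC subrK => H.
  by rewrite (le_trans H)// lerD2l (le_trans XL).
have G1 := Hr4 y _ y4 (sm_lieX r1 sZ Dy) (X y).
have G2 : a / (4 * B) * `|X y| <= a / 4.
  have -> : a / 4 = a / (4 * B) * B by field; rewrite gt_eqF.
  by rewrite ler_wpM2l// ltW.
have G3 : `|dot d (X y) - a| <= a / 4.
  rewrite /a /lie -/(lie X h) -/d -dotBr (le_trans (dot_le _ _))//.
  apply: (@le_trans _ _ ((3 * `|d| + 1) * m)).
    by apply: ler_pM => //; rewrite lerDl.
  move: ma; rewrite !ler_pdivlMr ?mulr_gt0// -/(lie X (lie X h) q0) -/a.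
  by have -> : m * (4 * (3 * `|d| + 1)) = (3 * `|d| + 1) * m * 4 by ring.
have {}G1 := le_trans G1 G2.
have G4 := ler_normB (dot (grad (lie X h) y) (X y) - dot d (X y)) (a - dot d (X y)).
rewrite opprB addrA subrK (distrC a) in G4.
have {}G4 := le_trans G4 (lerD G1 G3).
rewrite ltNge; apply/negP => le0; move: G4; rewrite distrC ger0_norm ?subr_ge0 ?(le_trans le0 (ltW fold))//.
have -> : a / 4 + a / 4 = a / 2 by field.
rewrite ler_pdivlMr// leNgt => /negP; apply.
rewrite (lt_le_trans (_ : a < a * 2))//; first by rewrite ltr_pMr// ltr1n.
by rewrite ler_pM2r// lerDl oppr_ge0.
Qed.

Lemma solution_traj0 (F : E -> E) (A : set E) b (c : R -> E) : solution F A `[0, b] c ->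
  traj F b c /\ forall t, 0 <= t <= b -> A (c t).
Proof.
move=> /solution_traj; rewrite subr0.
have -> : (fun t => c (t + 0)) = c by apply/funext => t; rewrite addr0.
by move=> [cT cA]; split=> // t /cA; rewrite addr0.
Qed.

(** The sliding part [e] has its own clock starting at 0; the sign of [lie X h] along it records
    that the exit at [y] is the first one. *)
Definition turn (x y : E) (tau s : R) (c e : R -> E) :=
  [/\ xarc h X D x s c, 0 < tau, traj S tau e & e 0 = c s /\ e tau = y] /\
  [/\ forall t, 0 <= t <= tau -> slide_dom Z (e t),
      forall t, 0 <= t < tau -> lie X h (e t) < 0 & fold_curve h X D y].

(** Before [s] the trajectory is off the switching surface, and from [s] until [T] it consists of
    sliding points, which are not boundary points. So the first visit to [U] happens exactly at
    [T]. *)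
Lemma first_return_turn U x y : U `<=` sliding_boundary Z ->
  fold_curve h X D x -> fold_curve h X D y -> first_return Z U x y ->
  exists tau s c e, turn x y tau s c e.
Proof.
move=> UB fx fy [s [T [c [[[/andP[s0 sT] cx] [solX hpos [Dcs hcs]] solS csl bT] [t Ht]]]]].
have [/andP[t0 tT] cty Uy _] := Ht.
have tE : t = T.
  apply/eqP; rewrite eq_le tT/= leNgt; apply/negP => tltT.
  have [ts|st] := ltP t s.
    by have := hpos t; rewrite t0 ts cty => /(_ isT); case: fy => _ ->; rewrite ltxx.
  apply: (sliding_boundary_not_sliding (UB _ Uy)); rewrite -cty; apply: csl.
  by rewrite st tltT.
rewrite tE in cty.
have [cT cD] := solution_traj0 solX.
have [eT eD] := solution_traj solS.
exists (T - s), s, c, (fun t => c (t + s)); split; split=> //.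
- by rewrite subr_gt0.
- by rewrite add0r subrK.
- move=> u /andP[u0 uT]; have [|_ Xu _] := csl (u + s); last exact: Xu.
  by rewrite lerDr u0/= -ltrBrDr.
Qed.

Lemma turn_passage x y tau s c e : turn x y tau s c e -> passage h X D S x y tau.
Proof.
move=> [[xc tau0 eT [e0 et]] [eD eX fy]].
exists s, c, (fun t => e (tau - t)); split=> //; rewrite ?subrr ?subr0//.
split; [exact: ltW|exact: traj_rev|].
move=> t /andP[t0 tt]; have [|[_ ->] //] := eD (tau - t).
by rewrite subr_ge0 tt gerBl.
Qed.

Variables p0 q0 : E.
Hypothesis shil : sliding_shilnikov Z p0 q0.

Lemma shilnikov_slide_dom : slide_dom Z q0.
Proof.
have [_ _ _ [c [[_ Sc _] _ c0 _]] _] := shil.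
by rewrite -c0; apply: Sc; rewrite in_itv/= lexx.
Qed.

(** The sliding connection in reversed time: the reference orbit that the sliding parts of all
    turns, also reversed, follow from near [q0] to near [p0]. *)
Lemma shilnikov_back : exists beta : R -> E, [/\ beta 0 = q0,
  forall T, 0 <= T -> traj (fun x => - S x) T beta,
  forall t, 0 <= t -> slide_dom Z (beta t) &
  forall e, 0 < e -> exists2 T, 0 <= T & `|beta T - p0| < e].
Proof.
have [_ _ _ [c [solc _ c0 clim]] _] := shil.
exists (fun t => c (- t)); split; first by rewrite oppr0.
- move=> T T0; have nT0 : - T <= 0 by rewrite oppr_le0.
  have [cT _] := solution_traj (solution_sub nT0 solc).
  rewrite sub0r opprK in cT; have := traj_rev cT.
  by have -> : (fun t => c (T - t - T)) = (fun t => c (- t)) by apply/funext => t; congr c; ring.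
- by move=> t t0; case: solc => _ Sc _; apply: Sc; rewrite in_itv/= oppr_le0.
- move=> e e0; move/cvgrPdist_lt in clim.
  have H : \forall t \near -oo%R, `|p0 - c t| < e /\ t < 0.
    by near=> t; split; near: t; [exact: clim|exact: nbhs_ninfty_lt].
  have [t [ct t0]] := filter_ex H.
  by exists (- t); rewrite ?opprK ?oppr_ge0 ?ltW// distrC.
Unshelve. all: by end_near. Qed.

Lemma shilnikov_turns : exists rho u Cu d, [/\ 0 < rho, 0 < Cu, 0 < d &
  [/\ forall y, sliding_boundary Z y -> nb q0 rho y ->
        fold_curve h X D y /\ 0 < dot (grad (lie X h) y) (S y),
      forall x y, fold_curve h X D x -> fold_curve h X D y -> nb q0 rho x -> nb q0 rho y ->
        `|x - y| <= Cu * `|dot u (x - y)|,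
      forall x1 y1 t1 x2 y2 t2, passage h X D S x1 y1 t1 -> passage h X D S x2 y2 t2 ->
        nb q0 rho x1 -> nb q0 rho x2 -> nb q0 rho y1 -> nb q0 rho y2 -> `|t1 - t2| <= d ->
        2 * `|dot u (x1 - x2)| <= `|dot u (y1 - y2)| &
      exists2 C, 0 < C & forall x1 s1 c1 x2 s2 c2, xarc h X D x1 s1 c1 -> xarc h X D x2 s2 c2 ->
        nb q0 rho x1 -> nb q0 rho x2 -> `|c1 s1 - c2 s2| <= C * `|x1 - x2|]].
Proof.
have [[[[Dp hp] Xp Yp] Sp unst] bq fq _ [t0 [c0 [t00 [solX c0h _] c00 c0t0]]]] := shil.
have [[Dq hq] Xq fold] := fq.
have hs x (Dx : D x) : sdiff h x (grad h x) := sdiff_h sZ Dx.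
have phis x (Dx : D x) : sdiff (lie X h) x (grad (lie X h) x) := sm_lieX r1 sZ Dx.
have XC x (Dx : D x) : C1at X x := C1at_X r1 sZ Dx.
have [c0T c0D] := solution_traj0 solX.
have denp : lie Y h p0 - lie X h p0 != 0 by rewrite gt_eqF// subr_gt0 (lt_trans Xp).
have SCp := C1at_slide r1 sZ Dp denp.
have nXp : dot (grad h p0) (X p0) != 0 by rewrite lt_eqF.
have nq : grad h q0 != 0 by case: sZ => _ _ H _ _; apply: H; split.
have qp : q0 != p0 by apply/eqP => qp; move: Xp; rewrite -qp Xq ltxx.
have [a [b [C [f [g [foc fX gX]]]]]] := focus_at_exists (hs _ Dp) SCp nXp unst.
have [beta [beta0 betaT betaD beta_lim]] := shilnikov_back.
have betaC t : 0 <= t -> C1at S (beta t).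
  by move=> /betaD[[Dt _] den]; exact: (C1at_slide r1 sZ Dt den).
have [rho1 rho10 H1] := sliding_boundary_fold bq fq shilnikov_slide_dom.
have [u [Cu [Cu0 Hu]]] := fold_curve_coord hs phis t00 c00 c0D Xq fold nq.
have [rho2 rho20 H2] := Hu 1 ltr01.
have [d [rho3 [d0 rho30 H3]]] := passage_expand hs phis XC t00 c0T c00 c0t0 c0D c0h hp hq Xq
  fold Xp foc fX gX Sp SCp qp beta0 betaT betaC beta_lim Cu0 Hu.
have [C4 [rho4 [C40 rho40 H4]]] := xarc_end hs phis XC t00 c0T c00 c0t0 c0D c0h hp fold Xp.
pose rho := Num.min (Num.min rho1 rho2) (Num.min rho3 rho4).
have rho0 : 0 < rho by rewrite !lt_min rho10 rho20 rho30.
have nbr x : nb q0 rho x -> [/\ nb q0 rho1 x, nb q0 rho2 x, nb q0 rho3 x & nb q0 rho4 x].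
  rewrite /nb/= => xr; have : `|x - q0| < rho := xr.
  by rewrite /rho !lt_min => /andP[/andP[? ?] /andP[? ?]].
exists rho, u, Cu, d; split=> //; split.
- by move=> y by_ /nbr[? _ _ _]; exact: H1.
- by move=> x y fx fy /nbr[_ xr _ _] /nbr[_ yr _ _]; exact: (H2 x y fx fy xr yr).1.
- move=> x1 y1 t1 x2 y2 t2 P1 P2 /nbr[_ _ ? _] /nbr[_ _ ? _] /nbr[_ _ ? _] /nbr[_ _ ? _].
  exact: H3.
- by exists C4 => // x1 s1 c1 x2 s2 c2 xc1 xc2 /nbr[_ _ _ ?] /nbr[_ _ _ ?]; apply: (H4 _ _ _ _ _ _ xc1 xc2).
Qed.

(** [passage_expand] compares turns of nearly equal sliding duration. The duration is continuous on
    [K], because arrival points depend continuously on the start and the exit is transversal;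
    compactness then gives a radius below which durations differ by at most [d]. *)
Lemma return_map_conjugate : exists2 V : set E, nbhs q0 V &
  forall U, U `<=` sliding_boundary Z -> U `<=` V ->
  forall K, compact K -> K `<=` U -> invariant_set (return_dom Z U) (return_map Z U) K ->
  exists k (Omega : set (cantor_space * Sigma_star k)),
    [/\ (0 < k)%N, invariant_set setT (@sigma k) Omega &
        conjugate_on K (return_map Z U) Omega (@sigma k)].
Proof.
have [rho [u [Cu [d [rho0 Cu0 d0 [Hfold Hcoord Hexp [C C0 Hend]]]]]]] := shilnikov_turns.
exists (nb q0 rho).
  by apply/nbhs_ballP; exists rho => //= y; rewrite -ball_normE/= distrC.
move=> U UB UV K cK KU [KD KK]; set pi := return_map Z U in KK *.
have piK x : K x -> K (pi x) by move=> Kx; apply: KK; exists x.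
have Kn x : K x -> nb q0 rho x by move=> /KU/UV.
have Kf x (Kx : K x) : fold_curve h X D x /\ 0 < dot (grad (lie X h) x) (S x).
  by apply: Hfold; [exact/UB/KU|exact: Kn].
have turnK x : K x -> exists tau s c e, turn x (pi x) tau s c e.
  move=> Kx; apply: (first_return_turn UB (Kf _ Kx).1 (Kf _ (piK _ Kx)).1).
  by have [_ /getPex] := KD _ Kx.
(* The sliding duration is singled out as a function of the starting point; 0 is a dummy value
   outside [K]. *)
have /choice[tau tauP] : forall x, exists tau, K x -> exists s c e, turn x (pi x) tau s c e.
  move=> x; have [/turnK[tau H]|nK] := pselect (K x); last by exists 0.
  by exists tau.
have local x eta : K x -> 0 < eta -> exists2 rx, 0 < rx & forall y, K y -> `|y - x| < rx ->
    `|tau y - tau x| <= eta /\ `|pi y - pi x| <= eta.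
  move=> Kx eta0; have [s [c [e [[xc tau0 eT [e0 et]] [eD eX fx]]]]] := tauP x Kx.
  have eC t : 0 <= t <= tau x -> C1at S (e t).
    by move=> /eD[[Dt _] den]; exact: (C1at_slide r1 sZ Dt den).
  have es t : 0 <= t <= tau x -> sdiff (lie X h) (e t) (grad (lie X h) (e t)).
    by move=> /eD[[Dt _] _]; exact: (sm_lieX r1 sZ Dt).
  have eph : lie X h (e (tau x)) = 0 by rewrite et; case: fx.
  have rate : 0 < dot (grad (lie X h) (e (tau x))) (S (e (tau x))).
    by rewrite et; exact: (Kf _ (piK _ Kx)).2.
  have [r0 r00 Hr] := sliding_exit_continuous tau0 eT eC es eX eph rate eta0.
  exists (r0 / C) => [|y Ky yx]; first by rewrite divr_gt0.
  have [s' [c' [e' [[xc' tau0' eT' [e0' et']] [eD' eX' fx']]]]] := tauP y Ky.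
  rewrite -et -et'; apply: Hr eX' _ _ => //; first exact: ltW.
    by rewrite et'; case: fx'.
  rewrite e0 e0' (le_lt_trans (Hend _ _ _ _ _ _ xc' xc (Kn _ Ky) (Kn _ Kx)))//.
  by rewrite mulrC -ltr_pdivlMr.
pose P (L : R) (A : set E) := forall y z, K y -> K z -> A y -> A z -> `|tau y - tau z| <= d.
have [||L0 [r0 [_ r00 Hr]]] := compact_tube cK (P := P).
- by move=> L L' A B _ AB PB y z Ky Kz Ay Az; apply: PB => //; exact: AB.
- move=> x Kx; have [rx rx0 Hx] := local x _ Kx (divr_gt0 d0 (ltr0n _ 2)).
  exists 0, rx; split=> // y z Ky Kz yx zx.
  have [ty _] := Hx y Ky yx; have [tz _] := Hx z Kz zx.
  have := ler_normB (tau y - tau x) (tau z - tau x).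
  rewrite opprB addrA subrK => /le_trans; apply.
  by rewrite [leRHS]splitr lerD.
(* Points of [K] whose [u]-coordinates differ by less than this are within [r0], where the durations
   are close enough. *)
have d'0 : 0 < r0 / Cu by rewrite divr_gt0.
apply: (expanding_conjugate cK piK (@dot_continuous _ u) _ Cu0 d'0).
- move=> x Kx e e0; have e20 : 0 < e / 2 by rewrite divr_gt0.
  have [rx rx0 Hx] := local x _ Kx e20; exists rx => // y Ky yx.
  have [_ Hp] := Hx y Ky yx.
  by rewrite (le_lt_trans Hp)// ltr_pdivrMr// ltr_pMr// ltr1n.
- move=> x y Kx Ky; rewrite -dotBr.
  by apply: Hcoord; [exact: (Kf _ Kx).1|exact: (Kf _ Ky).1|exact: Kn|exact: Kn].
- move=> x y Kx Ky; rewrite -!dotBr => uxy.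
  have xy : `|x - y| < r0.
    have := Hcoord x y (Kf _ Kx).1 (Kf _ Ky).1 (Kn _ Kx) (Kn _ Ky).
    by move=> /le_lt_trans; apply; rewrite mulrC -ltr_pdivlMr.
  have [s1 [c1 [e1 T1]]] := tauP x Kx; have [s2 [c2 [e2 T2]]] := tauP y Ky.
  apply: (Hexp _ _ _ _ _ _ (turn_passage T1) (turn_passage T2)); rewrite ?Kn ?piK//; do ?exact: Kn.
  - exact/Kn/piK.
  - exact/Kn/piK.
  - by apply: (Hr y Ky) => //; exact: nb_center.
Qed.

End ReturnMap.

Theorem corollary1 (R : realType) (Z : @filippov R) (r : nat) (p0 q0 : 'rV[R]_3)
    (r_ge1 : (1 <= r)%N)
    (Z_smooth : piecewise_C Z r)
    (Z_shilnikov : sliding_shilnikov Z p0 q0) :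
  exists2 V : set 'rV[R]_3, nbhs q0 V &
    forall U : set 'rV[R]_3,
      U `<=` sliding_boundary Z ->
      within (sliding_boundary Z) (nbhs q0) U ->
      U `<=` V ->
      forall K : set 'rV[R]_3,
        compact K -> K `<=` U ->
        invariant_set (return_dom Z U) (return_map Z U) K ->
        exists (k : nat) (Omega : set (cantor_space * Sigma_star k)),
          [/\ (0 < k)%N,
              invariant_set setT (@sigma k) Omega &
              conjugate_on K (return_map Z U) Omega (@sigma k)].
Proof.
have [V nV HV] := return_map_conjugate r_ge1 Z_smooth Z_shilnikov.
by exists V => // U UB _ UV K cK KU invK; exact: (HV U UB UV K cK KU invK).
Qed.
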